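(* Let $p$ be a prime with $p \equiv 1 \pmod 8$, let $b,c$ be positive integers with $p=b^{2}+c^{2}$, let $m$ be an odd integer, and let $\mathcal Q$ be a finite self-dual directly regular $4$-polytope of type $\{\{4,4\}_{(m,0)},\{4,4\}_{(m,0)}\}$ such that $p(p^{2}-1)$ does not divide $|\Gamma(\mathcal{Q})|$. Then there exists a properly self-dual chiral $4$-polytope, whose automorphism group is isomorphic to $L_{2}(p)\times \Gamma^{+}(\mathcal{Q})$, of type $\{\{4,4\}_{(m,0)},\{4,4\}_{(m,0)}\}$ if $p\mid m$, and of type $\{\{4,4\}_{(mb,mc)},\{4,4\}_{(mc,mb)}\}$ if $p\nmid m$.
   Context: An abstract $n$-polytope is a ranked poset (ranks $-1,\dots,n$) with a least and a greatest face, all flags of size $n+2$, strongly flag-connected, and satisfying the diamond condition; $\Gamma(\mathcal P)$ is its automorphism group. $\mathcal P$ is regular if $\Gamma(\mathcal P)$ is flag-transitive, and chiral if $\Gamma(\mathcal P)$ has exactly two flag orbits with adjacent flags always in distinct orbits. For regular $\mathcal P$, $\Gamma(\mathcal P)$ is generated by involutions $\rho_0,\dots,\rho_{n-1}$; the rotation subgroup $\Gamma^+(\mathcal P)$ is generated by $\sigma_i=\rho_{i-1}\rho_i$, has index at most $2$, and $\mathcal P$ is directly regular if the index is $2$. A polytope is of type $\{\mathcal P_1,\mathcal P_2\}$ if its facets are isomorphic to $\mathcal P_1$ and its vertex-figures to $\mathcal P_2$. A polytope is self-dual if it admits a duality (incidence-reversing bijection onto itself); a chiral polytope is properly self-dual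 if it admits a duality mapping each of the two flag orbits of $\Gamma(\mathcal P)$ onto itself. $\{4,4\}_{(b,c)}$ is the toroidal map obtained from the square tessellation of the plane by factoring out the translation lattice generated by $(b,c)$ and $(-c,b)$; it is regular if $bc=0$ or $b=c$ and chiral otherwise. $L_2(p)=PSL_2(p)$. *)

(* Defs.v *)
From HB Require Import structures.
From mathcomp Require Import all_boot all_order all_fingroup all_algebra.
From mathcomp Require Import all_solvable generic_quotient ring zify boolp.

Set Implicit Arguments.
Unset Strict Implicit.
Unset Printing Implicit Defensive.

Import Order.TTheory GRing.Theory Num.Theory.

(* Finite posets with a least and a greatest face are the library's
   [finTBPOrderType]s; faces are the elements of the type. *)
Section Polytopes.
Variables (d : Order.disp_t) (P : finTBPOrderType d).
Implicit Types (x y z : P) (A B Phi Psi : {set P}) (s : {perm P}).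

Definition chain A := [forall x in A, forall y in A, (x >=< y)%O].

Definition flag A := maxset chain A.

Definition flags := [set A | flag A].

(* One less than the largest number of faces in a chain strictly below x, so
   that the least face has rank -1. *)
Definition rank x : int :=
  ((\max_(A : {set P} | chain A && (A \subset [set y | (y < x)%O])) #|A|)%:Z
   - 1)%R.

Definition covers x y := (x < y)%O && [forall z, ~~ (x < z < y)%O].

Definition ranked (n : nat) :=
  (rank \top%O = n%:Z)%R /\ forall x y, covers x y -> rank y = (rank x + 1)%R.

Definition adjacent Phi Psi :=
  (#|Phi :\: Psi| == 1%N) && (#|Psi :\: Phi| == 1%N).

(* Phi and Psi differ exactly in their faces of rank i. *)
Definition adjacent_at (i : nat) Phi Psi :=
  adjacent Phi Psi && [forall x in Phi :\: Psi, (rank x == i%:Z)%R].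

Definition strongly_flag_connected :=
  forall Phi Psi, flag Phi -> flag Psi ->
    connect [rel A B | [&& flag A, flag B, adjacent A B,
                           Phi :&: Psi \subset A & Phi :&: Psi \subset B]]
            Phi Psi.

Definition diamond :=
  forall x y, (x < y)%O -> rank y = (rank x + 2)%R ->
    #|[set z | (x < z < y)%O]| = 2.

Definition polytope (n : nat) :=
  [/\ ranked n, forall Phi, flag Phi -> #|Phi| = n.+2,
      strongly_flag_connected & diamond].

Definition aut_set :=
  [set s : {perm P} | [forall x, forall y, (s x <= s y)%O == (x <= y)%O]].

Lemma aut_setP s :
  reflect {mono s : x y / (x <= y)%O} (s \in aut_set).
Proof.
rewrite inE; apply: (iffP forallP) => [h x y | h x].
  by have /forallP/(_ y)/eqP := h x.
by apply/forallP => y; rewrite h.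
Qed.

Lemma aut_group_set : group_set aut_set.
Proof.
apply/group_setP; split; first by apply/aut_setP => x y; rewrite !perm1.
move=> s t /aut_setP hs /aut_setP ht; apply/aut_setP => x y.
by rewrite !permM ht hs.
Qed.

Canonical Gamma := Group aut_group_set.

Definition regular := [transitive Gamma, on flags | 'P^*].

Definition flag_orbits := orbit 'P^* Gamma @: flags.

Definition chiral :=
  #|flag_orbits| = 2 /\
  forall Phi Psi, flag Phi -> flag Psi -> adjacent Phi Psi ->
    orbit 'P^* Gamma Phi != orbit 'P^* Gamma Psi.

(* The distinguished generator of Gamma with respect to the base flag Phi; for
   a regular polytope there is exactly one automorphism as required. *)
Definition rho Phi (i : nat) : {perm P} :=
  odflt 1%g [pick s in Gamma | adjacent_at i Phi (s @: Phi)].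

Definition sigma Phi (i : nat) : {perm P} := (rho Phi i.-1 * rho Phi i)%g.

Definition rotation_group (n : nat) Phi : {group {perm P}} :=
  <<[set sigma Phi i | i : 'I_n & 0 < i]>>%G.

Definition directly_regular (n : nat) :=
  regular /\ forall Phi, flag Phi -> #|Gamma : rotation_group n Phi|%g = 2.

Definition duality s := forall x y, (s x <= s y)%O = (y <= x)%O.

Definition self_dual := exists s, duality s.

Definition properly_self_dual :=
  exists2 s, duality s &
    forall O, O \in flag_orbits -> [set s @: (Phi : {set P}) | Phi in O] = O.

Definition section x y := [set z | (x <= z <= y)%O].

End Polytopes.

Arguments flags {d} P.
Arguments ranked {d} P n.
Arguments strongly_flag_connected {d} P.
Arguments diamond {d} P.
Arguments polytope {d} P n.
Arguments Gamma {d} P.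
Arguments regular {d} P.
Arguments flag_orbits {d} P.
Arguments chiral {d} P.
Arguments directly_regular {d} P n.
Arguments self_dual {d} P.
Arguments properly_self_dual {d} P.

(* A is isomorphic, for the induced order, to the poset K. *)
Definition isomorphic_to (d : Order.disp_t) (P : finPOrderType d)
    (A : {set P}) (d' : Order.disp_t) (K : porderType d') :=
  exists2 f : K -> P, {mono f : x y / (x <= y)%O} &
    forall z, z \in A <-> exists x, f x = z.

Definition has_type (d : Order.disp_t) (P : finTBPOrderType d) (n : nat)
    (d1 : Order.disp_t) (P1 : porderType d1)
    (d2 : Order.disp_t) (P2 : porderType d2) :=
  (forall F : P, (rank F = n%:Z - 1)%R -> isomorphic_to (section \bot%O F) P1)
  /\ (forall v : P, rank v = 0%R -> isomorphic_to (section v \top%O) P2).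

(* The cells of the square tessellation with vertex set Z^2 are indexed by
   Z^2 through twice their centres: (x, y) is the product of the cells of the
   line with centres x/2 and y/2, where an even x is the point x/2 and an odd x
   the segment from (x-1)/2 to (x+1)/2. *)
Section Toroid.
Local Open Scope ring_scope.

Definition line_incident (x y : int) :=
  (x == y) || odd `|y|%N && (`|x - y|%N == 1%N).

Definition cell_incident (u v : int * int) :=
  line_incident u.1 v.1 && line_incident u.2 v.2.

Variables b c : int.

(* The translations by Z(b,c) + Z(-c,b), in doubled coordinates. *)
Definition same_orbit (u v : int * int) : bool :=
  `[< exists s t : int, v.1 = u.1 + 2 * (s * b - t * c) /\
                        v.2 = u.2 + 2 * (s * c + t * b) >].

Lemma same_orbit_refl : reflexive same_orbit.
Proof. by move=> u; apply/asboolP; exists 0, 0; split; ring. Qed.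

Lemma same_orbit_sym : symmetric same_orbit.
Proof.
by move=> u v; apply/asboolP/asboolP => -[s [t [h1 h2]]]; exists (- s), (- t);
  rewrite h1 h2; split; ring.
Qed.

Lemma same_orbit_trans : transitive same_orbit.
Proof.
move=> v u w /asboolP[s [t [h1 h2]]] /asboolP[s' [t' [h3 h4]]].
by apply/asboolP; exists (s + s'), (t + t'); rewrite h3 h4 h1 h2; split; ring.
Qed.

Canonical same_orbit_equiv :=
  EquivRel same_orbit same_orbit_refl same_orbit_sym same_orbit_trans.

Definition torus_cell := {eq_quot same_orbit_equiv}%qT.

HB.instance Definition _ := Choice.on torus_cell.

Definition torus_cell_incident (X Y : torus_cell) : bool :=
  `[< exists u v : int * int,
        [/\ \pi_torus_cell%qT u = X, \pi_torus_cell%qT v = Y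
          & cell_incident u v] >].

(* The face poset of {4,4}_(b,c), with its two improper faces. *)
Inductive toroid := LeastFace | ProperFace of torus_cell | GreatestFace.

Definition toroid_le (F G : toroid) : bool :=
  match F, G with
  | LeastFace, _ | _, GreatestFace => true
  | ProperFace X, ProperFace Y => torus_cell_incident X Y
  | _, _ => false
  end.

HB.instance Definition _ := gen_eqMixin toroid.
HB.instance Definition _ := gen_choiceMixin toroid.

Lemma line_incident_trans : transitive line_incident.
Proof. by move=> y x z; rewrite /line_incident; lia. Qed.

Lemma line_incident_shift (x y e : int) :
  line_incident x y -> line_incident (x + 2 * e) (y + 2 * e).
Proof. by rewrite /line_incident; lia. Qed.

Lemma line_incident_anti (x y e : int) :
  line_incident x y -> line_incident y (x + 2 * e) -> x = y.
Proof. by rewrite /line_incident; lia. Qed.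

Lemma cell_incident_shift u v u' :
  cell_incident u v -> same_orbit u u' ->
  exists2 v', same_orbit v v' & cell_incident u' v'.
Proof.
move=> /andP[h1 h2] /asboolP[s [t [e1 e2]]].
exists (v.1 + 2 * (s * b - t * c), v.2 + 2 * (s * c + t * b)).
  by apply/asboolP; exists s, t.
by rewrite /cell_incident e1 e2 !line_incident_shift.
Qed.

Lemma torus_cell_eqP u v :
  reflect (\pi_torus_cell%qT u = \pi_torus_cell%qT v) (same_orbit u v).
Proof. by apply: (iffP idP) => [h|/eqquotP]; [apply/eqquotP|]. Qed.

Lemma torus_cell_incidentP u (Y : torus_cell) :
  torus_cell_incident (\pi_torus_cell%qT u) Y ->
  exists2 v, \pi_torus_cell%qT v = Y & cell_incident u v.
Proof.
move=> /asboolP[u' [v [hu hv huv]]].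
have /torus_cell_eqP hu' := hu.
have [v' hv' huv'] := cell_incident_shift huv hu'.
by exists v' => //; rewrite -hv; apply/esym/torus_cell_eqP.
Qed.

Lemma torus_cell_incident_refl : reflexive torus_cell_incident.
Proof.
elim/quotW=> u; apply/asboolP; exists u, u; split=> //.
by rewrite /cell_incident /line_incident !eqxx.
Qed.

Lemma torus_cell_incident_anti : antisymmetric torus_cell_incident.
Proof.
elim/quotW=> u Y /andP[/torus_cell_incidentP[v <- /andP[h1 h2]]].
move=> /torus_cell_incidentP[w /torus_cell_eqP].
rewrite same_orbit_sym => /asboolP[s [t [e1 e2]]] /andP[].
rewrite e1 e2 => /(line_incident_anti h1) E1 /(line_incident_anti h2) E2.
by case: u v E1 E2 {h1 h2 e1 e2} => [? ?] [? ?] /= -> ->.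
Qed.

Lemma torus_cell_incident_trans : transitive torus_cell_incident.
Proof.
move=> Y X Z; elim/quotW: X => u.
move=> /torus_cell_incidentP[v <- /andP[h1 h2]].
move=> /torus_cell_incidentP[w <- /andP[h3 h4]].
apply/asboolP; exists u, w; split=> //; apply/andP; split.
  exact: line_incident_trans h1 h3.
exact: line_incident_trans h2 h4.
Qed.

Lemma toroid_le_refl : reflexive toroid_le.
Proof. by case=> //= X; apply: torus_cell_incident_refl. Qed.

Lemma toroid_le_anti : antisymmetric toroid_le.
Proof. by case=> [|X|] [|Y|] //= /torus_cell_incident_anti ->. Qed.

Lemma toroid_le_trans : transitive toroid_le.
Proof.
by case=> [|Y|] [|X|] [|Z|] //=; apply: torus_cell_incident_trans.
Qed.

HB.instance Definition _ :=
  Order.Le_isPOrder.Build (Order.Disp tt tt) toroid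
    toroid_le_refl toroid_le_anti toroid_le_trans.

End Toroid.

Section ProjectiveSpecialLinear.
Variable p : nat.

Definition SL2_set := [set u : {'GL_2['F_p]} | (\det (GLval u) == 1)%R].

Lemma SL2_group_set : group_set SL2_set.
Proof.
apply/group_setP; split=> [|u v]; rewrite !inE ?det1 //.
by move=> /eqP hu /eqP hv; rewrite det_mulmx hu hv mulr1.
Qed.

Canonical SL2 := Group SL2_group_set.

Definition PSL2 : {group coset_of 'Z(SL2)%g} := (SL2 / 'Z(SL2))%G.

End ProjectiveSpecialLinear.

(* Main.v *)
From HB Require Import structures.
From mathcomp Require Import all_boot all_order all_fingroup all_algebra.
From mathcomp Require Import all_solvable finfield generic_quotient ring zify boolp.
Require Import Defs.

Set Implicit Arguments.
Unset Strict Implicit.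
Unset Printing Implicit Defensive.

Import Order.TTheory GRing.Theory Num.Theory.

(* Let [L] be PSL_2(p) and let [i] be a square root of -1 modulo p. The Moebius
   maps [w |-> i w + 1] and [w |-> i w] generate a quotient of the rotation group
   of the square tessellation, and together with a conjugate of the first under
   [w |-> k / w] they generate [L] and satisfy the relations of [4,4,4]^+. Hence
   flags of Q may be given voltages in [L], a flag and its adjacent ones lying in
   different orbits of the rotation group of Q receiving inverse voltages. The
   flags of the required polytope are the pairs of an element of [L] and a flag of
   Q. Closed walks of Q inside a facet have unipotent voltages fixing infinity,
   those inside a vertex-figure unipotent voltages fixing 0, so the faces of the
   cover intersect properly. The cover is connected by Goursat's lemma, since [L]
   is simple and the order of Q excludes [L] as a quotient of the rotation group.
   An automorphism exchanging adjacent flags would induce on [L] a map inverting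
   the voltages, which is impossible because [i] and [- i] differ modulo p. The
   translations of a facet of the cover are the elements of [(m)] that vanish
   modulo the prime [b + c i], whence its type. *)

(** * Flag graphs *)

(** The matrix of [w |-> i w + 1] has determinant [i], so this map lies in L only if [i] is a square
    modulo p. This is the purpose of the congruence modulo 8: it provides [z] with [z ^+ 2 = i], a
    primitive eighth root of unity, and all matrices are written in [z]. The voltage of the move 1
    is normalised to be trivial; the others are then the images of rotations fixing or moving a base
    flag. The price is paid by duality, which exchanges the moves 1 and 2, so that a correction by
    the voltage of the move 2 is needed on odd flags. The inversion [w |-> k / w] uses
    [k = 1 / (1 - i)], and its determinant may be a non-square; it acts on L without belonging to
    it. The order of L is tied to the hypothesis on Q by two factors 2 that cancel: the centre of
    [SL2 p] has order at most 2, and the rotation group has index 2. Of the two roots of -1, the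
    proof takes [i = - b / c], so that [b + c i] vanishes modulo p. *)

Section Link.
Variables (F : finType) (n : nat) (r : 'I_n -> F -> F).
Implicit Types (I J : {set 'I_n}) (x y z : F).

Definition link I := connect [rel x y | [exists i in I, y == r i x]].

Lemma link_refl I x : link I x x.
Proof. exact: connect0. Qed.

Lemma link_trans I y x z : link I x y -> link I y z -> link I x z.
Proof. exact: connect_trans. Qed.

Lemma link1 I i x : i \in I -> link I x (r i x).
Proof. by move=> iI; apply/connect1/exists_inP; exists i. Qed.

Lemma link_ind I x (P : F -> Prop) :
  P x -> (forall i y, i \in I -> link I x y -> P y -> P (r i y)) ->
  forall y, link I x y -> P y.
Proof.
move=> Px IH y /connectP[s]; elim/last_ind: s y => [|s y' IHs] y.
  by move=> _ ->.
rewrite rcons_path last_rcons => /andP[ps /exists_inP[i iI /eqP yE]] ->.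
rewrite yE; apply: IH => //; last exact: IHs.
by apply/connectP; exists s.
Qed.

Lemma link_sub I J x y : I \subset J -> link I x y -> link J x y.
Proof.
move=> sIJ; apply: (@link_ind I x (link J x)) => [|i z iI _ lz]; first exact: link_refl.
by apply: link_trans lz _; apply: link1; apply: (subsetP sIJ).
Qed.

Lemma link0 x y : link set0 x y -> x = y.
Proof. by apply: (@link_ind _ x (eq x)) => // i z; rewrite inE. Qed.

Hypothesis rK : forall i, involutive (r i).

Lemma link_sym I x y : link I x y = link I y x.
Proof.
suff H u v : link I u v -> link I v u by apply/idP/idP; apply: H.
apply: (@link_ind I u (link I ^~ u)) => [|i z iI _ lz]; first exact: link_refl.
by apply: link_trans lz; rewrite -{2}(rK i z); apply: link1.
Qed.

Lemma link_set1 i x y : link [set i] x y -> y = x \/ y = r i x.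
Proof.
apply: (@link_ind _ x (fun z => z = x \/ z = r i x)) => [|j z]; first by left.
by move=> /set1P-> _ [->|->]; [right | left; rewrite rK].
Qed.

End Link.

Lemma link_hom (F F' : finType) (n n' : nat) (r : 'I_n -> F -> F)
    (r' : 'I_n' -> F' -> F') (g : 'I_n -> 'I_n') (f : F -> F')
    (I : {set 'I_n}) (J : {set 'I_n'}) x y :
  (forall i, i \in I -> g i \in J) ->
  (forall i z, i \in I -> f (r i z) = r' (g i) (f z)) ->
  link r I x y -> link r' J (f x) (f y).
Proof.
move=> gJ fr; apply: (@link_ind _ _ _ I x (fun z => link r' J (f x) (f z))) => [|i z iI _ lz].
  exact: link_refl.
by apply: link_trans lz _; rewrite fr //; apply/link1/gJ.
Qed.

(** Moves in [A] slide past moves in [B], so any walk can be sorted, its [A] moves coming first. *)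
Lemma link_split (F : finType) (n : nat) (r : 'I_n -> F -> F)
    (A B : {set 'I_n}) x y :
  (forall i j z, i \in A -> j \in B -> r i (r j z) = r j (r i z)) ->
  link r (A :|: B) x y -> exists2 z, link r A x z & link r B z y.
Proof.
move=> rC; pose P y := exists2 z, link r A x z & link r B z y.
apply: (link_ind (P := P)) => [|i z]; first by exists x; apply: link_refl.
case/setUP=> [iA|iB] _ [t lxt ltz].
  exists (r i t); first by apply: link_trans lxt _; apply: link1.
  by apply: (link_hom (g := id)) ltz => // j u jB; apply: rC.
by exists t => //; apply: link_trans ltz _; apply: link1.
Qed.

(* The flag graph of an abstract polytope: [adj i] exchanges the face of rank
   [i], and [linkI] is what makes faces recoverable as components. *)
Record maniplex (n : nat) := Maniplex {
  mflag :> finType;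
  adj : 'I_n -> mflag -> mflag;
  base_flag : mflag;
  adjK : forall i, involutive (adj i);
  adj_neq : forall i x, adj i x <> x;
  adjC : forall (i j : 'I_n) x, i.+1 < j -> adj i (adj j x) = adj j (adj i x);
  link_all : forall x y, link adj setT x y;
  linkI : forall (I J : {set 'I_n}) x y,
    link adj I x y -> link adj J x y -> link adj (I :&: J) x y }.

(** * Faces as components of the flag graph *)

Section FacePoset.
Variables (n : nat) (M : maniplex n).
Local Notation adj := (@adj n M).
Local Notation link := (link adj).
Implicit Types (x y z : M) (k l : 'I_n.+2).

(* Face ranks are shifted by one, [k] standing for rank [k - 1], so that the
   two improper faces need no special treatment: no generator is excluded. *)
Definition others (k : nat) : {set 'I_n} := [set i : 'I_n | i.+1 != k].

(** The rank is kept beside the component because components of different ranks can coincide: both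
    improper faces have the set of all flags. *)
Definition cell k x : 'I_n.+2 * {set M} := (k, [set y | link (others k) x y]).

Definition face := {X | [exists k, exists x, X == cell k x]}.

Lemma cell_face k x : [exists l, exists y, cell k x == cell l y].
Proof. by apply/existsP; exists k; apply/existsP; exists x. Qed.

Definition mkface k x : face := Sub (cell k x) (cell_face k x).

Definition level (X : face) : 'I_n.+2 := (val X).1.

Lemma level_mkface k x : level (mkface k x) = k. Proof. by []. Qed.

Lemma faceP (X : face) : exists x, X = mkface (level X) x.
Proof.
case: X => X hX; have /existsP[k /existsP[x /eqP XE]] := hX.
by exists x; apply: val_inj => /=; rewrite /level /= XE.
Qed.

Lemma eq_mkface k x y : mkface k x = mkface k y <-> link (others k) x y.
Proof.
split=> [/(congr1 val)[/setP/(_ y)] | lxy].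
  by rewrite !inE link_refl.
apply: val_inj; rewrite /= /cell; congr pair; apply/setP=> z; rewrite !inE.
have lyx: link (others k) y x by rewrite (link_sym (@adjK _ M)).
by apply/idP/idP; apply: link_trans.
Qed.

Lemma mkface_adj (i : 'I_n) k x : i.+1 != k -> mkface k (adj i x) = mkface k x.
Proof.
move=> ik; apply/esym/eq_mkface/link1; first by rewrite inE.
Qed.

Lemma mkface_adj_neq (i : 'I_n) k x : i.+1 = k -> mkface k (adj i x) <> mkface k x.
Proof.
move=> ik /esym/eq_mkface lx.
have lx' : link [set i] x (adj i x) by apply: link1; rewrite inE.
have := linkI lx lx'; suff -> : others k :&: [set i] = set0.
  by move/link0/esym/adj_neq.
by apply/setP=> j; rewrite !inE andbC; case: (eqVneq j i) => // ->; rewrite ik eqxx.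
Qed.

(** Flags with a common face of rank [i] are joined without the move [i]; [linkI] intersects these
    conditions over all [i] outside [I], and [link_all] covers the empty intersection. *)
Lemma link_mkface (I : {set 'I_n}) x y :
  (forall i, i \notin I -> mkface (inord i.+1) x = mkface (inord i.+1) y) ->
  link I x y.
Proof.
move=> h; suff: link (\bigcap_(i in ~: I) others i.+1) x y.
  apply: link_sub; apply/subsetP=> j /bigcapP hj; apply: contraT => jI.
  by have := hj j; rewrite !inE jI eqxx => /(_ isT).
apply: (big_ind (fun J => link J x y)) => [|J K|i].
- exact: link_all.
- exact: linkI.
by rewrite inE => /h/eq_mkface; rewrite inordK // ltnS ltnS ltnW.
Qed.

Definition face_le (X Y : face) :=
  (level X <= level Y) && [exists x, (X == mkface (level X) x) && (Y == mkface (level Y) x)].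

Lemma face_leP (X Y : face) :
  reflect (level X <= level Y /\
           exists x, X = mkface (level X) x /\ Y = mkface (level Y) x)
          (face_le X Y).
Proof.
apply: (iffP andP) => -[kl].
  by case/existsP=> x /andP[/eqP hX /eqP hY]; split=> //; exists x.
by case=> x [hX hY]; split=> //; apply/existsP; exists x; rewrite -hX -hY !eqxx.
Qed.

Lemma face_le_mk k l x : k <= l -> face_le (mkface k x) (mkface l x).
Proof. by move=> kl; apply/face_leP; split=> //; exists x. Qed.

(* The generators below rank [j] commute with those above, so a flag can be
   moved above rank [j] only, and meet a face there. *)
Lemma mkface_join (j : 'I_n.+2) x y : mkface j x = mkface j y ->
  exists z, (forall k, k <= j -> mkface k z = mkface k x) /\
            (forall k, j <= k -> mkface k z = mkface k y).
Proof.
move=> /eq_mkface lxy.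
pose A := [set i : 'I_n | j < i.+1]; pose B := [set i : 'I_n | i.+1 < j].
have oE : others j = A :|: B.
  by apply/setP=> i; rewrite !inE neq_ltn orbC.
rewrite oE in lxy; have [|z lxz lzy] := link_split _ lxy.
  move=> i i' z; rewrite !inE => ji i'j; apply/esym/adjC.
  by rewrite -ltnS; apply: leq_trans ji.
exists z; split=> k kj; last first.
  apply/eq_mkface; apply: link_sub lzy.
  apply/subsetP=> i; rewrite !inE.
  by move=> ij; rewrite neq_ltn (leq_trans ij kj).
apply/esym/eq_mkface; apply: link_sub lxz; apply/subsetP=> i; rewrite !inE.
by move=> ij; rewrite neq_ltn (leq_ltn_trans kj ij) orbT.
Qed.

Lemma face_le_refl : reflexive face_le.
Proof. by move=> X; have [x ->] := faceP X; apply: face_le_mk. Qed.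

Lemma face_le_anti : antisymmetric face_le.
Proof.
move=> X Y /andP[/face_leP[kl [x [-> ->]]] /face_leP[lk _]].
by have /val_inj -> : level X = level Y :> nat by apply/eqP; rewrite eqn_leq kl.
Qed.

Lemma face_le_trans : transitive face_le.
Proof.
move=> Y X Z /face_leP[kl [x [-> YE]]] /face_leP[lm [y [YE' ->]]].
have [z [h1 h2]] := mkface_join (etrans (esym YE) YE').
by rewrite -(h1 _ kl) -(h2 _ lm); apply/face_le_mk/(leq_trans kl).
Qed.

HB.instance Definition _ := Finite.on face.
HB.instance Definition _ :=
  Order.Le_isPOrder.Build (Order.Disp tt tt) face
    face_le_refl face_le_anti face_le_trans.

Lemma mkface_improper k x y : k = ord0 \/ k = ord_max -> mkface k x = mkface k y.
Proof.
move=> hk; apply/eq_mkface; apply: link_sub (link_all x y).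
apply/subsetP=> i _; rewrite inE; case: hk => -> //=.
by rewrite neq_ltn !ltnS ltn_ord.
Qed.

Lemma face_le0 (X : face) : (mkface ord0 (base_flag M) <= X)%O.
Proof.
have [x XE] := faceP X; rewrite {}XE (mkface_improper _ x); last by left.
exact: face_le_mk.
Qed.

Lemma face_le1 (X : face) : (X <= mkface ord_max (base_flag M))%O.
Proof.
have [x XE] := faceP X; rewrite {}XE (mkface_improper _ x); last by right.
by apply: face_le_mk; rewrite -ltnS.
Qed.

HB.instance Definition _ := Order.hasBottom.Build (Order.Disp tt tt) face face_le0.
HB.instance Definition _ := Order.hasTop.Build (Order.Disp tt tt) face face_le1.

End FacePoset.

(** * The face poset is an abstract polytope *)

Section FacePolytope.
Variables (n : nat) (M : maniplex n).
Local Notation adj := (@adj n M).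
Local Notation link := (link adj).
Local Notation mkface := (@mkface n M).
Local Notation P := (face M).
Implicit Types (x y z : M) (k l : 'I_n.+2) (X Y Z : P).

Lemma le_faceP X Y :
  reflect (level X <= level Y /\
           exists x, X = mkface (level X) x /\ Y = mkface (level Y) x)
          (X <= Y)%O.
Proof. exact: face_leP. Qed.

Lemma le_mkface k l x : (mkface k x <= mkface l x)%O = (k <= l).
Proof. by apply/idP/idP => [/le_faceP[]//|]; apply: face_le_mk. Qed.

Lemma lt_mkface k l x : (mkface k x < mkface l x)%O = (k < l).
Proof. by rewrite lt_leAnge !le_mkface -ltnNge andbC; case: ltnP => // /ltnW->. Qed.

Lemma lt_mkfacer X k x : X = mkface (level X) x -> (X < mkface k x)%O = (level X < k).
Proof. by move=> XE; rewrite {1}XE lt_mkface. Qed.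

Lemma lt_mkfacel X k x : X = mkface (level X) x -> (mkface k x < X)%O = (k < level X).
Proof. by move=> XE; rewrite {1}XE lt_mkface. Qed.

Lemma level_lt X Y : (X < Y)%O -> level X < level Y.
Proof.
move=> /[dup] /ltW /le_faceP[le_l [x [XE YE]]]; rewrite ltn_neqAle le_l andbT.
by rewrite XE YE lt_mkface => lt; rewrite neq_ltn lt.
Qed.

Lemma level_inj (C : {set P}) : chain C -> {in C &, injective (@level n M)}.
Proof.
move=> /forall_inP cC X Y XC YC eXY.
have /forall_inP/(_ Y YC) := cC X XC.
case/orP=> /le_faceP[_ [x [-> ->]]]; by rewrite eXY.
Qed.

(** Induction on the level [j]: a flag through the members of the chain up to level [j] is glued by
    [mkface_join] to one through the next member. The invariant records the last level [i] reached,
    since the gluing happens at that face, which must stay comparable with the whole chain. *)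
Lemma chain_common (C : {set P}) : chain C ->
  exists x, forall X, X \in C -> X = mkface (level X) x.
Proof.
move=> cC; suff H j : j < n.+2 -> exists x (i : 'I_n.+2),
    [/\ i <= j, forall X, X \in C -> level X <= j ->
          X = mkface (level X) x /\ level X <= i
      & forall X, X \in C -> (mkface i x >=< X)%O].
  have [x [i [_ h _]]] := H n.+1 (ltnSn _).
  by exists x => X XC; case: (h X XC) => //; rewrite -ltnS.
elim: j => [_|j IH ltj].
  exists (base_flag M), ord0; split=> // X XC; last first.
    by apply/orP; left; apply: face_le0.
  rewrite leqn0 => /eqP X0; split; last by rewrite X0.
  have [x XE] := faceP X; rewrite {1}XE; apply: mkface_improper.
  by left; apply: val_inj.
have [x [i [ij h1 h2]]] := IH (ltnW ltj).
case: (pickP (fun X => (X \in C) && (level X == j.+1 :> nat))) => [Y|hN]; last first.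
  exists x, i; split=> // [|X XC]; first exact: ltnW.
  rewrite leq_eqVlt ltnS => /orP[lX|]; last exact: h1.
  by have:= hN X; rewrite XC lX.
case/andP=> YC /eqP lY.
have /le_faceP[_ [y [XE YE]]] : (mkface i x <= Y)%O.
  case/orP: (h2 Y YC) => // /le_faceP[]; rewrite level_mkface lY => lij.
  by have := leq_trans lij ij; rewrite ltnn.
have [z [hz1 hz2]] := mkface_join XE.
have YEz : Y = mkface (level Y) z by rewrite hz2 // lY leqW.
exists z, (level Y); split=> [|X XC|X XC]; first by rewrite lY.
  move=> hX; split; [move: hX | by rewrite lY].
  rewrite leq_eqVlt ltnS => /orP[/eqP lX|lX]; last first.
    have [XEx lXi] := h1 _ XC lX.
    by rewrite hz1.
  have -> : X = Y by apply: (level_inj cC) => //; apply: val_inj; rewrite /= lX.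
  by [].
by rewrite -YEz; have /forall_inP/(_ X XC) := (forall_inP cC) Y YC.
Qed.

Definition flag_of x : {set P} := [set mkface k x | k : 'I_n.+2].

Lemma mem_flag_of X x : (X \in flag_of x) = (X == mkface (level X) x).
Proof. by apply/imsetP/eqP => [[k _ ->]//|->]; exists (level X). Qed.

Lemma chain_flag_of x : chain (flag_of x).
Proof.
apply/forall_inP=> X; rewrite mem_flag_of => /eqP->; apply/forall_inP=> Y.
by rewrite mem_flag_of => /eqP->; rewrite /Order.comparable !le_mkface leq_total.
Qed.

Lemma card_flag_of x : #|flag_of x| = n.+2.
Proof.
rewrite card_imset ?card_ord // => k l /(congr1 (@level n M)).
by rewrite !level_mkface.
Qed.

Lemma flag_faceP (A : {set P}) : flag A <-> exists x, A = flag_of x.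
Proof.
split=> [/maxsetP[cA maxA]|[x ->]].
  have [x hx] := chain_common cA; exists x; apply/esym/maxA.
    exact: chain_flag_of.
  by apply/subsetP=> X XA; rewrite mem_flag_of -hx.
apply/maxsetP; split=> [|B cB sAB]; first exact: chain_flag_of.
have [y hy] := chain_common cB; apply/eqP; rewrite eqEsubset sAB andbT.
apply/subsetP=> X XB; rewrite (hy X XB).
have: mkface (level X) x \in B by rewrite (subsetP sAB) // mem_flag_of.
by move/hy; rewrite level_mkface => <-; rewrite mem_flag_of.
Qed.

Lemma flag_flag_of x : flag (flag_of x).
Proof. by apply/flag_faceP; exists x. Qed.

Lemma eq_flag_of x y : flag_of x = flag_of y -> x = y.
Proof.
move=> eF; apply: (@link0 _ _ adj); apply: link_mkface => i _.
have: mkface (inord i.+1) x \in flag_of y by rewrite -eF mem_flag_of.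
by rewrite mem_flag_of => /eqP.
Qed.

Lemma widen_ord_le_inj (a b : nat) (le_ab : a <= b) : injective (widen_ord le_ab).
Proof. by move=> i j /(congr1 val) ij; apply: val_inj. Qed.

Lemma card_below k : #|[set l : 'I_n.+2 | l < k]| = k.
Proof.
have le_k : k <= n.+2 by apply: ltnW.
rewrite -[RHS]card_ord -(card_imset _ (@widen_ord_le_inj _ _ le_k)).
congr #|pred_of_set _|; apply/setP=> l; rewrite inE; apply/idP/imsetP => [lk|[j _ ->] //=].
by exists (Ordinal lk) => //; apply: val_inj.
Qed.

(** A chain below [X] has distinct levels, all below that of [X], and the lower faces of a flag
    through [X] attain this bound. *)
Lemma rank_face X : rank X = ((level X)%:Z - 1)%R.
Proof.
rewrite /rank; congr (_%:Z - 1)%R; apply/eqP; rewrite eqn_leq; apply/andP; split.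
  apply/bigmax_leqP=> A /andP[cA /subsetP sA].
  rewrite -(card_in_imset (level_inj cA)).
  apply: (leq_trans (n := #|[set l : 'I_n.+2 | l < level X]|)).
    apply/subset_leq_card/subsetP=> _ /imsetP[Y YA ->]; rewrite inE.
    by apply: level_lt; have := sA Y YA; rewrite inE.
  by rewrite card_below.
have [x XE] := faceP X.
pose A := [set mkface l x | l in [set l : 'I_n.+2 | l < level X]].
have <- : #|A| = level X.
  by rewrite card_imset ?card_below // => k l /(congr1 (@level n M)).
apply: leq_bigmax_cond; apply/andP; split.
  apply/forall_inP=> _ /imsetP[k _ ->]; apply/forall_inP=> _ /imsetP[l _ ->].
  by rewrite /Order.comparable !le_mkface leq_total.
apply/subsetP=> _ /imsetP[k hk ->]; rewrite !inE XE lt_mkface.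
by rewrite inE in hk.
Qed.

Lemma covers_level X Y : covers X Y -> level Y = (level X).+1 :> nat.
Proof.
case/andP=> ltXY /forallP hN; have /le_faceP[_ [x [XE YE]]] := ltW ltXY.
have := level_lt ltXY; rewrite leq_eqVlt => /orP[/eqP->//|lt2].
have lt3: (level X).+1 < n.+2 by apply: leq_trans (ltn_ord (level Y)); apply: ltnW.
have := hN (mkface (Ordinal lt3) x).
by rewrite (lt_mkfacer _ XE) (lt_mkfacel _ YE) /= ltnSn lt2.
Qed.

Lemma face_ranked : ranked P n.
Proof.
split=> [|X Y /covers_level lXY]; rewrite !rank_face.
  by rewrite level_mkface /=; lia.
by rewrite lXY; lia.
Qed.

Lemma adjacent_flag_of x i : adjacent (flag_of x) (flag_of (adj i x)).
Proof.
have H y : flag_of y :\: flag_of (adj i y) = [set mkface (inord i.+1) y].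
  have iE : val (@inord n.+1 i.+1) = i.+1 by rewrite /= inordK // ltnS ltnS ltnW.
  apply/setP=> X; rewrite !inE !mem_flag_of andbC.
  apply/andP/eqP => [[/eqP XE]|XE].
    case: (eqVneq (i.+1) (level X)) => [iX _|iX]; first by rewrite iX inord_val.
    by rewrite mkface_adj // -XE eqxx.
  split; rewrite XE level_mkface //.
  by apply/eqP=> /esym; apply: mkface_adj_neq; rewrite iE.
rewrite /adjacent H; have := H (adj i x); rewrite adjK => ->.
by rewrite !cards1.
Qed.

Lemma adjacent_adj x y : adjacent (flag_of x) (flag_of y) -> exists i, y = adj i x.
Proof.
case/andP=> /cards1P[X XE] _.
have xNy : x <> y by move=> xy; move: XE; rewrite xy setDv => /setP/(_ X); rewrite !inE eqxx.
have hk k : k != level X -> mkface k x = mkface k y.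
  move=> kX; apply/eqP; apply: contraTT kX => hk; rewrite negbK.
  have /setP/(_ (mkface k x)) := XE; rewrite !inE !mem_flag_of level_mkface eqxx hk.
  by move/esym/eqP <-.
pose I := [set i : 'I_n | i.+1 == level X].
have lxy : link I x y.
  apply: link_mkface => i; rewrite inE => iX; apply: hk; apply: contraNneq iX => <-.
  by rewrite inordK // ltnS ltnS ltnW.
case: (pickP (mem I)) => [i iI|I0]; last first.
  case: xNy; apply: (@link0 _ _ adj); apply: link_sub lxy.
  by apply/subsetP=> i; rewrite [i \in I]I0.
exists i; have IE : I \subset [set i].
  apply/subsetP=> j; move: iI; rewrite !inE => /eqP <- /eqP[ji].
  by apply/eqP/val_inj.
by have [/esym|] := link_set1 (@adjK _ M) (link_sub IE lxy).
Qed.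

Lemma face_flag_connected : strongly_flag_connected P.
Proof.
move=> _ _ /flag_faceP[x ->] /flag_faceP[y ->]; set R := (X in connect X _ _).
(* Only the ranks at which the two flags differ are moved, so every flag of the walk keeps their
   common faces. *)
pose I := [set i : 'I_n | mkface (inord i.+1) x != mkface (inord i.+1) y].
have: link I x y by apply: link_mkface => i; rewrite inE negbK => /eqP.
apply: (@link_ind _ _ _ I x (fun z => connect R (flag_of x) (flag_of z))) => [|i z iI lxz IH].
  exact: connect0.
apply: connect_trans IH _; apply: connect1.
have H t : link I x t -> flag_of x :&: flag_of y \subset flag_of t.
  move=> lxt; apply/subsetP=> X; rewrite inE !mem_flag_of => /andP[/eqP Xx /eqP Xy].
  apply/eqP; rewrite {1}Xx; apply/eq_mkface; apply: link_sub lxt.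
  apply/subsetP=> j; rewrite !inE; apply: contraNneq => jX.
  have -> : inord j.+1 = level X by apply: val_inj; rewrite /= jX inord_val.
  by rewrite -Xx {1}Xy.
rewrite /R /= !flag_flag_of adjacent_flag_of !H //.
by apply: link_trans lxz _; apply: link1.
Qed.

(** Two flags through [X] and [Y] are joined by moves of other ranks. Among these the move [i]
    between [X] and [Y] commutes with all others, and the others do not affect the middle face; so
    that face takes only the values given by [x] and [adj i x]. *)
Lemma face_diamond : diamond P.
Proof.
move=> X Y ltXY; rewrite !rank_face => lXY.
have {}lXY : level Y = (level X).+2 :> nat by lia.
have /le_faceP[_ [x [XE YE]]] := ltW ltXY.
have ltX : level X < n by have := ltn_ord (level Y); rewrite lXY.
pose i := Ordinal ltX; have kP : (level X).+1 < n.+2 by rewrite ltnS ltnS ltnW.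
pose k := Ordinal kP.
have -> : [set Z | (X < Z < Y)%O] = [set mkface k x; mkface k (adj i x)].
  apply/setP=> Z; rewrite !inE; apply/andP/orP => [[XZ ZY]|]; last first.
    have X' : X = mkface (level X) (adj i x) by rewrite mkface_adj //= neq_ltn ltnSn orbT.
    have Y' : Y = mkface (level Y) (adj i x) by rewrite mkface_adj //= lXY neq_ltn ltnSn.
    by case=> /eqP->; [rewrite XE YE | rewrite X' Y']; rewrite !lt_mkface /= lXY !ltnSn.
  have lZ : level Z = k.
    by apply: val_inj; apply/eqP; rewrite eqn_leq /= (level_lt XZ) andbT -ltnS -lXY level_lt.
  have [|z hz] := @chain_common [set X; Y; Z].
    apply/forall_inP=> U hU; apply/forall_inP=> V hV.
    move: hU hV (ltW ltXY) (ltW XZ) (ltW ZY); rewrite !inE /Order.comparable.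
    by move=> /orP[/orP[]|] /eqP-> /orP[/orP[]|] /eqP-> XY' XZ' ZY';
      rewrite ?lexx ?XY' ?XZ' ?ZY' ?orbT.
  have Xz : X = mkface (level X) z by apply: hz; rewrite !inE eqxx.
  have Yz : Y = mkface (level Y) z by apply: hz; rewrite !inE eqxx ?orbT.
  have -> : Z = mkface k z by rewrite -lZ; apply: hz; rewrite !inE eqxx ?orbT.
  have l1 : link (others n (level X)) x z by apply/eq_mkface; rewrite -XE.
  have l2 : link (others n (level Y)) x z by apply/eq_mkface; rewrite -YE.
  pose B := others n k :&: others n (level X) :&: others n (level Y).
  have [||t /(link_set1 (@adjK _ M)) tE ltz] := @link_split _ _ adj [set i] B x z.
  - move=> i' j t /set1P-> ; rewrite !inE lXY /= => /andP[/andP[h1 h2] h3].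
    case: (ltngtP j i) => [ji|ij|]; last first.
    + by move=> ij; move: h1; rewrite ij eqxx.
    + by apply: adjC; rewrite ltn_neqAle ij andbT -eqSS eq_sym.
    by apply/esym/adjC; rewrite ltn_neqAle ji andbT.
  - apply: link_sub (linkI l1 l2); apply/subsetP=> j; rewrite !inE => /andP[-> ->].
    by rewrite !andbT eqSS; apply: orbN.
  have <- : mkface k t = mkface k z.
    apply/eq_mkface; apply: link_sub ltz; apply/subsetP=> j.
    by rewrite inE => /andP[]; rewrite inE => /andP[].
  by case: tE => ->; rewrite eqxx; [left|right].
rewrite cards2; case: eqP => // /esym E.
by case: (mkface_adj_neq (erefl : i.+1 = k) E).
Qed.

Lemma face_polytope : polytope P n.
Proof.
split; [exact: face_ranked | | exact: face_flag_connected | exact: face_diamond].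
by move=> _ /flag_faceP[x ->]; apply: card_flag_of.
Qed.

End FacePolytope.

(** * Automorphisms, flag orbits and dualities of the face poset *)

Section OrderAutomorphisms.
Variables (d : Order.disp_t) (P : finTBPOrderType d).
Implicit Types (x y : P) (A : {set P}) (s : {perm P}).

Lemma chain_mono s A :
  (forall x y, (x >=< y)%O -> (s x >=< s y)%O) -> chain A -> chain (s @: A).
Proof.
move=> sC /forall_inP cA; apply/forall_inP=> _ /imsetP[x xA ->].
apply/forall_inP=> _ /imsetP[y yA ->]; apply: sC.
by have /forall_inP/(_ y yA) := cA x xA.
Qed.

Lemma chain_aut s A : s \in Gamma P -> chain A -> chain (s @: A).
Proof.
by move=> /aut_setP sm; apply: chain_mono => x y; rewrite /Order.comparable !sm.
Qed.

Lemma imset_permK s A : s^-1%g @: (s @: A) = A.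
Proof.
rewrite -imset_comp -[RHS]imset_id; apply: eq_imset => x /=.
by rewrite permK.
Qed.

Lemma flag_perm s A :
  (forall B, chain B -> chain (s @: B)) ->
  (forall B, chain B -> chain (s^-1%g @: B)) ->
  flag A -> flag (s @: A).
Proof.
move=> sC sVC /maxsetP[cA maxA]; apply/maxsetP; split=> [|B cB sAB].
  exact: sC.
have sAB' : A \subset s^-1%g @: B by rewrite -{1}(imset_permK s A) imsetS.
have E := maxA _ (sVC _ cB) sAB'.
by rewrite -E -{1}[s]invgK imset_permK.
Qed.

Lemma flag_aut s A : s \in Gamma P -> flag A -> flag (s @: A).
Proof.
by move=> sG; apply: flag_perm => B; apply: chain_aut; rewrite ?groupV.
Qed.

Lemma rank_aut s x : s \in Gamma P -> rank (s x) = rank x.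
Proof.
suff H t y : t \in Gamma P -> (rank y <= rank (t y))%R.
  move=> sG; apply/le_anti; rewrite H // andbT.
  by have := H s^-1%g (s x); rewrite permK groupV; apply.
move=> tG; rewrite /rank lerD2r lez_nat; apply/bigmax_leqP=> A /andP[cA /subsetP sA].
rewrite -(card_imset _ (@perm_inj _ t)); apply: leq_bigmax_cond.
rewrite chain_aut //; apply/subsetP=> _ /imsetP[z zA ->].
have /aut_setP tm := tG; have := sA z zA.
by rewrite !inE !lt_leAnge !tm.
Qed.

End OrderAutomorphisms.

Section FaceAutomorphisms.
Variables (n : nat) (M : maniplex n).
Local Notation adj := (@adj n M).
Local Notation mkface := (@mkface n M).
Local Notation P := (face M).
Implicit Types (x y z : M) (k l : 'I_n.+2) (X Y Z : P) (f : {perm M}).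

Definition maut_set := [set f : {perm M} | [forall i, forall x, f (adj i x) == adj i (f x)]].

Lemma mautP f : reflect (forall i x, f (adj i x) = adj i (f x)) (f \in maut_set).
Proof.
rewrite inE; apply: (iffP forallP) => [h i x|h i].
  by have /forallP/(_ x)/eqP := h i.
by apply/forallP => x; rewrite h.
Qed.

Lemma maut_group_set : group_set maut_set.
Proof.
apply/group_setP; split; first by apply/mautP => i x; rewrite !perm1.
move=> f g /mautP hf /mautP hg; apply/mautP => i x.
by rewrite !permM hf hg.
Qed.

Canonical maut := Group maut_group_set.

Lemma maut_eq f g x : f \in maut -> g \in maut -> f x = g x -> f = g.
Proof.
move=> /mautP hf /mautP hg fgx; apply/permP=> y.
apply: (link_ind (P := fun y => f y = g y)) (link_all x y) => // i z _ _ E.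
by rewrite hf hg E.
Qed.

Definition face_rep X : M := odflt (base_flag M) [pick x | X == mkface (level X) x].

Lemma face_repK X : mkface (level X) (face_rep X) = X.
Proof.
rewrite /face_rep; case: pickP => [x /eqP//|h].
by have [x XE] := faceP X; have /eqP[] := h x.
Qed.

(** One construction for automorphisms, where [h] and [g] are identities, and for dualities, where
    both are [rev_ord]. A face is sent through any flag containing it, which is legitimate because
    [f] carries components to components. *)
Lemma face_perm_ex (h : 'I_n -> 'I_n) (g : 'I_n.+2 -> 'I_n.+2) f :
  injective g -> (forall i x, f (adj i x) = adj (h i) (f x)) ->
  (forall (i : 'I_n) k, ((h i).+1 == g k) = (i.+1 == k)) ->
  exists s : {perm P}, forall k x, s (mkface k x) = mkface (g k) (f x).
Proof.
move=> g_inj fh hg; pose s0 X := mkface (g (level X)) (f (face_rep X)).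
have s0E k x : s0 (mkface k x) = mkface (g k) (f x).
  have := face_repK (mkface k x); rewrite level_mkface => /eq_mkface l.
  apply/eq_mkface; apply: (link_hom (g := h)) l => [i|i z _]; last exact: fh.
  by rewrite !inE level_mkface hg.
have s0_inj : injective s0.
  move=> X Y; have [x XE] := faceP X; have [y YE] := faceP Y.
  rewrite XE YE !s0E => E; have kl : level X = level Y.
    by apply: g_inj; have := congr1 (@level n M) E; rewrite !level_mkface.
  rewrite kl in E *; move/eq_mkface: E => l; apply/eq_mkface.
  pose J := [set h i | i in others n (level Y)].
  have lJ : link adj J (f x) (f y).
    have h_inj : injective h.
      move=> i j ij; pose k := @inord n.+1 i.+1.
      have kE : i.+1 = k :> nat by rewrite inordK // ltnS ltnS ltnW.
      by have := hg i k; rewrite ij hg kE eqxx -kE => /eqP[/val_inj].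
    apply: link_sub l; apply/subsetP=> j jo; apply/imsetP.
    have [hV _ hK] := injF_bij h_inj; exists (hV j); rewrite ?hK //.
    by rewrite inE -hg hK; rewrite inE in jo.
  rewrite -[x](permK f) -[y](permK f).
  pose Q z := link adj (others n (level Y)) (f^-1%g (f x)) (f^-1%g z).
  apply: (@link_ind _ _ adj J (f x) Q) lJ.
    exact: link_refl.
  move=> _ z /imsetP[i io ->] _ lz; apply: link_trans lz _.
  by rewrite -{2}[z](permKV f) -fh permK; apply: link1.
by exists (perm s0_inj) => k x; rewrite permE s0E.
Qed.

(** The condition on [f] sits inside the specification, with the identity as default, so that
    [face_perm] is total and can be packed as a morphism. *)
Lemma face_perm_sig f :
  {s : {perm P} | f \in maut -> forall k x, s (mkface k x) = mkface k (f x)}.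
Proof.
pose p s := [forall k, forall x, s (mkface k x) == mkface k (f x)].
exists (odflt 1%g [pick s : {perm P} | p s]) => /mautP fM k x.
case: pickP => [s /forallP/(_ k)/forallP/(_ x)/eqP//|h].
have [s sE] := @face_perm_ex id id f (@inj_id _) fM (fun _ _ => erefl).
have /negP[] := negbT (h s); apply/forallP=> l; apply/forallP=> y; apply/eqP/sE.
Qed.

Definition face_perm f : {perm P} := sval (face_perm_sig f).

Lemma face_permE f k x : f \in maut -> face_perm f (mkface k x) = mkface k (f x).
Proof. by move=> fM; apply: (svalP (face_perm_sig f)). Qed.

Lemma imset_flag_of (g : 'I_n.+2 -> 'I_n.+2) f (s : {perm P}) x :
  injective g -> (forall k y, s (mkface k y) = mkface (g k) (f y)) ->
  s @: flag_of x = flag_of (f x).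
Proof.
move=> g_inj sE; apply/eqP.
rewrite eqEcard card_imset ?card_flag_of ?leqnn ?andbT; last exact: perm_inj.
apply/subsetP=> Y /imsetP[X]; rewrite mem_flag_of => /eqP XE ->.
by rewrite XE sE mem_flag_of.
Qed.

Lemma face_perm_flag f x : f \in maut -> face_perm f @: flag_of x = flag_of (f x).
Proof.
by move=> fM; apply: (imset_flag_of (g := id)) => // k y; apply: face_permE.
Qed.

Lemma face_perm_Gamma f : f \in maut -> face_perm f \in Gamma P.
Proof.
move=> fM; apply/aut_setP.
have H h X Y : h \in maut -> (X <= Y)%O -> (face_perm h X <= face_perm h Y)%O.
  by move=> hM /le_faceP[kl [x [-> ->]]]; rewrite !face_permE // le_mkface.
move=> X Y; apply/idP/idP; last exact: H.
suff K Z : face_perm f^-1 (face_perm f Z) = Z.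
  by move=> le_s; have := H _ _ _ (groupVr fM) le_s; rewrite !K.
by have [x ->] := faceP Z; rewrite !face_permE ?groupV // permK.
Qed.

(** An order automorphism permutes flags and keeps ranks, so flags differing at one rank have images
    differing at that rank only; the induced map on flags commutes with every [adj i]. *)
Lemma Gamma_face_perm s : s \in Gamma P -> exists2 f, f \in maut & s = face_perm f.
Proof.
move=> sG; have sF x : exists y, s @: flag_of x == flag_of y.
  by have /flag_faceP[y ->] := flag_aut sG (flag_flag_of x); exists y.
pose f0 x := xchoose (sF x); have f0E x : s @: flag_of x = flag_of (f0 x).
  by apply/eqP; apply: (xchooseP (sF x)).
have f0_inj : injective f0.
  move=> x y /(congr1 (@flag_of n M)); rewrite -!f0E => /imset_inj E.
  by apply: eq_flag_of; apply: E; apply: perm_inj.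
have sE k x : s (mkface k x) = mkface k (f0 x).
  have : s (mkface k x) \in flag_of (f0 x) by rewrite -f0E imset_f // mem_flag_of.
  rewrite mem_flag_of => /eqP->; congr mkface; apply: val_inj.
  by have := rank_aut (mkface k x) sG; rewrite !rank_face level_mkface => /addIr[].
pose f := perm f0_inj; have fM : f \in maut.
  apply/mautP=> i x; rewrite !permE.
  have l : link adj [set i] (f0 x) (f0 (adj i x)).
    apply: link_mkface => j; rewrite inE => ji; rewrite -!sE mkface_adj //.
    by rewrite inordK ?ltnS 1?ltnW // eqSS; apply: contraNneq ji => ij; apply/eqP/val_inj.
  have [/f0_inj/adj_neq//|//] := link_set1 (@adjK _ M) l.
exists f => //; apply/permP=> X; have [x ->] := faceP X.
by rewrite face_permE // sE permE.
Qed.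

Lemma Gamma_isog_maut : Gamma P \isog maut.
Proof.
rewrite isog_sym.
have mf : {in maut &, {morph face_perm : f g / (f * g)%g}}.
  move=> f g fM gM; apply/permP=> X; have [x ->] := faceP X.
  by rewrite permM !face_permE ?groupM // permM.
apply/isogP; exists (Morphism mf).
  apply/injmP=> f g fM gM /= E; apply: (maut_eq (x := base_flag M)) => //.
  by apply: eq_flag_of; rewrite -!face_perm_flag // E.
rewrite morphimEdom; apply/setP=> s; apply/imsetP/idP => [[f fM ->]|].
  exact: face_perm_Gamma.
by move/Gamma_face_perm=> [f fM ->]; exists f.
Qed.

Variable par : M -> bool.
Hypothesis par_adj : forall i x, par (adj i x) = ~~ par x.
Hypothesis par_orbit : forall x y, (exists2 f, f \in maut & f x = y) <-> par x = par y.

Definition par_flags (e : bool) := [set flag_of x | x in par @^-1: [set e]].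

Lemma mem_par_flags e x : (flag_of x \in par_flags e) = (par x == e).
Proof.
apply/imsetP/idP => [[y]|xe]; first by rewrite !inE => ye /eq_flag_of ->.
by exists x; rewrite // !inE.
Qed.

Lemma orbit_flag_of x : orbit 'P^* (Gamma P) (flag_of x) = par_flags (par x).
Proof.
apply/setP=> A; apply/orbitP/imsetP => [[s sG <-]|[y]].
  have [f fM ->] := Gamma_face_perm sG; exists (f x).
    by rewrite !inE; apply/eqP/esym/par_orbit; exists f.
  by rewrite -face_perm_flag.
rewrite !inE => /eqP/esym/par_orbit[f fM <-] ->; exists (face_perm f).
  exact: face_perm_Gamma.
by rewrite -face_perm_flag.
Qed.

(** [par] is a two-colouring of the flag graph whose classes are the orbits of [maut M]; a first
    move, available as [0 < n], reaches the second class. *)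
Lemma face_chiral : 0 < n -> chiral P.
Proof.
move=> n_gt0; pose i0 := Ordinal n_gt0.
have H x y : orbit 'P^* (Gamma P) (flag_of x) = orbit 'P^* (Gamma P) (flag_of y) -> par x = par y.
  rewrite !orbit_flag_of => /setP/(_ (flag_of x)).
  by rewrite !mem_par_flags eqxx => /esym/eqP.
split=> [|_ _ /flag_faceP[x ->] /flag_faceP[y ->] /adjacent_adj[i ->]]; last first.
  by apply/eqP=> /H; rewrite par_adj; case: (par x).
pose x0 := base_flag M.
have -> : flag_orbits P = [set par_flags (par x0); par_flags (par (adj i0 x0))].
  apply/setP=> O; rewrite !inE; apply/imsetP/orP.
    case=> A; rewrite inE => /flag_faceP[x ->] ->; rewrite orbit_flag_of par_adj.
    by case: (par x) (par x0) => [] []; rewrite eqxx; [left|right|right|left].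
  case=> /eqP->; rewrite -orbit_flag_of; [exists (flag_of x0) | exists (flag_of (adj i0 x0))];
    by rewrite // inE flag_flag_of.
rewrite cards2; case: eqP => //; rewrite -!orbit_flag_of => /H.
by rewrite par_adj; case: (par x0).
Qed.

Variable dual : {perm M}.
Hypothesis dual_adj : forall i x, dual (adj i x) = adj (rev_ord i) (dual x).

Lemma face_dual : exists2 s : {perm P}, duality s &
  forall k x, s (mkface k x) = mkface (rev_ord k) (dual x).
Proof.
have [i k|s sE] := face_perm_ex rev_ord_inj dual_adj.
  by rewrite /=; apply/eqP/eqP; have := ltn_ord i; have := ltn_ord k; lia.
have dualV_adj i x : dual^-1%g (adj i x) = adj (rev_ord i) (dual^-1%g x).
  by apply: (@perm_inj _ dual); rewrite dual_adj !permKV rev_ordK.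
have [i k|t tE] := face_perm_ex rev_ord_inj dualV_adj.
  by rewrite /=; apply/eqP/eqP; have := ltn_ord i; have := ltn_ord k; lia.
exists s => // X Y.
have revle k l : k <= l -> rev_ord l <= rev_ord k by move=> kl; apply: leq_sub2l.
apply/idP/idP => [|/le_faceP[kl [x [-> ->]]]]; last by rewrite !sE le_mkface revle.
have tK Z : t (s Z) = Z by have [x ->] := faceP Z; rewrite sE tE permK rev_ordK.
case/le_faceP=> kl [x [XE YE]]; rewrite -(tK X) -(tK Y) XE YE !tE le_mkface.
exact: revle.
Qed.

Lemma face_properly_self_dual : (forall x, par (dual x) = par x) -> properly_self_dual P.
Proof.
move=> dual_par; have [s sd sE] := face_dual; exists s => // O /imsetP[A].
rewrite inE => /flag_faceP[x ->] ->; rewrite orbit_flag_of.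
apply/eqP; rewrite eqEcard card_imset ?leqnn ?andbT; last exact/imset_inj/perm_inj.
apply/subsetP=> _ /imsetP[B /imsetP[y yx ->] ->].
rewrite (imset_flag_of y rev_ord_inj sE) mem_par_flags dual_par.
by rewrite !inE in yx.
Qed.

End FaceAutomorphisms.

(** * Flags of a polytope *)

(** Used to recover ranks: a strictly increasing labelling of [n.+2] faces by [n.+2] levels leaves
    no choice. *)
Lemma strict_mono_id (m : nat) (g : 'I_m -> 'I_m) :
  (forall k l : 'I_m, k < l -> g k < g l) -> g =1 id.
Proof.
move=> gm; have ge (k : 'I_m) : k <= g k.
  case: k => k; elim: k => [|k IH] hk //=.
  apply: leq_ltn_trans (IH (ltnW hk)) _; exact: gm.
have le (j : nat) (k : 'I_m) : m = j + k.+1 -> g k <= k.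
  elim: j k => [|j IH] k mE.
    by have := ltn_ord (g k); lia.
  have hk : k.+1 < m by lia.
  rewrite -ltnS; apply: leq_trans (IH (Ordinal hk) _); last by rewrite /=; lia.
  exact: gm.
move=> k; apply/val_inj/eqP; rewrite eqn_leq ge andbT.
by apply: (le (m - k.+1)); rewrite subnK.
Qed.

Section FlagManiplex.
Variables (d : Order.disp_t) (P : finTBPOrderType d) (n : nat).
Hypothesis hP : polytope P n.
Implicit Types (x y z : P) (k l : 'I_n.+2) (i j : 'I_n).

Lemma rank_ge x : (-1 <= rank x)%R.
Proof. by rewrite /rank; lia. Qed.

Lemma rank_lt x y : (x < y)%O -> (rank x < rank y)%R.
Proof.
move=> xy; rewrite /rank ltrD2r ltz_nat.
pose below := [pred A : {set P} | chain A && (A \subset [set y | (y < x)%O])].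
have [|A /andP[cA /subsetP sA] ->] := @eq_bigmax_cond _ below (fun A => #|A|).
  apply/card_gt0P; exists set0; rewrite inE sub0set andbT.
  by apply/forall_inP=> z; rewrite inE.
have xA : x \notin A by apply/negP=> /sA; rewrite inE ltxx.
rewrite -[_.+1](_ : #|x |: A| = _); last by rewrite cardsU1 xA.
apply: leq_bigmax_cond; apply/andP; split; last first.
  apply/subsetP=> z /setU1P[->|/sA]; rewrite !inE // => zx; exact: lt_trans xy.
apply/forall_inP=> u /setU1P hu; apply/forall_inP=> v /setU1P hv.
have lx w : w \in A -> (w <= x)%O by move/sA; rewrite inE => /ltW.
case: hu hv => [->|uA] [->|vA].
- exact: comparablexx.
- by rewrite /Order.comparable lx ?orbT.
- by rewrite /Order.comparable lx.
by have /forall_inP/(_ v vA) := (forall_inP cA) u uA.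
Qed.

Lemma rank_le x y : (x <= y)%O -> (rank x <= rank y)%R.
Proof. by rewrite le_eqVlt => /predU1P[->//|/rank_lt/ltW]. Qed.

Definition lev x : 'I_n.+2 := inord `|(rank x + 1)%R|%N.

Lemma levE x : (rank x = (lev x)%:Z - 1)%R.
Proof.
have [[rT _] _ _ _] := hP; have := rank_le (lex1 x); rewrite rT => le_x.
have r_ge := rank_ge x; rewrite /lev inordK; lia.
Qed.

Lemma lev_lt x y : (x < y)%O -> lev x < lev y.
Proof. by move/rank_lt; rewrite !levE; lia. Qed.

Lemma chain_lev_inj (A : {set P}) : chain A -> {in A &, injective lev}.
Proof.
move=> /forall_inP cA x y xA yA exy; have /forall_inP/(_ y yA) := cA x xA.
by case: comparableP => // /lev_lt; rewrite exy ltnn.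
Qed.

Lemma chain_flag (A : {set P}) : chain A -> #|A| = n.+2 -> flag A.
Proof.
move=> cA oA; apply/maxsetP; split=> // B cB sAB; apply/esym/eqP.
rewrite eqEcard sAB oA -(card_in_imset (chain_lev_inj cB)) -[leqRHS]card_ord.
exact: max_card.
Qed.

Definition pflag := {A : {set P} | flag A}.
HB.instance Definition _ := Finite.on pflag.
Implicit Types A B C : pflag.

Lemma pflag_chain A : chain (val A).
Proof. by have /maxsetP[] := valP A. Qed.

Lemma pface_ex A k : exists x, (x \in val A) && (lev x == k).
Proof.
have [_ /(_ _ (valP A)) oA _ _] := hP.
have /eqP E : lev @: val A == setT.
  rewrite eqEcard subsetT cardsT card_ord.
  by rewrite (card_in_imset (chain_lev_inj (pflag_chain A))) oA leqnn.
have: k \in lev @: val A by rewrite E inE.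
by case/imsetP=> x xA ->; exists x; rewrite xA eqxx.
Qed.

Lemma pface_sig A k : {x | (x \in val A) && (lev x == k)}.
Proof. by have h := xchooseP (pface_ex A k); exists (xchoose (pface_ex A k)). Qed.

Definition pface A k : P := sval (pface_sig A k).

Lemma pface_in A k : pface A k \in val A.
Proof. by have /andP[] := svalP (pface_sig A k). Qed.

Lemma lev_pface A k : lev (pface A k) = k.
Proof. by have /andP[_ /eqP] := svalP (pface_sig A k). Qed.

Lemma pface_lev A x : x \in val A -> pface A (lev x) = x.
Proof.
move=> xA; apply: (chain_lev_inj (pflag_chain A)) => //; first exact: pface_in.
exact: lev_pface.
Qed.

Lemma pface_lt A k l : k < l -> (pface A k < pface A l)%O.
Proof.
move=> kl; have /forall_inP/(_ _ (pface_in A l)) := forall_inP (pflag_chain A) _ (pface_in A k).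
case: comparableP => // [/lev_lt|/(congr1 lev) E].
  by rewrite !lev_pface ltnNge ltnW.
by move: kl; rewrite !lev_pface in E; rewrite E ltnn.
Qed.

Lemma pflag_eq A B : (forall k, pface A k = pface B k) -> A = B.
Proof.
move=> E; apply: val_inj; apply/setP=> x.
by apply/idP/idP => /pface_lev <-; rewrite ?E ?pface_in // -E pface_in.
Qed.

Lemma pface_bot A : pface A ord0 = \bot%O.
Proof.
have := le0x (pface A ord0); rewrite le_eqVlt => /predU1P[//|/lev_lt].
by rewrite lev_pface.
Qed.

Lemma pface_top A : pface A ord_max = \top%O.
Proof.
have := lex1 (pface A ord_max); rewrite le_eqVlt => /predU1P[//|/lev_lt].
by rewrite lev_pface ltnNge -ltnS ltn_ord.
Qed.

Lemma pflag_of_chain (g : 'I_n.+2 -> P) : (forall k l, k < l -> (g k < g l)%O) ->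
  exists A, forall k, pface A k = g k.
Proof.
move=> gm; have levg : forall k, lev (g k) = k.
  by apply: (@strict_mono_id _ (lev \o g)) => k l /gm/lev_lt.
have g_inj : injective g by move=> k l /(congr1 lev); rewrite !levg.
have cA : chain [set g k | k : 'I_n.+2].
  apply/forall_inP=> _ /imsetP[k _ ->]; apply/forall_inP=> _ /imsetP[l _ ->].
  case: (ltngtP k l) => [/gm/ltW|/gm/ltW|/val_inj->]; rewrite /Order.comparable ?lexx //.
    by move=> ->.
  by move=> ->; rewrite orbT.
have oA : #|[set g k | k : 'I_n.+2]| = n.+2 by rewrite card_imset ?card_ord.
exists (Sub _ (chain_flag cA oA)) => k.
by rewrite -{1}(levg k) pface_lev //= imset_f.
Qed.

Lemma diamond_uniq x y z z1 z2 : lev y = (lev x).+2 :> nat ->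
  (x < z < y)%O -> (x < z1 < y)%O -> (x < z2 < y)%O -> z1 <> z -> z2 <> z -> z1 = z2.
Proof.
move=> lxy hz h1 h2 z1z z2z; have [_ _ _ /(_ x y)] := hP.
have xy : (x < y)%O by case/andP: hz; apply: lt_trans.
have rxy : (rank y = rank x + 2)%R by rewrite !levE lxy; lia.
move=> /(_ xy rxy)/eqP/cards2P[u [v [uv E]]].
have [+ + +] : [/\ z \in [set u; v], z1 \in [set u; v] & z2 \in [set u; v]].
  by rewrite -E !inE.
rewrite !inE => /orP[] /eqP zE /orP[] /eqP z1E /orP[] /eqP z2E; congruence.
Qed.

Lemma diamond_other x y z : lev y = (lev x).+2 :> nat ->
  (x < z < y)%O -> exists2 z', (x < z' < y)%O & z' <> z.
Proof.
move=> lxy hz; have [_ _ _ /(_ x y)] := hP.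
have xy : (x < y)%O by case/andP: hz; apply: lt_trans.
have rxy : (rank y = rank x + 2)%R by rewrite !levE lxy; lia.
move=> /(_ xy rxy)/eqP/cards2P[u [v [uv E]]].
have Eb w : (x < w < y)%O = (w == u) || (w == v) by have /setP/(_ w) := E; rewrite !inE.
have [hu hv] : (x < u < y)%O /\ (x < v < y)%O by rewrite !Eb !eqxx orbT.
case: (eqVneq u z) => [uz|/eqP]; last by exists u.
by exists v => // vz; rewrite uz vz eqxx in uv.
Qed.

Definition lo i : 'I_n.+2 := inord i.
Definition mid i : 'I_n.+2 := inord i.+1.
Definition hi i : 'I_n.+2 := inord i.+2.

Lemma loE i : lo i = i :> nat. Proof. by rewrite inordK //; have := ltn_ord i; lia. Qed.
Lemma midE i : mid i = i.+1 :> nat. Proof. by rewrite inordK //; have := ltn_ord i; lia. Qed.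
Lemma hiE i : hi i = i.+2 :> nat. Proof. by rewrite inordK //; have := ltn_ord i; lia. Qed.

Lemma pface_mid A i : (pface A (lo i) < pface A (mid i) < pface A (hi i))%O.
Proof. by rewrite !pface_lt // ?loE ?midE ?hiE. Qed.

(** The diamond condition supplies a second face between the neighbours of the face at [mid i], and
    exchanging the two gives a chain of full size. The boolean equality says at once that the face
    at [mid i] changes and that no other does. *)
Lemma padj_ex i A : exists B, [forall k, (pface B k == pface A k) == (k != mid i)].
Proof.
have [||z /andP[z1 z2] zN] := @diamond_other (pface A (lo i)) (pface A (hi i)) (pface A (mid i)).
- by rewrite !lev_pface hiE loE.
- exact: pface_mid.
have lz : lev z = mid i.
  apply/val_inj/eqP; rewrite eqn_leq /= midE; have := lev_lt z1; have := lev_lt z2.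
  by rewrite !lev_pface loE hiE; lia.
pose B0 := z |: (val A :\ pface A (mid i)).
have zA : z \notin val A by apply/negP=> /pface_lev; rewrite lz => /esym.
have cB : chain B0.
  have cz y : y \in val A -> y != pface A (mid i) -> (z >=< y)%O.
    move=> yA yN; have yE := pface_lev yA; rewrite -yE in yN *.
    case: (ltngtP (lev y) (mid i)) => [ly|ly|ly]; last by rewrite (val_inj ly) eqxx in yN.
      apply/orP; right; apply/ltW; apply: le_lt_trans z1.
      move: ly; rewrite midE ltnS leq_eqVlt -loE => /predU1P[/val_inj->//|ly].
      by apply/ltW/pface_lt.
    apply/orP; left; apply/ltW; apply: lt_le_trans z2 _.
    move: ly; rewrite midE leq_eqVlt -hiE => /predU1P[/val_inj->//|ly].
    by apply/ltW/pface_lt.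
  apply/forall_inP=> u /setU1P hu; apply/forall_inP=> v /setU1P hv.
  case: hu hv => [->|/setD1P[uN uA]] [->|/setD1P[vN vA]].
  - exact: comparablexx.
  - exact: cz.
  - by rewrite comparable_sym; apply: cz.
  by have /forall_inP/(_ v vA) := (forall_inP (pflag_chain A)) u uA.
have oB : #|B0| = n.+2.
  have [_ /(_ _ (valP A)) oA _ _] := hP.
  have := cardsD1 (pface A (mid i)) (val A); rewrite pface_in oA /= add1n => -[oA'].
  by rewrite cardsU1 -oA' in_setD1 (negPf zA) andbF.
pose B : pflag := Sub B0 (chain_flag cB oB).
exists B; apply/forallP=> k; apply/eqP; case: (eqVneq k (mid i)) => [->|kN] /=.
  have -> : pface B (mid i) = z by rewrite -lz pface_lev //= setU11.
  exact/eqP.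
apply/eqP; rewrite -{1}(lev_pface A k) pface_lev //=; apply/setU1P; right.
apply/setD1P; split; last exact: pface_in.
by apply: contra_neq kN => /(congr1 lev); rewrite !lev_pface.
Qed.

Lemma padj_sig i A : {B | [forall k, (pface B k == pface A k) == (k != mid i)]}.
Proof. by have h := xchooseP (padj_ex i A); exists (xchoose (padj_ex i A)). Qed.

Definition padj i A : pflag := sval (padj_sig i A).

Lemma padjP i A k : (pface (padj i A) k == pface A k) = (k != mid i).
Proof. by have /forallP/(_ k)/eqP := svalP (padj_sig i A). Qed.

Lemma pface_padj i A k : k != mid i -> pface (padj i A) k = pface A k.
Proof. by rewrite -(padjP i A) => /eqP. Qed.

Lemma padj_mid i A : pface (padj i A) (mid i) <> pface A (mid i).
Proof. by apply/eqP; rewrite padjP eqxx. Qed.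

Lemma padj_face i A B : pface B (lo i) = pface A (lo i) ->
  pface B (hi i) = pface A (hi i) -> pface B (mid i) <> pface A (mid i) ->
  pface B (mid i) = pface (padj i A) (mid i).
Proof.
move=> hlo hhi hm.
have lN : lo i != mid i by rewrite -val_eqE /= loE midE neq_ltn ltnSn.
have hN : hi i != mid i by rewrite -val_eqE /= hiE midE neq_ltn ltnSn orbT.
apply: (@diamond_uniq (pface A (lo i)) (pface A (hi i)) (pface A (mid i))) => //.
- by rewrite !lev_pface hiE loE.
- exact: pface_mid.
- by rewrite -hlo -hhi; apply: pface_mid.
- by rewrite -(pface_padj A lN) -(pface_padj A hN); apply: pface_mid.
exact: padj_mid.
Qed.

Lemma padj_uniq i A B : (forall k, k != mid i -> pface B k = pface A k) -> B <> A ->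
  B = padj i A.
Proof.
move=> h BA; have hm : pface B (mid i) <> pface A (mid i).
  move=> hm; apply: BA; apply: pflag_eq => k.
  by case: (eqVneq k (mid i)) => [->|/h].
apply: pflag_eq => k; case: (eqVneq k (mid i)) => [->|kN]; last by rewrite h // pface_padj.
by apply: padj_face => //; apply: h; rewrite -val_eqE /= ?loE ?hiE midE neq_ltn ltnSn ?orbT.
Qed.

Lemma padj_neq i A : padj i A <> A.
Proof. by move=> E; apply: (@padj_mid i A); rewrite E. Qed.

Lemma padjK i : involutive (padj i).
Proof.
move=> A; apply/esym/padj_uniq => [k kN|]; first by rewrite pface_padj.
by move/esym/padj_neq.
Qed.

(** For non-consecutive [a] and [b] the move [b] fixes the faces at [lo a], [mid a] and [hi a], so
    by [padj_face] the move [a] produces the same new face before and after it. *)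
Lemma padjC i j A : i.+1 < j -> padj i (padj j A) = padj j (padj i A).
Proof.
move=> ij; have ijN : mid i != mid j by rewrite -val_eqE /= !midE eqSS neq_ltn ltnW.
have far (a b : 'I_n) k : (a.+1 < b) || (b.+1 < a) ->
    [|| k == lo a, k == hi a | k == mid a] -> k != mid b.
  by rewrite -!val_eqE /= loE hiE !midE; lia.
have H (a b : 'I_n) : (a.+1 < b) || (b.+1 < a) ->
    pface (padj a (padj b A)) (mid a) = pface (padj b (padj a A)) (mid a).
  move=> ab; rewrite [RHS]pface_padj; last by apply: far ab _; rewrite eqxx !orbT.
  have E k : [|| k == lo a, k == hi a | k == mid a] -> pface (padj b A) k = pface A k.
    by move=> dual_scale; apply/pface_padj/(far _ _ _ ab).
  apply: padj_face.
  - by rewrite pface_padj ?E ?eqxx // -val_eqE /= loE midE neq_ltn ltnSn.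
  - by rewrite pface_padj ?E ?eqxx ?orbT // -val_eqE /= hiE midE neq_ltn ltnSn orbT.
  by rewrite -(E (mid a)) ?eqxx ?orbT //; apply: padj_mid.
apply: pflag_eq => k; case: (eqVneq k (mid i)) => [->|ki]; first by apply: H; rewrite ij.
case: (eqVneq k (mid j)) => [->|kj]; first by apply/esym/H; rewrite ij orbT.
by rewrite !pface_padj.
Qed.

Lemma adjacent_padj A B : adjacent (val A) (val B) ->
  exists2 i, B = padj i A & val A :\: val B = [set pface A (mid i)].
Proof.
case/andP=> /cards1P[x xE] _.
have /setDP[xA xB] : x \in val A :\: val B by rewrite xE set11.
have hk k : k != lev x -> pface B k = pface A k.
  move=> kx; have : pface A k \notin val A :\: val B.
    by rewrite xE inE; apply: contra_neq kx => <-; rewrite lev_pface.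
  by rewrite inE pface_in andbT negbK => /pface_lev; rewrite lev_pface.
have l0 : lev x != ord0.
  by apply: contraNneq xB => l0; rewrite -(pface_lev xA) l0 pface_bot -(pface_bot B) pface_in.
have l1 : lev x != ord_max.
  by apply: contraNneq xB => l1; rewrite -(pface_lev xA) l1 pface_top -(pface_top B) pface_in.
have lx : (lev x).-1 < n.
  by move: l0 l1 (ltn_ord (lev x)); rewrite -!val_eqE /=; lia.
pose i := Ordinal lx; have lE : lev x = mid i.
  by apply: val_inj; rewrite /= midE /= prednK // lt0n.
exists i; last by rewrite xE -lE pface_lev.
apply: padj_uniq => [k|BA]; first by rewrite -lE; apply: hk.
by rewrite BA xA in xB.
Qed.

(** Strong flag-connectedness in a form from which the intersection property is immediate. Each step
    of a walk keeping the common faces of [A] and [B] is some [padj i], and [i] lies in [I], as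
    otherwise a common face would have changed. *)
Lemma link_padj (I : {set 'I_n}) A B :
  link padj I A B <-> forall i, i \notin I -> pface A (mid i) = pface B (mid i).
Proof.
split=> [lAB i iI|h].
  apply: (link_ind (P := fun B => pface A (mid i) = pface B (mid i))) lAB => // j C jI _ ->.
  rewrite pface_padj // -val_eqE /= !midE eqSS; apply: contraNneq iI => ij.
  by rewrite (_ : i = j) //; apply: val_inj.
have [_ _ /(_ _ _ (valP A) (valP B)) + _] := hP; set R := (X in connect X _ _).
move=> cAB; suff H C : connect R (val A) (val C) -> link padj I A C by apply: H.
case/connectP=> s; elim/last_ind: s C => [|s C' IH] C.
  by move=> _ /= /val_inj ->; apply: link_refl.
rewrite rcons_path last_rcons => /andP[ps RC] CE; rewrite -{C'}CE in RC.
case/and5P: RC => fD fC aDC sD sC; pose D : pflag := Sub _ fD.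
have lAD : link padj I A D by apply: IH.
have [i CE DC] := @adjacent_padj D C aDC; rewrite CE.
apply: link_trans lAD _; apply: link1; apply: contraT => /h E.
have xAB : pface A (mid i) \in val A :&: val B by rewrite inE pface_in E pface_in.
have xC := subsetP sC _ xAB; have xD := subsetP sD _ xAB.
have := pface_lev (A := C) xC; have := pface_lev (A := D) xD.
by rewrite lev_pface => <-; rewrite CE => /padj_mid.
Qed.

Lemma padj_link_all A B : link padj setT A B.
Proof. by apply/link_padj=> i; rewrite inE. Qed.

Lemma padj_linkI (I J : {set 'I_n}) A B :
  link padj I A B -> link padj J A B -> link padj (I :&: J) A B.
Proof.
move=> /link_padj hI /link_padj hJ; apply/link_padj=> i.
by rewrite inE negb_and => /orP[/hI|/hJ].
Qed.

Definition flag_maniplex A : maniplex n :=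
  @Maniplex n pflag padj A padjK padj_neq padjC padj_link_all padj_linkI.

Lemma pflag_ex x : exists A, x \in val A.
Proof.
have [|A fA sA] := @maxset_exists _ (@chain d P) [set x].
  apply/forall_inP=> y /set1P->; apply/forall_inP=> z /set1P->; exact: comparablexx.
by exists (Sub A fA); rewrite /= -sub1set.
Qed.

Lemma lev_aut s x : s \in Gamma P -> lev (s x) = lev x.
Proof. by move=> sG; rewrite /lev rank_aut. Qed.

(** Defined for every permutation, with [A] itself as value when the image is not a flag; it serves
    both automorphisms and dualities. *)
Definition flag_act (s : {perm P}) A : pflag := insubd A (s @: val A).

Lemma val_flag_act s A : s \in Gamma P -> val (flag_act s A) = s @: val A.
Proof. by move=> sG; rewrite insubdK //; apply: flag_aut => //; apply: valP. Qed.

Lemma flag_actM s t A : s \in Gamma P -> t \in Gamma P ->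
  flag_act (s * t) A = flag_act t (flag_act s A).
Proof.
move=> sG tG; apply: val_inj; rewrite !val_flag_act ?groupM // -imset_comp.
by apply: eq_imset => x; rewrite /= permM.
Qed.

Lemma flag_act1 A : flag_act 1 A = A.
Proof.
apply: val_inj; rewrite val_flag_act ?group1 // -[RHS]imset_id.
by apply: eq_imset => x; rewrite perm1.
Qed.

Lemma pface_act s A k : s \in Gamma P -> pface (flag_act s A) k = s (pface A k).
Proof.
move=> sG; have lk : lev (s (pface A k)) = k by rewrite lev_aut // lev_pface.
by rewrite -{1}lk pface_lev // val_flag_act // imset_f // pface_in.
Qed.

Lemma flag_act_inj s : s \in Gamma P -> injective (flag_act s).
Proof.
move=> sG A B /(congr1 val); rewrite !val_flag_act // => /imset_inj E.
by apply/val_inj/E/perm_inj.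
Qed.

Lemma flag_act_padj s i A : s \in Gamma P -> flag_act s (padj i A) = padj i (flag_act s A).
Proof.
move=> sG; apply: padj_uniq => [k kN|/(flag_act_inj sG)/padj_neq//].
by rewrite !pface_act // pface_padj.
Qed.

Lemma flag_act_eq s t A : s \in Gamma P -> t \in Gamma P ->
  flag_act s A = flag_act t A -> s = t.
Proof.
move=> sG tG E.
have {}E B : flag_act s B = flag_act t B.
  apply: (link_ind (P := fun B => flag_act s B = flag_act t B)) (padj_link_all A B) => //.
  by move=> i C _ _ EC; rewrite (flag_act_padj i C sG) (flag_act_padj i C tG) EC.
apply/permP=> x; have [B xB] := pflag_ex x.
by rewrite -(pface_lev xB) -(pface_act B _ sG) -(pface_act B _ tG) E.
Qed.

Section Duality.
Variable s : {perm P}.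
Hypothesis sd : duality s.

Lemma dualityV : duality s^-1%g.
Proof. by move=> x y; rewrite -{2}(permKV s x) -{2}(permKV s y) sd. Qed.

Lemma chain_duality t (C : {set P}) : duality t -> chain C -> chain (t @: C).
Proof.
by move=> td; apply: chain_mono => x y; rewrite /Order.comparable !td orbC.
Qed.

Lemma val_dual A : val (flag_act s A) = s @: val A.
Proof.
rewrite insubdK //; apply: flag_perm (valP A) => B; apply: chain_duality => //.
exact: dualityV.
Qed.

(** Along a flag the reversed levels of the images increase strictly, so [strict_mono_id] determines
    them. *)
Lemma lev_dual x : lev (s x) = rev_ord (lev x).
Proof.
have [A xA] := pflag_ex x.
pose g k := rev_ord (lev (s (pface A k))).
have gm k l : k < l -> g k < g l.
  move=> kl; have : (s (pface A l) < s (pface A k))%O.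
    by rewrite lt_leAnge !sd -lt_leAnge pface_lt.
  move/lev_lt; rewrite /g /=; have := ltn_ord (lev (s (pface A k))); lia.
have := strict_mono_id gm (lev x); rewrite /g pface_lev // => <-.
by rewrite rev_ordK.
Qed.

Lemma pface_dual A k : pface (flag_act s A) k = s (pface A (rev_ord k)).
Proof.
have lk : lev (s (pface A (rev_ord k))) = k by rewrite lev_dual lev_pface rev_ordK.
by rewrite -{1}lk pface_lev // val_dual imset_f // pface_in.
Qed.

Lemma dual_act_inj : injective (flag_act s).
Proof.
move=> A B /(congr1 val); rewrite !val_dual => /imset_inj E.
by apply/val_inj/E/perm_inj.
Qed.

Lemma dual_padj i A : flag_act s (padj i A) = padj (rev_ord i) (flag_act s A).
Proof.
apply: padj_uniq => [k kN|/dual_act_inj/padj_neq//].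
rewrite !pface_dual pface_padj //; apply: contra_neq kN => /(congr1 (@rev_ord _)).
rewrite rev_ordK => ->; apply: val_inj; rewrite /= !midE /=.
by have := ltn_ord i; lia.
Qed.

End Duality.

Section Rotation.
Variable Phi : pflag.
Hypotheses (hreg : regular P)
  (hrot : #|Gamma P : rotation_group n (val Phi)|%g = 2).
Local Notation rot := (rotation_group n (val Phi)).

Lemma flag_trans A B : exists2 s, s \in Gamma P & flag_act s A = B.
Proof.
have [] := atransP2 hreg (x := val A) (y := val B); rewrite ?inE ?(valP A) ?(valP B) //.
move=> s sG E; exists s => //; apply: val_inj; by rewrite val_flag_act // E.
Qed.

Lemma setD_padj i A : val A :\: val (padj i A) = [set pface A (mid i)].
Proof.
apply/setP=> x; rewrite !inE; apply/andP/eqP => [[xN xA]|->].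
  rewrite -(pface_lev xA); congr pface; apply/eqP; apply: contraNT xN => /(pface_padj A).
  by rewrite (pface_lev xA) => <-; apply: pface_in.
split; last exact: pface_in.
by apply/negP=> /pface_lev; rewrite lev_pface => /padj_mid.
Qed.

(** Flag-transitivity shows that the default value in [rho] is never taken. *)
Lemma rhoP i : rho (val Phi) i \in Gamma P /\ flag_act (rho (val Phi) i) Phi = padj i Phi.
Proof.
rewrite /rho; case: pickP => [s /andP[sG]|h].
  case/andP=> a /forall_inP r; split=> //.
  rewrite -val_flag_act // in a r; have [j sE jE] := adjacent_padj a.
  rewrite sE; congr padj; apply: val_inj.
  have := r (pface Phi (mid j)); rewrite jE set11 levE lev_pface midE => /(_ isT)/eqP.
  by rewrite /=; lia.
have [s sG sE] := flag_trans Phi (padj i Phi).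
have /negP[] := negbT (h s); rewrite sG andTb -(val_flag_act Phi sG) sE.
have := setD_padj i (padj i Phi); rewrite padjK => E.
rewrite /adjacent_at /adjacent E setD_padj !cards1 /=.
by apply/forall_inP=> x /set1P->; rewrite levE lev_pface midE; apply/eqP; lia.
Qed.

Lemma rot_sub : rot \subset Gamma P.
Proof.
rewrite gen_subG; apply/subsetP=> _ /imsetP[i _ ->].
have hi0 : i.-1 < n by apply: leq_ltn_trans (ltn_ord i); apply: leq_pred.
apply: groupM; last by case: (rhoP i).
by case: (rhoP (Ordinal hi0)).
Qed.

Lemma rho_act i s : s \in Gamma P ->
  flag_act (rho (val Phi) i * s) Phi = padj i (flag_act s Phi).
Proof.
by move=> sG; have [rG rE] := rhoP i; rewrite flag_actM // rE flag_act_padj.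
Qed.

(** Each [sigma] is a rotation, so the [rho] are all inside the rotation group or all outside. If
    inside, this group would be transitive on flags, hence equal to [Gamma P], against index 2. *)
Lemma rho_notin i : rho (val Phi) i \notin rot.
Proof.
apply/negP=> ri; have step (j : nat) : 0 < j -> j < n ->
    (rho (val Phi) j.-1 \in rot) = (rho (val Phi) j \in rot).
  move=> j0 jn; have sr : sigma (val Phi) j \in rot.
    by apply/mem_gen/imsetP; exists (Ordinal jn); rewrite ?inE.
  rewrite /sigma in sr; apply/idP/idP => hr.
    by rewrite groupMl // in sr.
  by rewrite groupMr // in sr.
have all0 (j : nat) : j < n -> (rho (val Phi) j \in rot) = (rho (val Phi) 0 \in rot).
  by elim: j => // j IH jn; rewrite -(step j.+1) //= IH // ltnW.
have rall j : rho (val Phi) j \in rot by rewrite all0 // -(all0 i).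
have orb A : exists2 s, s \in rot & flag_act s Phi = A.
  apply: (link_ind (P := fun A => exists2 s, s \in rot & flag_act s Phi = A)) (padj_link_all Phi A).
    by exists 1%g; rewrite ?group1 // flag_act1.
  move=> j B _ _ [s sr <-]; exists (rho (val Phi) j * s)%g; first by rewrite groupM.
  by rewrite rho_act // (subsetP rot_sub).
have: Gamma P \subset rot.
  apply/subsetP=> s sG; have [t tr tE] := orb (flag_act s Phi).
  by rewrite -(flag_act_eq (subsetP rot_sub _ tr) sG tE).
by rewrite -indexg_eq1 hrot.
Qed.

Lemma mem_rotM r s : r \in Gamma P -> s \in Gamma P -> r \notin rot ->
  (r * s \in rot)%g = (s \notin rot).
Proof.
move=> rG sG rN; apply/idP/idP => [h|sN].
  by apply: contra rN => sr; rewrite groupMr // in h.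
have E : (r^-1 *: rot = Gamma P :\: rot)%g.
  apply/eqP; rewrite eqEcard; apply/andP; split.
    apply/subsetP=> _ /lcosetP[t tr ->]; rewrite inE groupMr // groupV rN.
    by rewrite groupM ?groupV // (subsetP rot_sub).
  rewrite card_lcoset cardsD (setIidPr rot_sub) -(Lagrange rot_sub) hrot.
  by rewrite muln2 -addnn addnK.
have : s \in Gamma P :\: rot by rewrite inE sN.
by rewrite -E => /lcosetP[t tr ->]; rewrite mulgA mulgV mul1g.
Qed.

Definition odd_flag A := ~~ [exists s in rot, flag_act s Phi == A].

Lemma odd_flag_act s : s \in Gamma P -> odd_flag (flag_act s Phi) = (s \notin rot).
Proof.
move=> sG; congr (~~ _); apply/exists_inP/idP => [[t tr /eqP tE]|sr].
  by rewrite -(flag_act_eq (subsetP rot_sub _ tr) sG tE).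
by exists s.
Qed.

Lemma odd_padj i A : odd_flag (padj i A) = ~~ odd_flag A.
Proof.
have [s sG <-] := flag_trans Phi A; rewrite -rho_act //.
have [rG _] := rhoP i.
by rewrite (odd_flag_act (groupM rG sG)) (odd_flag_act sG) (mem_rotM rG sG (rho_notin i)).
Qed.

Lemma odd_rot s A : s \in rot -> odd_flag (flag_act s A) = odd_flag A.
Proof.
move=> sr; have sG := subsetP rot_sub _ sr; have [t tG <-] := flag_trans Phi A.
by rewrite -(flag_actM _ tG sG) (odd_flag_act (groupM tG sG)) (odd_flag_act tG) groupMr.
Qed.

Lemma rot_trans A B : odd_flag A = odd_flag B -> exists2 s, s \in rot & flag_act s A = B.
Proof.
have [s sG sE] := flag_trans A B; have [t tG tE] := flag_trans Phi A.
rewrite -sE -tE -(flag_actM _ tG sG) (odd_flag_act (groupM tG sG)) (odd_flag_act tG) => E.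
exists s; last by rewrite (flag_actM _ tG sG).
case: (boolP (t \in rot)) E => [tr|tN]; first by rewrite groupMl // => /esym/negbFE.
by rewrite (mem_rotM tG sG tN) negbK => <-.
Qed.

End Rotation.

End FlagManiplex.

(** * The square tessellation *)

Inductive dir := East | North | West | South.

Definition turn u :=
  match u with East => North | North => West | West => South | South => East end.

Definition unturn u :=
  match u with East => South | North => East | West => North | South => West end.

Definition vec u : int * int :=
  match u with
  | East => (1, 0)%R | North => (0, 1)%R | West => (-1, 0)%R | South => (0, -1)%R
  end.

(* The flag [(z, u, e)] has vertex [z] and the square on the left of the ray
   from [z] in direction [u]; its edge leaves [z] in direction [u] if [e] is
   false, in direction [turn u] otherwise. *)
Definition tflag := (int * int * dir * bool)%type.

Section Tessellation.
Local Open Scope ring_scope.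

Definition tadj (i : nat) (t : tflag) : tflag :=
  let: (z, u, e) := t in
  match i, e with
  | 0%N, false => (z.1 + (vec u).1, z.2 + (vec u).2, turn u, true)
  | 0%N, true => (z.1 + (vec (turn u)).1, z.2 + (vec (turn u)).2, unturn u, false)
  | 1%N, _ => (z, u, ~~ e)
  | _, false => (z, unturn u, true)
  | _, true => (z, turn u, false)
  end.

(* In the doubled coordinates of [cell_incident]. *)
Definition tcell (i : nat) (t : tflag) : int * int :=
  let: (z, u, e) := t in
  match i with
  | 0%N => (2 * z.1, 2 * z.2)
  | 1%N => let v := vec (if e then turn u else u) in (2 * z.1 + v.1, 2 * z.2 + v.2)
  | _ => (2 * z.1 + ((vec u).1 + (vec (turn u)).1),
          2 * z.2 + ((vec u).2 + (vec (turn u)).2))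
  end.

Definition shift (w : int * int) (t : tflag) : tflag :=
  let: (z, u, e) := t in (z.1 + w.1, z.2 + w.2, u, e).

Definition lattice (b c : int) (w : int * int) :=
  exists s t : int, w.1 = s * b - t * c /\ w.2 = s * c + t * b.

Lemma same_orbitP b c u v :
  same_orbit b c u v <-> exists2 w, lattice b c w & v = (u.1 + 2 * w.1, u.2 + 2 * w.2).
Proof.
split=> [/asboolP[s [t [h1 h2]]]|[w [s [t [h1 h2]]] ->]].
  exists (s * b - t * c, s * c + t * b); first by exists s, t.
  by rewrite -h1 -h2; case: (v).
by apply/asboolP; exists s, t; rewrite /= h1 h2.
Qed.

Lemma tcell_adj i j t : (i < 3)%N -> (j < 3)%N -> i != j -> tcell j (tadj i t) = tcell j t.
Proof.
case: t => [[[a b] u] e].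
by case: i => [|[|[|//]]]; case: j => [|[|[|//]]] // _ _ _; case: u; case: e => /=;
  congr pair; ring.
Qed.

Lemma tcell_shift i w t :
  tcell i (shift w t) = ((tcell i t).1 + 2 * w.1, (tcell i t).2 + 2 * w.2).
Proof.
by case: t w => [[[a b] u] e] [x y]; case: i => [|[|i]] /=; congr pair; ring.
Qed.

Lemma tcell_incident i j t : (i <= j)%N -> (j < 3)%N -> cell_incident (tcell i t) (tcell j t).
Proof.
case: t => [[[a b] u] e].
by case: i => [|[|[|//]]]; case: j => [|[|[|//]]] // _ _; case: u; case: e;
  rewrite /cell_incident /line_incident /=; lia.
Qed.

(** Moves 1 and 2 turn a flag about its vertex through all directions, move 0 steps to the adjacent
    vertices, and integer induction along both axes reaches every vertex. *)
Lemma tflag_ind (Q : tflag -> Prop) t0 :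
  Q t0 -> (forall i t, (i < 3)%N -> Q t -> Q (tadj i t)) -> forall t, Q t.
Proof.
move=> Q0 QR.
have Qe z u e e' : Q (z, u, e) -> Q (z, u, e').
  by case: (eqVneq e e') => [->//|ee'] /(QR 1%N _ isT) /=; case: e e' ee' => [] [].
have Qturn z u e e' : Q (z, u, e) -> Q (z, turn u, e').
  by move=> /(Qe _ _ _ true)/(QR 2%N _ isT) /= /Qe.
have Qu z u u' e e' : Q (z, u, e) -> Q (z, u', e').
  move=> h; have h1 := Qturn _ _ _ e' h; have h2 := Qturn _ _ _ e' h1.
  have h3 := Qturn _ _ _ e' h2; have h4 := Qturn _ _ _ e' h3.
  by case: u u' h h1 h2 h3 h4 => [] [].
have Qv u a b u' e e' : Q (a, b, u, e) -> Q (a + (vec u').1, b + (vec u').2, u, e').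
  by move=> /(Qu _ _ u' _ false)/(QR 0%N _ isT) /= /Qu; apply.
have Q1 a b u e : Q (a, b, u, e) -> forall n : int, Q (a + n, b, u, e).
  move=> h; elim/int_ind => [|n IH|n IH]; first by rewrite addr0.
  - by have := Qv _ _ _ East _ e IH; rewrite /= addr0 -addrA [(n%:Z + 1)%R]addrC -intS.
  by have := Qv _ _ _ West _ e IH; rewrite /= addr0 -addrA -opprD [(n%:Z + 1)%R]addrC -intS.
have Q2 a b u e : Q (a, b, u, e) -> forall n : int, Q (a, b + n, u, e).
  move=> h; elim/int_ind => [|n IH|n IH]; first by rewrite addr0.
  - by have := Qv _ _ _ North _ e IH; rewrite /= addr0 -addrA [(n%:Z + 1)%R]addrC -intS.
  by have := Qv _ _ _ South _ e IH; rewrite /= addr0 -addrA -opprD [(n%:Z + 1)%R]addrC -intS.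
case: t0 Q0 => [[[a b] u] e] Q0 [[[a' b'] u'] e'].
have := Q2 _ _ _ _ (Q1 _ _ _ _ (Qu _ _ u' _ e' Q0) (a' - a)) (b' - b).
by rewrite !subrKC.
Qed.

Definition odd_dim (u : int * int) : nat := (odd `|u.1|%N + odd `|u.2|%N)%N.

(** A standard flag through the cell [u]. Floor division gives the lower left vertex of the cell,
    and only a vertical edge, where the first coordinate is even and the second odd, requires the
    direction North. *)
Definition tflag_of (u : int * int) : tflag :=
  ((u.1 %/ 2)%Z, (u.2 %/ 2)%Z,
   if ~~ odd `|u.1|%N && odd `|u.2|%N then North else East, false).

Lemma tflag_ofK u : tcell (odd_dim u) (tflag_of u) = u.
Proof.
case: u => x y; rewrite /odd_dim /tflag_of /=.
by case: (boolP (odd `|x|%N)) => hx; case: (boolP (odd `|y|%N)) => hy /=; congr pair; lia.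
Qed.

Lemma odd_dim_lt u : (odd_dim u < 3)%N.
Proof. by rewrite /odd_dim; do 2!case: (odd _). Qed.

Lemma odd_dim_tcell i t : (i < 3)%N -> odd_dim (tcell i t) = i.
Proof.
case: t => [[[a b] u] e]; rewrite /odd_dim.
by case: i => [|[|[|//]]] _; case: u; case: e => /=; lia.
Qed.

Lemma tflag_of_shift u w :
  tflag_of (u.1 + 2 * w.1, u.2 + 2 * w.2) = shift w (tflag_of u).
Proof.
case: u w => x y [a b]; rewrite /tflag_of /=.
have hx : odd `|(x + 2 * a)%R|%N = odd `|x|%N by lia.
have hy : odd `|(y + 2 * b)%R|%N = odd `|y|%N by lia.
by rewrite hx hy; congr (_, _, _, _); lia.
Qed.

Lemma incident_tflag u v : cell_incident u v ->
  exists t i j, [/\ (i <= j)%N, (j < 3)%N, tcell i t = u & tcell j t = v].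
Proof.
case: u v => x y [x' y'] /andP[/= hx hy].
pose z := ((x %/ 2)%Z, (y %/ 2)%Z).
have xE : x = 2 * z.1 + (odd `|x|%N : nat)%:Z by rewrite /=; lia.
have yE : y = 2 * z.2 + (odd `|y|%N : nat)%:Z by rewrite /=; lia.
(* An odd coordinate of [u] is kept, an even one may stay or move by one either way; every resulting
   position receives an explicit flag. *)
have cx : x' = x \/ ~~ odd `|x|%N /\ (x' = x + 1 \/ x' = x - 1).
  by move: hx; rewrite /line_incident; lia.
have cy : y' = y \/ ~~ odd `|y|%N /\ (y' = y + 1 \/ y' = y - 1).
  by move: hy; rewrite /line_incident; lia.
move: xE yE cx cy {hx hy}; case: z => a b /=.
case: (odd _); case: (odd _) => /= xE yE.
- case=> [->|[//]] [->|[//]]; exists (a, b, East, false), 2%N, 2%N.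
  by split=> //; rewrite xE yE /=; congr pair; ring.
- case=> [->|[//]] [->|[_ [->|->]]].
  + by exists (a, b, East, false), 1%N, 1%N; split=> //; rewrite xE yE /=; congr pair; ring.
  + by exists (a, b, East, false), 1%N, 2%N; split=> //; rewrite xE yE /=; congr pair; ring.
  by exists (a, b, South, true), 1%N, 2%N; split=> //; rewrite xE yE /=; congr pair; ring.
- case=> [->|[_ [->|->]]] [->|[//]].
  + by exists (a, b, North, false), 1%N, 1%N; split=> //; rewrite xE yE /=; congr pair; ring.
  + by exists (a, b, East, true), 1%N, 2%N; split=> //; rewrite xE yE /=; congr pair; ring.
  by exists (a, b, North, false), 1%N, 2%N; split=> //; rewrite xE yE /=; congr pair; ring.
case=> [->|[_ [->|->]]] [->|[_ [->|->]]].
- by exists (a, b, East, false), 0%N, 0%N; split=> //; rewrite xE yE /=; congr pair; ring.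
- by exists (a, b, North, false), 0%N, 1%N; split=> //; rewrite xE yE /=; congr pair; ring.
- by exists (a, b, South, false), 0%N, 1%N; split=> //; rewrite xE yE /=; congr pair; ring.
- by exists (a, b, East, false), 0%N, 1%N; split=> //; rewrite xE yE /=; congr pair; ring.
- by exists (a, b, East, false), 0%N, 2%N; split=> //; rewrite xE yE /=; congr pair; ring.
- by exists (a, b, South, false), 0%N, 2%N; split=> //; rewrite xE yE /=; congr pair; ring.
- by exists (a, b, West, false), 0%N, 1%N; split=> //; rewrite xE yE /=; congr pair; ring.
- by exists (a, b, North, false), 0%N, 2%N; split=> //; rewrite xE yE /=; congr pair; ring.
by exists (a, b, West, false), 0%N, 2%N; split=> //; rewrite xE yE /=; congr pair; ring.
Qed.

(* [t] and [tflag_of (tcell i t)] have the same cell of dimension [i], and the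
   flags around a given cell are permuted transitively by the other moves. *)
Lemma tcell_flag (T : Type) (g : tflag -> T) i t : (i < 3)%N ->
  (forall j s, (j < 3)%N -> j != i -> g (tadj j s) = g s) ->
  g (tflag_of (tcell i t)) = g t.
Proof.
move=> i3 gR; have R j s : (j < 3)%N -> j != i -> g s = g (tadj j s) by move=> *; rewrite gR.
have tE (a b x y : int) : tflag_of (2 * a + x, 2 * b + y) =
    shift (a, b) (tflag_of (x, y)) by rewrite -tflag_of_shift /= [x + _]addrC [y + _]addrC.
case: i i3 gR R => [|[|[|//]]] _ gR R; case: t => [[[a b] u] e].
- rewrite /= -[2 * a]addr0 -[2 * b]addr0 tE (_ : tflag_of _ = (0, 0, East, false)) //.
  have h v e1 : g (a, b, v, e1) = g (a, b, turn v, e1).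
    by case: e1; [rewrite (R 2%N) // (R 1%N) | rewrite (R 1%N) // (R 2%N)].
  have -> : g (a, b, u, e) = g (a, b, u, false) by case: e; rewrite // (R 1%N).
  have -> : g (a, b, u, false) = g (a, b, East, false).
    by case: u; rewrite // h //= h //= h.
  by rewrite /=; congr (g (_, _, _, _)); ring.
- have h v : g (tflag_of (tcell 1 (a, b, v, false))) = g (a, b, v, false).
    case: v; rewrite /= tE.
    + by rewrite (_ : tflag_of _ = (0, 0, East, false)) //=; congr (g (_, _, _, _)); ring.
    + by rewrite (_ : tflag_of _ = (0, 0, North, false)) //=; congr (g (_, _, _, _)); ring.
    + rewrite (_ : tflag_of _ = (-1, 0, East, false)) //.
      rewrite (R 2%N (a, b, _, _)) // (R 0%N (a, b, _, _)) //=.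
      by rewrite /=; congr (g (_, _, _, _)); ring.
    rewrite (_ : tflag_of _ = (0, -1, North, false)) //.
    rewrite (R 2%N (a, b, _, _)) // (R 0%N (a, b, _, _)) //=.
    by rewrite /=; congr (g (_, _, _, _)); ring.
  case: e; last by rewrite h.
  by rewrite [RHS](R 2%N) //= -h.
have h (x y : int) v : g (x, y, v, false) = g (x + (vec v).1, y + (vec v).2, turn v, false).
  by rewrite (R 0%N) // (R 1%N).
have -> : g (a, b, u, e) = g (a, b, u, false) by case: e; rewrite // (R 1%N).
case: u; rewrite /= tE.
- by rewrite (_ : tflag_of _ = (0, 0, East, false)) //=; congr (g (_, _, _, _)); ring.
- rewrite (_ : tflag_of _ = (-1, 0, East, false)) // (h a) (h (a + _)) (h (a + _ + _)) /=.
  by rewrite /=; congr (g (_, _, _, _)); ring.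
- rewrite (_ : tflag_of _ = (-1, -1, East, false)) // (h a) (h (a + _)) /=.
  by rewrite /=; congr (g (_, _, _, _)); ring.
rewrite (_ : tflag_of _ = (0, -1, East, false)) // (h a) /=.
by rewrite /=; congr (g (_, _, _, _)); ring.
Qed.

End Tessellation.

(** * Charts: wrapping the tessellation around a facet *)

Section Charts.
Local Open Scope ring_scope.

(** A covering of the flags of one facet by those of the plane; the move 3 is left out because it
    changes the facet. *)
Definition chart (F : finType) (r : 'I_4 -> F -> F) (mu : tflag -> F) :=
  forall (i : 'I_4) t, (i < 3)%N -> mu (tadj i t) = r i (mu t).

(** Walk lifting: each step is the image of a step in the tessellation, and the invariant [Q] is
    carried along the lifted walk. *)
Lemma chart_lift (F : finType) (r : 'I_4 -> F -> F) (mu : tflag -> F)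
    (I : {set 'I_4}) (Q : tflag -> Prop) t y :
  chart r mu -> (forall i, i \in I -> (i < 3)%N) ->
  Q t -> (forall i s, i \in I -> Q s -> Q (tadj i s)) ->
  link r I (mu t) y -> exists2 s, Q s & mu s = y.
Proof.
move=> hmu I3 Qt QR.
apply: (@link_ind _ _ _ I (mu t) (fun y => exists2 s, Q s & mu s = y)); first by exists t.
by move=> i z iI _ [s Qs <-]; exists (tadj i s); [apply: QR | rewrite hmu ?I3].
Qed.

Lemma others4_lt (i : 'I_4) : i \in others 4 4 -> (i < 3)%N.
Proof. by rewrite inE eqSS => i3; have := ltn_ord i; rewrite ltnS leq_eqVlt (negPf i3). Qed.

Section ChartToroid.
Variables (M : maniplex 4) (mu : tflag -> M) (b c : int).
Hypotheses (hmu : chart (@adj 4 M) mu)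
  (mu_fib : forall t t', mu t = mu t' <-> exists2 w, lattice b c w & t' = shift w t).
Local Notation P := (face M).

Lemma mu_mkface (k : 'I_6) t (j : nat) : (j < 3)%N -> j != k.-1 -> (0 < k)%N ->
  mkface k (mu (tadj j t)) = mkface k (mu t).
Proof.
move=> j3 jk k0; have j4 : (j < 4)%N by apply: leq_trans j3 _.
have := hmu (i := Ordinal j4) t j3 => /= ->; rewrite mkface_adj //=.
by apply: contraNneq jk => <-.
Qed.

Definition facet : P := mkface (inord 4) (mu (0, 0, East, false)).

Lemma facetE t : mkface (inord 4) (mu t) = facet.
Proof.
apply: (@tflag_ind (fun t => mkface _ (mu t) = facet) (0, 0, East, false)) => // i s i3 <-.
apply: mu_mkface; rewrite ?inordK //=.
by apply: contraTneq i3 => ->.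
Qed.

Definition cell_face_of (u : int * int) : P :=
  mkface (inord (odd_dim u).+1) (mu (tflag_of u)).

Lemma cell_face_tcell i t : (i < 3)%N -> cell_face_of (tcell i t) = mkface (inord i.+1) (mu t).
Proof.
move=> i3; rewrite /cell_face_of odd_dim_tcell //.
apply: (tcell_flag (g := fun t => mkface (inord i.+1) (mu t)) _ i3) => j s j3 ji.
by apply: mu_mkface; rewrite ?inordK // ltnS (leq_trans i3).
Qed.

Lemma cell_face_orbit u v : same_orbit b c u v -> cell_face_of u = cell_face_of v.
Proof.
move/same_orbitP=> [w wL ->]; rewrite /cell_face_of tflag_of_shift.
have -> : odd_dim (u.1 + 2 * w.1, u.2 + 2 * w.2) = odd_dim u.
  have := tcell_shift (odd_dim u) w (tflag_of u); rewrite tflag_ofK => <-.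
  exact: odd_dim_tcell (odd_dim_lt u).
by congr mkface; apply/mu_fib; exists w.
Qed.

Definition toroid_face (X : toroid b c) : P :=
  match X with
  | LeastFace => \bot%O
  | ProperFace X => cell_face_of (repr X)
  | GreatestFace => facet
  end.

Lemma toroid_face_pi u :
  toroid_face (ProperFace (\pi_(torus_cell b c)%qT u)) = cell_face_of u.
Proof.
by apply: cell_face_orbit; apply/torus_cell_eqP; rewrite reprK.
Qed.

Lemma below_facet (X Y : P) : (X <= Y)%O -> (Y <= facet)%O ->
  exists t, X = mkface (level X) (mu t) /\ Y = mkface (level Y) (mu t).
Proof.
move=> XY YF; have [|y hy] := @chain_common _ M [set X; Y; facet].
  apply/forall_inP=> U hU; apply/forall_inP=> V hV.
  move: hU hV (le_trans XY YF); rewrite !inE /Order.comparable.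
  by move=> /orP[/orP[]|] /eqP-> /orP[/orP[]|] /eqP-> XF;
    rewrite ?lexx ?XY ?YF ?XF ?orbT.
have Fy : mkface (inord 4) y = facet.
  by rewrite [RHS]hy // !inE eqxx orbT.
have l : link (@adj 4 M) (others 4 4) (mu (0, 0, East, false)) y.
  by have := esym Fy; rewrite /facet => /eq_mkface; rewrite inordK.
have [s _ sE] := chart_lift (Q := fun=> True) hmu others4_lt I (fun _ _ _ _ => I) l.
by exists s; rewrite sE; split; apply: hy; rewrite !inE eqxx ?orbT.
Qed.

(** By [linkI] there is a walk that fixes both the facet and the face of rank [i]. Lifted to the
    tessellation it keeps the cell, and its end lies over [mu t], hence is a lattice translate of
    [t]. *)
Lemma cell_of_face i t u : (i < 3)%N -> cell_face_of u = mkface (inord i.+1) (mu t) ->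
  same_orbit b c u (tcell i t).
Proof.
move=> i3; rewrite -{1}(tflag_ofK u) cell_face_tcell ?odd_dim_lt // => E.
have iE : odd_dim u = i.
  have := congr1 (fun X => val (level X)) E; rewrite !level_mkface /= !inordK //; first by case.
    by lia.
  by have := odd_dim_lt u; lia.
rewrite iE in E; have /eq_mkface l1 := E.
have /eq_mkface l2 : mkface (inord 4) (mu (tflag_of u)) = mkface (inord 4) (mu t).
  by rewrite !facetE.
rewrite inordK // in l2; rewrite inordK in l1; last by lia.
have l := linkI l1 l2; have [||j s|s sE st] := chart_lift (Q := fun s => tcell i s = u) hmu _ _ _ l.
- by move=> j /setIP[_]; apply: others4_lt.
- by rewrite -iE tflag_ofK.
- by case/setIP; rewrite inE eqSS => ji /others4_lt j3 <-; apply: tcell_adj.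
have [w wL ->] := (mu_fib s t).1 st.
by apply/same_orbitP; exists w; rewrite // tcell_shift sE.
Qed.

Lemma chart_toroid : isomorphic_to (section \bot%O facet) (toroid b c).
Proof.
have od3 u : (odd_dim u <= 2)%N by have := odd_dim_lt u.
have levc u : level (cell_face_of u) = (odd_dim u).+1 :> nat.
  by rewrite level_mkface inordK //; have := od3 u; lia.
have lev0 : level (\bot%O : P) = 0%N :> nat by [].
have levF : level facet = 4%N :> nat by rewrite level_mkface inordK.
have cF u : (cell_face_of u <= facet)%O.
  rewrite -(facetE (tflag_of u)) le_mkface; have hu := od3 u.
  by rewrite !inordK; lia.
exists toroid_face => [X Y|Z]; last first.
  rewrite inE le0x /=; split=> [ZF|[X <-]]; last first.
    by case: X => [|X|] /=; rewrite ?le0x ?lexx ?cF.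
  have [t [ZE _]] := below_facet ZF (lexx _).
  have /le_faceP[+ _] := ZF; rewrite levF leq_eqVlt => /predU1P[Z4|lZ].
    exists (GreatestFace b c); rewrite /= -(facetE t) ZE; congr mkface.
    by apply: val_inj; rewrite /= inordK.
  have [Z0|Z0] := eqVneq (level Z : nat) 0%N.
    exists (LeastFace b c); rewrite ZE /=; apply: etrans (mkface_improper _ _ _) _; last first.
    - by congr mkface; apply: val_inj; rewrite /= Z0.
    by left.
  have Z3 : ((level Z).-1 < 3)%N by lia.
  exists (ProperFace (\pi_(torus_cell b c)%qT (tcell (level Z).-1 t))).
  rewrite toroid_face_pi cell_face_tcell // [RHS]ZE; congr mkface.
  by rewrite prednK ?inord_val // lt0n.
have -> : (X <= Y)%O = toroid_le X Y by [].
have nle (U V : P) : (level V < level U)%N -> (U <= V)%O = false.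
  by move=> lVU; apply/negP=> /le_faceP[]; rewrite leqNgt lVU.
case: X Y => [|X|] [|Y|]; rewrite /= ?le0x ?cF ?lexx //; try by rewrite nle // ?lev0 ?levc ?levF.
  elim/quotW: X => u; elim/quotW: Y => v.
  have hp w : cell_face_of (repr (\pi_(torus_cell b c)%qT w)) = cell_face_of w.
    exact: toroid_face_pi.
  rewrite (hp u) (hp v).
  apply/idP/idP => [uv|/torus_cell_incidentP[v' /torus_cell_eqP/cell_face_orbit <-]].
    have [t [uE vE]] := below_facet uv (cF v).
    have hu := @cell_of_face (odd_dim u) t u (odd_dim_lt u) uE.
    have hv := @cell_of_face (odd_dim v) t v (odd_dim_lt v) vE.
    apply/asboolP; exists (tcell (odd_dim u) t), (tcell (odd_dim v) t); split.
    - by apply/esym/torus_cell_eqP.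
    - by apply/esym/torus_cell_eqP.
    apply: tcell_incident (odd_dim_lt v).
    by have /le_faceP[] := uv; rewrite !levc.
  move=> /incident_tflag[t [i [j [ij j3 <- <-]]]].
  have i3 := leq_ltn_trans ij j3.
  rewrite !cell_face_tcell // le_mkface !inordK //; lia.
by rewrite nle // levc levF !ltnS; apply: od3.
Qed.

End ChartToroid.

Lemma odd_dim_orbit b c u v : same_orbit b c u v -> odd_dim u = odd_dim v.
Proof.
move/same_orbitP=> [w _ ->].
have := tcell_shift (odd_dim u) w (tflag_of u); rewrite tflag_ofK => <-.
by rewrite odd_dim_tcell ?odd_dim_lt.
Qed.

Section ToroidChart.
Variables (d : Order.disp_t) (Q : finTBPOrderType d) (m : int) (F : Q).
Variables (f : toroid m 0 -> Q).
Hypotheses (hQ : polytope Q 4) (A0 : pflag Q) (m_odd : odd `|m|%N)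
  (rF : rank F = 3) (f_mono : {mono f : X Y / (X <= Y)%O})
  (f_img : forall z, z \in section \bot%O F <-> exists X, f X = z).
Local Notation pf := (pface hQ).
Local Notation cls := (\pi_(torus_cell m 0)%qT).

Lemma f_le_F X : (f X <= F)%O.
Proof. by have := (f_img (f X)).2 (ex_intro _ X erefl); rewrite inE => /andP[]. Qed.

Lemma f_inj X Y : f X = f Y -> X = Y.
Proof. by move=> E; apply/le_anti; rewrite -!f_mono E lexx. Qed.

Lemma f_lt X Y : (f X < f Y)%O = (X < Y)%O.
Proof. by rewrite !lt_leAnge !f_mono. Qed.

Lemma f_least : f (LeastFace m 0) = \bot%O.
Proof.
have [X XE] : exists X, f X = \bot%O by apply/f_img; rewrite inE lexx le0x.
by apply/le_anti; rewrite le0x andbT -XE f_mono.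
Qed.

Lemma F_lt_top : (F < \top)%O.
Proof.
rewrite lt_neqAle lex1 andbT; apply: contra_eq_neq rF => ->.
by have [[-> _] _ _ _] := hQ.
Qed.

(** [f] sends its greatest element to [F], so level 4 is the facet and only level 5 comes from
    outside it. *)
Definition tface (k : nat) t : Q :=
  match k with
  | 0%N => f (LeastFace m 0)
  | 4%N => f (GreatestFace m 0)
  | k'.+1 => if (k < 5)%N then f (ProperFace (cls (tcell k' t))) else \top%O
  end.

Lemma cls_lt i j t : (i < j)%N -> (j < 3)%N ->
  (ProperFace (cls (tcell i t)) < ProperFace (cls (tcell j t)) :> toroid m 0)%O.
Proof.
move=> ij j3; rewrite lt_neqAle; apply/andP; split; last first.
  apply/asboolP; exists (tcell i t), (tcell j t); split=> //.
  by apply: tcell_incident => //; apply: ltnW.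
apply/eqP=> -[/torus_cell_eqP/odd_dim_orbit].
by rewrite !odd_dim_tcell ?(ltn_trans ij) // => ijE; rewrite ijE ltnn in ij.
Qed.

Lemma tface_lt t (k l : 'I_6) : (k < l)%N -> (tface k t < tface l t)%O.
Proof.
case: k l => k hk [l hl] /= kl.
have [l5|l4] := ltnP l 5%N; last first.
  have -> : l = 5%N by apply/eqP; rewrite eqn_leq l4 -ltnS hl.
  have k5 : (k < 5)%N by lia.
  by case: k k5 {hk kl} => [|[|[|[|[|//]]]]] _ /=; apply: le_lt_trans (f_le_F _) F_lt_top.
case: l l5 kl {hl} => [|[|[|[|[|//]]]]] _; case: k {hk} => [|[|[|[|//]]]] //= _;
  by rewrite f_lt // ?cls_lt.
Qed.

Lemma tface_chart : exists mu : tflag -> pflag Q, forall t (k : 'I_6), pf (mu t) k = tface k t.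
Proof.
have ex t : exists A, forall k : 'I_6, pf A k = tface k t.
  exact/pflag_of_chain/tface_lt.
by have [mu muE] := choice ex; exists mu.
Qed.

Section Chart.
Variable mu : tflag -> pflag Q.
Hypothesis muE : forall t (k : 'I_6), pf (mu t) k = tface k t.

Lemma mu_eq t t' : mu t = mu t' <->
  forall i, (i < 3)%N -> same_orbit m 0 (tcell i t) (tcell i t').
Proof.
split=> [E i i3|E]; last first.
  apply: (@pflag_eq _ _ _ hQ) => k; rewrite !muE.
  case: k => [[|[|[|[|[|k]]]]] hk] //=; congr (f (ProperFace _)); exact/torus_cell_eqP/E.
have i6 : (i.+1 < 6)%N by lia.
have := muE t (Ordinal i6); rewrite E muE.
by case: i i3 i6 => [|[|[|//]]] _ _ /= /f_inj[/torus_cell_eqP]; rewrite same_orbit_sym.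
Qed.

(** If [m] were 1 or -1 the torus would have a single vertex, whereas the diamond condition asks for
    two vertices below an edge. *)
Lemma m_neq1 : `|m|%N != 1%N.
Proof.
apply/eqP=> m1; pose t0 : tflag := (0, 0, East, false).
pose i0 : 'I_4 := ord0; pose B := padj hQ i0 (mu t0).
have hmid : mid i0 = 1%N :> nat by rewrite midE.
have hhi : hi i0 = 2%N :> nat by rewrite hiE.
have Bhi : pf B (hi i0) = f (ProperFace (cls (tcell 1 t0))).
  by rewrite pface_padj ?muE ?hhi // -val_eqE /= hhi hmid.
have BN : pf B (mid i0) <> f (ProperFace (cls (tcell 0 t0))).
  by have := @padj_mid _ _ _ hQ i0 (mu t0); rewrite muE hmid.
have Blt : (pf B (mid i0) < f (ProperFace (cls (tcell 1 t0))))%O.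
  by rewrite -Bhi; apply: pface_lt; rewrite hmid hhi.
have [X XE] : exists X, f X = pf B (mid i0).
  by apply/f_img; rewrite inE le0x (le_trans (ltW Blt)) // f_le_F.
rewrite -XE f_lt in Blt BN.
case: X XE Blt BN => [|X|] XE // Blt BN.
  have := lev_pface hQ B (mid i0); rewrite -XE f_least -(pface_bot hQ B) lev_pface.
  by move/(congr1 val); rewrite /= hmid.
elim/quotW: X XE Blt BN => u XE; rewrite lt_neqAle => /andP[uN].
have -> (Y Z : toroid m 0) : (Y <= Z)%O = toroid_le Y Z by [].
move=> /= /torus_cell_incidentP[v /torus_cell_eqP vE /incident_tflag[t [i [j [ij j3 ui vj]]]]] BN.
have j1 : j = 1%N by have := odd_dim_orbit vE; rewrite -vj !odd_dim_tcell.
have i0' : i = 0%N.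
  have : i != 1%N; last by lia.
  apply: contraNneq uN => i1; apply/eqP; congr ProperFace; apply/torus_cell_eqP.
  by rewrite (_ : u = v) // -ui -vj i1 j1.
apply: BN; congr (f (ProperFace _)); apply/torus_cell_eqP/same_orbitP.
case: t ui {vj} => [[[a b] u'] e]; rewrite i0' /= => <-.
exists (- a, - b); last by congr pair; rewrite /=; ring.
have mm : m * m = 1 by nia.
by exists (- (a * m)), (- (b * m)); rewrite /= !mulr0 subr0 add0r !mulNr -!mulrA mm !mulr1.
Qed.

Lemma mulm_neq (s : int) : (s * m != 1) && (s * m != -1).
Proof. by have := m_neq1; have := m_odd; nia. Qed.

(** The cells of rank [i] in neighbouring flags differ by a unit translation or by no integral
    translation at all; unit translations are outside the lattice because no multiple of [m] is 1 or
    -1. *)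
Lemma mu_padj (i : 'I_4) t : (i < 3)%N -> mu (tadj i t) = padj hQ i (mu t).
Proof.
move=> i3; apply: padj_uniq => [k kN|].
  have {}kN : k != i.+1 :> nat by move: kN; rewrite -val_eqE /= midE.
  rewrite !muE; case: k kN => [[|[|[|[|[|k]]]]] hk] //= kN;
    by rewrite tcell_adj //; apply: contraNneq kN => ->.
move=> /mu_eq/(_ i i3)/same_orbitP[w [s [s' [w1 w2]]]].
have := mulm_neq s; have := mulm_neq s'.
have {}w1 : s * m = w.1 by rewrite w1 mulr0 subr0.
have {}w2 : s' * m = w.2 by rewrite w2 mulr0 add0r.
rewrite w1 w2 => n2 n1; case: t => [[[a b] u] e].
by case: i i3 => [[|[|[|//]]] hi] _ /=; case: u; case: e => /= -[]; lia.
Qed.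

(** A priori each of the three cells is moved by its own lattice vector. Relative to the vector of
    the vertex, the other two have entries among -1, 0 and 1; being multiples of [m], these entries
    vanish, so one translation serves for all. *)
Lemma mu_fibres t t' : mu t = mu t' <-> exists2 w, lattice m 0 w & t' = shift w t.
Proof.
split=> [/mu_eq E|[w wL ->]]; last first.
  by apply/mu_eq=> i i3; apply/same_orbitP; exists w; rewrite // tcell_shift.
have /same_orbitP[w wL E0] := E 0%N isT.
have /same_orbitP[w1 [s1 [s1' [h1 h1']]] E1] := E 1%N isT.
have /same_orbitP[w2 [s2 [s2' [h2 h2']]] E2] := E 2%N isT.
have [s [s' [h0 h0']]] := wL; exists w => //.
have := mulm_neq (s1 - s); have := mulm_neq (s2 - s).
have := mulm_neq (s1' - s'); have := mulm_neq (s2' - s').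
have -> : (s1 - s) * m = w1.1 - w.1 by rewrite h1 h0; ring.
have -> : (s2 - s) * m = w2.1 - w.1 by rewrite h2 h0; ring.
have -> : (s1' - s') * m = w1.2 - w.2 by rewrite h1' h0'; ring.
have -> : (s2' - s') * m = w2.2 - w.2 by rewrite h2' h0'; ring.
move=> n4 n3 n2 n1 {h0 h0' h1 h1' h2 h2' wL E}.
case: w w1 w2 E0 E1 E2 n1 n2 n3 n4 => [x y] [x1 y1] [x2 y2].
case: t t' => [[[a b] u] e] [[[a' b'] u'] e'] /= -[Ea Eb].
have {Ea}-> : a' = a + x by lia.
have {Eb}-> : b' = b + y by lia.
by case: u; case: u'; rewrite /= => E1 [F1 F2] n1 n2 n3 n4;
  (try by exfalso; lia); case: e E1; case: e' => //= -[G1 G2]; exfalso; lia.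
Qed.

End Chart.

Lemma toroid_chart : exists2 mu : tflag -> flag_maniplex hQ A0, chart (@adj 4 _) mu &
  forall t t', mu t = mu t' <-> exists2 w, lattice m 0 w & t' = shift w t.
Proof.
have [mu muE] := tface_chart; exists mu; last exact: mu_fibres.
by move=> i t i3; apply: mu_padj.
Qed.

End ToroidChart.

(* The dual of the tessellation, composed with the reflection in a diagonal. *)
Section ToroidDual.
Variables b c b' c' : int.
Hypothesis hlat : forall x y, lattice b' c' (x, y) <-> lattice b c (y, x).

(** Adding 1 in doubled coordinates is a shift by half a diagonal, which exchanges vertices with
    squares. *)
Definition swap_cell (u : int * int) : int * int := (u.2 + 1, u.1 + 1).

Lemma same_orbit_swap u v : same_orbit b' c' u v = same_orbit b c (swap_cell u) (swap_cell v).
Proof.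
apply/idP/idP => /same_orbitP[[x y] /hlat wL].
  by move=> -> /=; apply/same_orbitP; exists (y, x) => //=; rewrite /swap_cell /=; congr pair; ring.
rewrite /swap_cell /= => -[E1 E2]; apply/same_orbitP; exists (y, x); first exact/hlat/hlat.
by case: u v E1 E2 => [u1 u2] [v1 v2] /= E1 E2; congr pair; lia.
Qed.

Definition toroid_swap (X : toroid b' c') : toroid b c :=
  match X with
  | LeastFace => GreatestFace b c
  | ProperFace X => ProperFace (\pi_(torus_cell b c)%qT (swap_cell (repr X)))
  | GreatestFace => LeastFace b c
  end.

Lemma toroid_swap_pi u : toroid_swap (ProperFace (\pi_(torus_cell b' c')%qT u)) =
  ProperFace (\pi_(torus_cell b c)%qT (swap_cell u)).
Proof.
congr ProperFace; apply/torus_cell_eqP; rewrite -same_orbit_swap.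
by apply/torus_cell_eqP; rewrite reprK.
Qed.

Lemma line_incident_swap (x y : int) : line_incident (y + 1) (x + 1) = line_incident x y.
Proof. by apply/idP/idP; rewrite /line_incident; lia. Qed.

Lemma cell_incident_swap u v : cell_incident (swap_cell v) (swap_cell u) = cell_incident u v.
Proof. by rewrite /cell_incident /= !line_incident_swap andbC. Qed.

Lemma toroid_swap_le X Y : (toroid_swap X <= toroid_swap Y)%O = (Y <= X)%O.
Proof.
have leE b1 c1 (U V : toroid b1 c1) : (U <= V)%O = toroid_le U V by [].
rewrite !leE; case: X Y => [|X|] [|Y|] //.
elim/quotW: X => u; elim/quotW: Y => v.
rewrite (toroid_swap_pi u) (toroid_swap_pi v) /=; apply/asboolP/asboolP.
  move=> [u' [v' [/torus_cell_eqP + /torus_cell_eqP + uv]]].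
  pose unswap (w : int * int) : int * int := (w.2 - 1, w.1 - 1).
  have swK w : swap_cell (unswap w) = w by case: w => x y; rewrite /swap_cell /= !subrK.
  rewrite -(swK u') -(swK v') -!same_orbit_swap => hu hv.
  exists (unswap v'), (unswap u'); split; try exact/torus_cell_eqP.
  by rewrite -cell_incident_swap !swK.
move=> [v' [u' [/torus_cell_eqP + /torus_cell_eqP + uv]]]; rewrite !same_orbit_swap => hv hu.
exists (swap_cell u'), (swap_cell v'); split; try exact/torus_cell_eqP.
by rewrite cell_incident_swap.
Qed.

Lemma toroid_swap_onto Y : exists X, toroid_swap X = Y.
Proof.
case: Y => [|Y|]; [by exists (GreatestFace b' c') | | by exists (LeastFace b' c')].
elim/quotW: Y => -[x y]; exists (ProperFace (\pi_(torus_cell b' c')%qT (y - 1, x - 1))).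
by rewrite toroid_swap_pi /swap_cell /= !subrK.
Qed.

(** The duality carries the vertex-figure at [v] to the facet [s v] with the order reversed, and
    [toroid_swap] reverses it once more. *)
Lemma vertex_figure_dual (d : Order.disp_t) (P : finTBPOrderType d) (s : {perm P}) (v : P) :
  duality s -> isomorphic_to (section \bot%O (s v)) (toroid b c) ->
  isomorphic_to (section v \top%O) (toroid b' c').
Proof.
move=> sd [f f_mono f_img].
exists (fun X => s^-1%g (f (toroid_swap X))) => [X Y|z].
  by rewrite -sd !permKV f_mono toroid_swap_le.
rewrite inE lex1 andbT -sd.
have := f_img (s z); rewrite inE le0x /= => ->; split=> [[Y YE]|[X <-]].
  by have [X XE] := toroid_swap_onto Y; exists X; rewrite XE YE permK.
by exists (toroid_swap X); rewrite permKV.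
Qed.

End ToroidDual.

End Charts.

(** * The projective special linear group *)

Section TwoByTwo.
Variable F : fieldType.
Local Open Scope ring_scope.
Implicit Types a b c d : F.

Definition mx2 a b c d : 'M[F]_2 :=
  \matrix_(i, j) (if i == 0 then if j == 0 then a else b
                  else if j == 0 then c else d).

Lemma mul_mx2 a b c d a' b' c' d' : mx2 a b c d *m mx2 a' b' c' d' =
  mx2 (a * a' + b * c') (a * b' + b * d') (c * a' + d * c') (c * b' + d * d').
Proof.
apply/matrixP=> i j; rewrite !mxE !big_ord_recl big_ord0 !mxE addr0 /=.
by case: (i == 0); case: (j == 0).
Qed.

Lemma det_mx2 a b c d : \det (mx2 a b c d) = a * d - b * c.
Proof.
rewrite (expand_det_row _ ord0) !big_ord_recl big_ord0 addr0 /cofactor !det_mx11 !mxE /=.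
by rewrite /bump /= !expr1 ?expr0; ring.
Qed.

Lemma eq_mx2 a b c d a' b' c' d' : mx2 a b c d = mx2 a' b' c' d' ->
  [/\ a = a', b = b', c = c' & d = d'].
Proof.
by move/matrixP=> E; split; [have := E 0 0 | have := E 0 1 | have := E 1 0 | have := E 1 1];
  rewrite !mxE.
Qed.

Lemma mx2P (A : 'M[F]_2) : A = mx2 (A 0 0) (A 0 1) (A 1 0) (A 1 1).
Proof.
apply/matrixP=> i j; rewrite mxE.
have o2 (k : 'I_2) : k = if k == 0 then 0 else 1.
  by case: k => [[|[|//]] hk]; apply: val_inj.
by rewrite {1}(o2 i) {1}(o2 j); case: (i == 0); case: (j == 0).
Qed.

End TwoByTwo.

Section PSL.
Variable p : nat.
Hypothesis p_pr : prime p.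
Local Open Scope ring_scope.
Local Notation F := 'F_p.
Local Notation K := (subg_of (PSL2 p)).
Local Notation Z := ('Z(SL2 p))%G.
Implicit Types a b c d : F.

(** [insubd] makes [sl2] total, with value 1 on singular matrices; the lock prevents its unfolding
    in entry computations. *)
Fact sl2_key : unit. Proof. exact. Qed.
Definition sl2 : F -> F -> F -> F -> {'GL_2['F_p]} :=
  locked_with sl2_key (fun a b c d => insubd (1%g : {'GL_2['F_p]}) (mx2 a b c d)).

Lemma val_sl2 a b c d : a * d - b * c = 1 -> GLval (sl2 a b c d) = mx2 a b c d.
Proof.
move=> h; rewrite /sl2 unlock [LHS]insubdK // unfold_in; rewrite unitmxE det_mx2 h.
exact: unitr1.
Qed.

Lemma sl2_in a b c d : a * d - b * c = 1 -> sl2 a b c d \in SL2 p.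
Proof. by move=> h; rewrite inE val_sl2 // det_mx2 h. Qed.

Lemma det2M a b c d a' b' c' d' : a * d - b * c = 1 -> a' * d' - b' * c' = 1 ->
  (a * a' + b * c') * (c * b' + d * d') - (a * b' + b * d') * (c * a' + d * c') = 1.
Proof.
move=> h h'; transitivity ((a * d - b * c) * (a' * d' - b' * c')); first by ring.
by rewrite h h' mulr1.
Qed.

Lemma sl2M a b c d a' b' c' d' : a * d - b * c = 1 -> a' * d' - b' * c' = 1 ->
  (sl2 a b c d * sl2 a' b' c' d')%g =
  sl2 (a * a' + b * c') (a * b' + b * d') (c * a' + d * c') (c * b' + d * d').
Proof.
move=> h h'; apply: val_inj; rewrite [LHS](_ : _ = mx2 a b c d *m mx2 a' b' c' d'); last first.
  by rewrite -!val_sl2.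
by rewrite mul_mx2 [RHS]val_sl2 // det2M.
Qed.

Lemma sl2_ex x : x \in SL2 p -> exists a b c d, a * d - b * c = 1 /\ x = sl2 a b c d.
Proof.
rewrite inE => /eqP; set A := GLval x => dA.
rewrite (mx2P A) det_mx2 in dA.
exists (A 0 0), (A 0 1), (A 1 0), (A 1 1); split=> //.
by apply: val_inj; rewrite [RHS]val_sl2 // -mx2P.
Qed.

Lemma SL2_norm : (SL2 p \subset 'N(Z))%g.
Proof. by apply: normal_norm; apply: center_normal. Qed.

Fact psl2_key : unit. Proof. exact. Qed.
Definition psl2 : F -> F -> F -> F -> K :=
  locked_with psl2_key (fun a b c d => subg (PSL2 p) (coset Z (sl2 a b c d))).

Lemma psl2E a b c d : psl2 a b c d = subg (PSL2 p) (coset Z (sl2 a b c d)).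
Proof. by rewrite /psl2 unlock. Qed.

Lemma val_psl2 a b c d : a * d - b * c = 1 -> sgval (psl2 a b c d) = coset Z (sl2 a b c d).
Proof. by move=> h; rewrite psl2E subgK //; apply/mem_quotient/sl2_in. Qed.

Lemma psl2M a b c d a' b' c' d' : a * d - b * c = 1 -> a' * d' - b' * c' = 1 ->
  (psl2 a b c d * psl2 a' b' c' d')%g =
  psl2 (a * a' + b * c') (a * b' + b * d') (c * a' + d * c') (c * b' + d * d').
Proof.
move=> h h'; apply: subg_inj; rewrite /= !val_psl2 ?det2M //.
by rewrite -sl2M // morphM // (subsetP SL2_norm) // sl2_in.
Qed.

Lemma psl2_ex (x : K) : exists a b c d, a * d - b * c = 1 /\ x = psl2 a b c d.
Proof.
have /morphimP[y _ yS xE] := subgP x.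
have [a [b [c [d [h yE]]]]] := sl2_ex yS; exists a, b, c, d; split=> //.
by apply: subg_inj; rewrite val_psl2 // -yE.
Qed.

Lemma psl2_id : psl2 1 0 0 1 = 1%g.
Proof.
apply: subg_inj; rewrite val_psl2 ?mulr1 ?mulr0 ?subr0 //= (_ : sl2 1 0 0 1 = 1%g) ?morph1 //.
apply: val_inj; rewrite [LHS]val_sl2 ?mulr1 ?mulr0 ?subr0 //.
by apply/matrixP=> i j; rewrite !mxE; case: i j => [[|[|//]] hi] [[|[|//]] hj].
Qed.

(** A central matrix commutes with both elementary matrices, which forces it to be scalar. *)
Lemma psl2_eq1 a b c d : a * d - b * c = 1 -> psl2 a b c d = 1%g -> [/\ b = 0, c = 0 & a = d].
Proof.
move=> h E; have : coset Z (sl2 a b c d) = 1%g by rewrite -val_psl2 // E.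
move/(coset_idr (subsetP SL2_norm _ (sl2_in h))) => /centerP[_ C].
have hT : (1 : F) * 1 - 1 * 0 = 1 by ring.
have hL : (1 : F) * 1 - 0 * 1 = 1 by ring.
have := C _ (sl2_in hT); have := C _ (sl2_in hL).
rewrite /commute (sl2M h hL) (sl2M hL h) (sl2M h hT) (sl2M hT h).
move=> /(congr1 (@GLval _ _)) E1 /(congr1 (@GLval _ _)) E2.
have {E1}[] : [/\ a * 1 + b * 1 = 1 * a + 0 * c, a * 0 + b * 1 = 1 * b + 0 * d,
    c * 1 + d * 1 = 1 * a + 1 * c & c * 0 + d * 1 = 1 * b + 1 * d].
  by apply: eq_mx2; move: E1; rewrite (val_sl2 (det2M h hL)) (val_sl2 (det2M hL h)).
have {E2}[] : [/\ a * 1 + b * 0 = 1 * a + 1 * c, a * 1 + b * 1 = 1 * b + 1 * d,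
    c * 1 + d * 0 = 0 * a + 1 * c & c * 1 + d * 1 = 0 * b + 1 * d].
  by apply: eq_mx2; move: E2; rewrite (val_sl2 (det2M h hT)) (val_sl2 (det2M hT h)).
rewrite !(mul1r, mulr1, mul0r, mulr0, addr0, add0r) => e1 e3 _ _ e2 _ _ _.
have c0 : c = 0 by apply: (addrI a); rewrite -e1 addr0.
have b0 : b = 0 by apply: (addrI a); rewrite e2 addr0.
by split=> //; move: e3; rewrite b0 addr0 add0r.
Qed.

Lemma psl2V a b c d : a * d - b * c = 1 -> (psl2 a b c d)^-1%g = psl2 d (- b) (- c) a.
Proof.
move=> h; apply/eqP; rewrite eq_invg_mul psl2M //; last by rewrite -h; ring.
rewrite -psl2_id; apply/eqP; congr psl2; try (by ring); rewrite -h; ring.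
Qed.

(** The quotient of the two matrices is scalar; its diagonal entry [l] is the factor [e], of square
    1 because both determinants are 1. *)
Lemma psl2_inj a b c d a' b' c' d' : a * d - b * c = 1 -> a' * d' - b' * c' = 1 ->
  psl2 a b c d = psl2 a' b' c' d' -> exists2 e : F, e * e = 1 &
    [/\ a = e * a', b = e * b', c = e * c' & d = e * d'].
Proof.
move=> h h' E; have : (psl2 a b c d * (psl2 a' b' c' d')^-1)%g = 1%g by rewrite E mulgV.
have hV : d' * a' - - b' * - c' = 1 by rewrite -h'; ring.
rewrite psl2V // psl2M // => /psl2_eq1[].
  exact: det2M.
set l := a * d' + b * - c' => e1 e2 e3.
have {}e1 : b * a' - a * b' = 0 by rewrite -e1; ring.
have {}e2 : c * d' - d * c' = 0 by rewrite -e2; ring.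
exists l.
  transitivity ((a * d - b * c) * (a' * d' - b' * c') + (b * a' - a * b') * (c * d' - d * c')).
    by rewrite {2}e3 /l; ring.
  by rewrite h h' e1 mul0r addr0 mulr1.
split.
- transitivity (a' * l + c' * (b * a' - a * b')); last by rewrite e1 mulr0 addr0 mulrC.
  by rewrite -[LHS]mulr1 -h' /l; ring.
- transitivity (b' * l + d' * (b * a' - a * b')); last by rewrite e1 mulr0 addr0 mulrC.
  by rewrite -[LHS]mulr1 -h' /l; ring.
- transitivity (c' * (c * - b' + d * a') + a' * (c * d' - d * c')).
    by rewrite -[LHS]mulr1 -h'; ring.
  by rewrite e2 mulr0 addr0 -e3 mulrC.
transitivity (d' * (c * - b' + d * a') + b' * (c * d' - d * c')).
  by rewrite -[LHS]mulr1 -h'; ring.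
by rewrite e2 mulr0 addr0 -e3 mulrC.
Qed.

Lemma psl2N a b c d : a * d - b * c = 1 -> psl2 (- a) (- b) (- c) (- d) = psl2 a b c d.
Proof.
move=> h; apply: subg_inj; rewrite !val_psl2 //; last by rewrite -h; ring.
have hN : (-1 : F) * -1 - 0 * 0 = 1 by ring.
have -> : sl2 (- a) (- b) (- c) (- d) = (sl2 (-1) 0 0 (-1) * sl2 a b c d)%g.
  by rewrite (sl2M hN h); congr sl2; ring.
rewrite morphM ?(subsetP SL2_norm) ?sl2_in //= coset_id ?mul1g //.
apply/centerP; split; first exact: sl2_in.
move=> y /sl2_ex[a' [b' [c' [d' [h' ->]]]]]; rewrite /commute (sl2M hN h') (sl2M h' hN).
by congr sl2; ring.
Qed.

End PSL.

(** * Generation, simplicity, centre and order of PSL_2(p) *)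

Section SimplePSL.
Variable p : nat.
Hypothesis p_pr : prime p.
Local Open Scope ring_scope.
Local Notation F := 'F_p.
Local Notation K := (subg_of (PSL2 p)).
Local Notation psl2 := (@psl2 p).
Implicit Types a b c d : F.

Definition Tm a : K := psl2 1 a 0 1.
Definition Lm a : K := psl2 1 0 a 1.

Lemma detT a : 1 * 1 - a * 0 = 1. Proof. by ring. Qed.
Lemma detL a : 1 * 1 - 0 * a = 1. Proof. by ring. Qed.

Lemma TmM a b : (Tm a * Tm b)%g = Tm (a + b).
Proof. by rewrite /Tm (psl2M (detT a) (detT b)); congr psl2; ring. Qed.

Lemma LmM a b : (Lm a * Lm b)%g = Lm (a + b).
Proof. by rewrite /Lm (psl2M (detL a) (detL b)); congr psl2; ring. Qed.

Definition Wm : K := psl2 0 1 (-1) 0.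

Lemma detW : 0 * 0 - 1 * -1 = 1 :> F. Proof. by ring. Qed.

Lemma WmV : (Wm^-1)%g = psl2 0 (-1) 1 0.
Proof. by rewrite /Wm (psl2V detW) opprK. Qed.

Lemma detWV : 0 * 0 - -1 * 1 = 1 :> F. Proof. by ring. Qed.

Lemma Tm0 : Tm 0 = 1%g. Proof. exact: psl2_id. Qed.
Lemma Lm0 : Lm 0 = 1%g. Proof. exact: psl2_id. Qed.

Lemma TmX a n : (Tm a ^+ n)%g = Tm (a *+ n).
Proof. by elim: n => [|n IH]; rewrite ?Tm0 // expgS IH TmM mulrS. Qed.

Lemma LmX a n : (Lm a ^+ n)%g = Lm (a *+ n).
Proof. by elim: n => [|n IH]; rewrite ?Lm0 // expgS IH LmM mulrS. Qed.

Lemma TmV a : (Tm a)^-1%g = Tm (- a).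
Proof. by rewrite /Tm (psl2V (detT a)) oppr0. Qed.

Lemma LmV a : (Lm a)^-1%g = Lm (- a).
Proof. by rewrite /Lm (psl2V (detL a)) oppr0. Qed.

Lemma Tm_inj : injective Tm.
Proof.
move=> a b E; have : Tm (a - b) = 1%g by rewrite -TmM -TmV E mulgV.
by case/(psl2_eq1 (detT _)) => /subr0_eq.
Qed.

Lemma Tm_Lm a b : Tm a = Lm b -> a = 0.
Proof.
move=> E; have : (Tm a * (Lm b)^-1)%g = 1%g by rewrite E mulgV.
rewrite LmV (psl2M (detT a) (detL (- b))) => /(psl2_eq1 (det2M (detT a) (detL (- b)))) [].
by rewrite mulr0 add0r mulr1.
Qed.

Lemma Fp_mulrn (e a : F) : e != 0 -> exists n, a = e *+ n.
Proof.
move=> e0; exists (a / e : F) => //; rewrite -mulr_natr natr_Zp.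
by rewrite mulrC divfK.
Qed.

(** Over the prime field every element is a natural multiple of [e], so [N] contains all
    transvections of both kinds. A matrix with lower left entry [c] nonzero is [Tm s * Lm c * Tm t];
    the others are brought to this case by a factor [Lm]. *)
Lemma gen_PSL (N : {group K}) (e e' : F) : e != 0 -> e' != 0 ->
  Tm e \in N -> Lm e' \in N -> N = [set: K] :> {set K}.
Proof.
move=> e0 e0' eN eN'.
have TN a : Tm a \in N by have [n ->] := Fp_mulrn a e0; rewrite -TmX groupX.
have LN a : Lm a \in N by have [n ->] := Fp_mulrn a e0'; rewrite -LmX groupX.
have H a b c d : a * d - b * c = 1 -> c != 0 -> psl2 a b c d \in N.
  move=> h c0; pose s := (a - 1) / c; pose t := (d - 1) / c.
  suff -> : psl2 a b c d = (Tm s * Lm c * Tm t)%g by rewrite !groupM.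
  have hh := det2M (detT s) (detL c).
  rewrite /Tm /Lm (psl2M (detT _) (detL _)) (psl2M hh (detT _)) /s /t; congr psl2; try by field.
  transitivity ((a * d - (a * d - b * c)) / c); last by rewrite h; field.
  by field.
apply/setP=> x; rewrite inE; have [a [b [c [d [h ->]]]]] := psl2_ex x.
have [c0|] := eqVneq c 0; last exact: H.
have d0 : d != 0.
  by apply: contra_eq_neq h => ->; rewrite c0 !mulr0 subr0 eq_sym oner_neq0.
pose M := psl2 (a + b) b (c + d) d; pose m1 : F := - 1.
suff -> : psl2 a b c d = (M * Lm m1)%g.
  by rewrite groupM //; apply: H; rewrite ?c0 ?add0r // -h c0; ring.
rewrite /M /m1 (psl2M _ (detL _)); last by rewrite -h; ring.
by congr psl2; ring.
Qed.

(** Commutators turn a nontrivial element into a transvection. An element with nonzero [c] is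
    conjugated to have upper left entry 0; a commutator with [D = diag(2, 1/2)] makes it upper
    triangular with diagonal 4, 1/4; a commutator with [Tm 1] then leaves [Tm 15], where 15 = 4^2 -
    1. *)
Lemma simple_PSL (N : {group K}) (x : K) : (2%:R : F) != 0 -> (15%:R : F) != 0 ->
  (forall y z, y \in N -> (y ^ z)%g \in N) -> x \in N -> x != 1%g -> N = [set: K] :> {set K}.
Proof.
move=> h2 h15 hN xN x1.
have [a [b [c [d [h [MN c0]]]]]] :
    exists a b c d, a * d - b * c = 1 /\ (psl2 a b c d \in N /\ c != 0).
  have [a [b [c [d [h xE]]]]] := psl2_ex x.
  have [c0|c0] := eqVneq c 0; last by exists a, b, c, d; rewrite -xE.
  have [b0|b0] := eqVneq b 0; last first.
    exists d, (- c), (- b), a; rewrite oppr_eq0; split; first by rewrite -h; ring.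
    split=> //; suff -> : psl2 d (- c) (- b) a = (x ^ Wm)%g by apply: hN.
    rewrite conjgE xE WmV mulgA (psl2M detWV h) (psl2M (det2M detWV h) detW).
    by congr psl2; ring.
  (* Conjugation by [Lm 1] gives a diagonal matrix the lower left entry [d - a], which vanishes only
     for scalars. *)
  exists a, 0, (d - a), d; rewrite b0 c0 mul0r subr0 in h *; split; first by rewrite mul0r subr0.
  split.
    pose L1 := Lm 1; suff -> : psl2 a 0 (d - a) d = (x ^ L1)%g by apply: hN.
    have h' : a * d - 0 * 0 = 1 by rewrite mul0r subr0.
    rewrite conjgE xE /L1 LmV b0 c0 /Lm mulgA (psl2M (detL _) h').
    rewrite (psl2M (det2M (detL _) h') (detL _)).
    by congr psl2; ring.
  rewrite subr_eq0; apply: contraNneq x1 => da; rewrite xE b0 c0.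
  rewrite da in h *; have : (a - 1) * (a + 1) = a * a - 1 by ring.
  rewrite h subrr.
  move/eqP; rewrite mulf_eq0 subr_eq0 addr_eq0 => /orP[]/eqP->; first by rewrite -psl2_id.
  rewrite -psl2_id -[X in _ == X]psl2N ?oppr0 //; last by ring.
pose s := a / c; pose t := c * s + d.
have hM : 0 * t - (- c^-1) * c = 1 by rewrite mul0r sub0r mulNr opprK mulVf.
pose M := psl2 0 (- c^-1) c t.
have {}MN : M \in N.
  suff -> : M = (psl2 a b c d ^ Tm s)%g by apply: hN.
  rewrite conjgE TmV /Tm mulgA (psl2M (detT _) h) (psl2M (det2M (detT _) h) (detT _)).
  congr psl2; rewrite ?/t ?/s; try by field.
  transitivity (- ((a * d - b * c) / c)); last by field.
  by rewrite h mul1r.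
have h4 : 4%:R = 2%:R * 2%:R :> F by rewrite -natrM.
have h40 : (4%:R : F) != 0 by rewrite h4 mulf_neq0.
have hD : 2%:R * (2%:R)^-1 - 0 * 0 = 1 :> F by rewrite mulfV // mul0r subr0.
have hB : 4%:R * (4%:R)^-1 - (3%:R * t / c) * 0 = 1 :> F.
  by rewrite mulr0 subr0 mulfV.
pose B := psl2 4%:R (3%:R * t / c) 0 (4%:R)^-1; pose D := psl2 2%:R 0 0 (2%:R)^-1.
have BN : B \in N.
  suff -> : B = ((M^-1 ^ (D^-1)) * M)%g by rewrite groupM // hN // groupV.
  have hV : t * 0 - - - c^-1 * - c = 1 by rewrite -hM; ring.
  have hV2 : (2%:R)^-1 * 2%:R - - 0 * - 0 = 1 :> F by rewrite oppr0 mul0r subr0 mulVf.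
  rewrite conjgE invgK mulgA (psl2V hM) (psl2V hD) (psl2M hD hV) (psl2M (det2M hD hV) hV2).
  rewrite (psl2M (det2M (det2M hD hV) hV2) hM).
  by congr psl2; rewrite ?h4 ?invfM; field; rewrite ?c0 ?h2.
have TN : Tm 15%:R \in N.
  pose T1 := Tm 1; suff -> : Tm 15%:R = (B * (B^-1) ^ (T1^-1))%g.
    by rewrite groupM // hN // groupV.
  have hV : (4%:R)^-1 * 4%:R - - (3%:R * t / c) * - 0 = 1 by rewrite oppr0 mulr0 subr0 mulVf.
  rewrite conjgE invgK (psl2V hB) /T1 TmV /Tm !mulgA (psl2M hB (detT _)).
  rewrite (psl2M (det2M hB (detT _)) hV) (psl2M (det2M (det2M hB (detT _)) hV) (detT _)).
  by congr psl2; field; rewrite ?c0 ?h40.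
apply: (gen_PSL h15 _ TN (e' := - 15%:R)); first by rewrite oppr_eq0.
suff -> : Lm (- 15%:R) = (Tm 15%:R ^ Wm)%g by apply: hN.
rewrite conjgE WmV mulgA /Tm (psl2M detWV (detT _)) (psl2M (det2M detWV (detT _)) detW).
by congr psl2; ring.
Qed.

(** By simplicity a nontrivial centre would be everything, but [Tm 1] and [Lm 1] do not commute. *)
Lemma center_PSL (x : K) : (2%:R : F) != 0 -> (15%:R : F) != 0 ->
  (forall y, commute x y) -> x = 1%g.
Proof.
move=> h2 h15 xC; apply/eqP; apply: contraT => x1.
have NC : x \in 'Z([set: K])%g by apply/centerP; split; rewrite ?inE // => y _; apply: xC.
have hz (y z : K) : y \in 'Z([set: K])%g -> (y ^ z)%g \in 'Z([set: K])%g.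
  by rewrite memJ_norm // (subsetP (gFnorm _ _)) // inE.
have E := @simple_PSL ('Z([set: K]))%G x h2 h15 hz NC x1.
have : Tm 1 \in 'Z([set: K])%g by rewrite E inE.
case/centerP=> _ /(_ (Lm 1)); rewrite inE => /(_ isT).
rewrite /commute /Tm /Lm (psl2M (detT _) (detL _)) (psl2M (detL _) (detT _)).
case/(psl2_inj (det2M (detT _) (detL _)) (det2M (detL _) (detT _))) => e _ [+ + _ _].
rewrite !(mulr1, mul1r, mulr0, mul0r, addr0, add0r) => e2 e1.
by move: e2; rewrite -e1 => /eqP; rewrite -subr_eq0 addrK oner_eq0.
Qed.

Definition detU (u : {'GL_2['F_p]}) : {unit 'F_p} := insubd (1%g : {unit 'F_p}) (\det (GLval u)).

Lemma val_detU u : val (detU u) = \det (GLval u).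
Proof. by rewrite insubdK //; have := GL_unit u; rewrite unitmxE. Qed.

Lemma detUM : {in setT &, {morph detU : u v / (u * v)%g}}.
Proof. by move=> u v _ _; apply: val_inj; rewrite /= !val_detU det_mulmx. Qed.

Canonical detU_morphism := Morphism detUM.

(** The kernel of the determinant on [GL_2], whose order is known. The image has order dividing
    [p.-1], and asking only for divisibility spares the proof that the determinant is onto. *)
Lemma card_SL2 : (p * (p ^ 2 - 1) %| #|SL2 p|)%N.
Proof.
have kE : ('ker detU)%g = SL2 p.
  by apply/setP=> u; rewrite !inE -val_eqE /= val_detU.
have := card_GL_2 F; rewrite card_Fp // => cGL.
have /dvdnP[j jE] : (#|detU @* setT|%g %| p.-1)%N.
  by rewrite -[X in X.-1](card_Fp p_pr) -card_finField_unit; apply/cardSg/subsetT.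
have := LagrangeI setT ('ker detU)%G; have := card_morphim detU_morphism setT.
rewrite setTI => <- /=; rewrite setTI kE cGL => E.
have i0 : (0 < #|detU @* setT|%g)%N by apply: cardG_gt0.
have p1 := prime_gt1 p_pr.
suff -> : #|SL2 p| = (p * (p ^ 2 - 1) * j)%N by apply: dvdn_mulr.
apply/eqP; rewrite -(eqn_pmul2r i0); apply/eqP; rewrite E.
have -> : (p ^ 2 - 1 = p.-1 * p.+1)%N by case: (p) p1 => [|q] // _; rewrite /= -mulnn; nia.
by rewrite -[RHS]mulnA -jE -mulnn; lia.
Qed.

(** The factor 2 accounts for the centre of [SL2 p], whose elements can only be 1 and -1. *)
Lemma card_PSL : (p * (p ^ 2 - 1) %| 2 * #|[set: K]|)%N.
Proof.
have -> : #|[set: K]| = #|PSL2 p| by apply/esym/card_isog/isog_subg.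
have -> : #|PSL2 p| = #|SL2 p : 'Z(SL2 p)|%g by apply/card_quotient/SL2_norm.
apply: dvdn_trans card_SL2 _; rewrite -(Lagrange (center_sub (SL2 p))) dvdn_mul //.
have hN : (-1 : F) * -1 - 0 * 0 = 1 by ring.
have : (#|'Z(SL2 p)|%g <= 2)%N.
  apply: leq_trans (subset_leq_card (B := [set 1%g; sl2 (-1) 0 0 (-1)]) _) _; last first.
    by rewrite cards2; case: (_ != _).
  apply/subsetP=> z zZ; have zS := subsetP (center_sub _) _ zZ.
  have [a [b [c [d [h zE]]]]] := sl2_ex zS.
  have : psl2 a b c d = 1%g by apply: subg_inj; rewrite val_psl2 //= -zE coset_id.
  case/(psl2_eq1 h) => b0 c0 ad; rewrite b0 c0 ad mul0r subr0 in h zE *.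
  have : (d - 1) * (d + 1) = d * d - 1 by ring.
  rewrite h subrr.
  move/eqP; rewrite mulf_eq0 subr_eq0 addr_eq0 => /orP[]/eqP dE; rewrite !inE zE dE ?eqxx ?orbT //.
  apply/orP; left; apply/eqP/val_inj; rewrite [LHS]val_sl2; last by ring.
  by apply/matrixP=> i j; rewrite !mxE; case: i j => [[|[|//]] hi] [[|[|//]] hj].
have : (0 < #|'Z(SL2 p)|%g)%N by apply: cardG_gt0.
by case: #|_| => [|[|[|n]]].
Qed.

End SimplePSL.

(** * Voltages in PSL_2(p) from an eighth root of unity *)

Local Notation o0 := (@Ordinal 4 0 isT).
Local Notation o1 := (@Ordinal 4 1 isT).
Local Notation o2 := (@Ordinal 4 2 isT).
Local Notation o3 := (@Ordinal 4 3 isT).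

Lemma ord4P (P : 'I_4 -> Prop) : P o0 -> P o1 -> P o2 -> P o3 -> forall i, P i.
Proof.
move=> P0 P1 P2 P3 [[|[|[|[|//]]]] hi].
- by rewrite (_ : Ordinal hi = o0) //; apply: val_inj.
- by rewrite (_ : Ordinal hi = o1) //; apply: val_inj.
- by rewrite (_ : Ordinal hi = o2) //; apply: val_inj.
by rewrite (_ : Ordinal hi = o3) //; apply: val_inj.
Qed.

Section Voltages.
Variable p : nat.
Hypothesis p_pr : prime p.
Local Open Scope ring_scope.
Local Notation F := 'F_p.
Local Notation K := (subg_of (PSL2 p)).
Local Notation psl2 := (@psl2 p).
Variable z : F.
Hypotheses (z4 : z ^+ 4 = -1) (h2 : (2%:R : F) != 0).

(* Images in the projective group of the Moebius maps [w |-> i w + 1],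
   [w |-> w], [w |-> - i w] and [w |-> w / ((1 - i) w - 1)], where [i] is
   [z ^+ 2] and the inverse of [z] is [- z ^+ 3]. *)
Definition volt (i : 'I_4) : K :=
  match val i with
  | 0%N => psl2 z (- z ^+ 3) 0 (- z ^+ 3)
  | 1%N => 1%g
  | 2%N => psl2 (- z ^+ 3) 0 0 z
  | _ => psl2 (- z ^+ 2) 0 (- 1 - z ^+ 2) (z ^+ 2)
  end.

Lemma det0 : z * - z ^+ 3 - - z ^+ 3 * 0 = 1. Proof. by ring: z4. Qed.
Lemma det2 : - z ^+ 3 * z - 0 * 0 = 1. Proof. by ring: z4. Qed.
Lemma det3 : - z ^+ 2 * z ^+ 2 - 0 * (- 1 - z ^+ 2) = 1. Proof. by ring: z4. Qed.
Lemma det0V : - z ^+ 3 * z - - - z ^+ 3 * - 0 = 1. Proof. by ring: z4. Qed.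
Lemma det2V : z * - z ^+ 3 - - 0 * - 0 = 1. Proof. by ring: z4. Qed.
Lemma det3V : z ^+ 2 * - z ^+ 2 - - 0 * - (- 1 - z ^+ 2) = 1. Proof. by ring: z4. Qed.

(** Lifted moves commute when the square of moves [i], [j] has trivial total voltage, with signs
    alternating along it. The two matrices differ by the factor -1, whence [psl2N]. *)
Lemma volt_far (i j : 'I_4) : (i.+1 < j)%N ->
  (volt i * (volt j)^-1 = volt j * (volt i)^-1)%g.
Proof.
elim/ord4P: i; elim/ord4P: j => // _; rewrite /volt /=.
- rewrite (psl2V det0) (psl2V det2) (psl2M det0 det2V) (psl2M det2 det0V).
  rewrite -[RHS]psl2N; last exact: (det2M det2 det0V).
  by congr psl2; ring: z4.
- rewrite (psl2V det0) (psl2V det3) (psl2M det0 det3V) (psl2M det3 det0V).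
  rewrite -[RHS]psl2N; last exact: (det2M det3 det0V).
  by congr psl2; ring: z4.
rewrite invg1 mulg1 mul1g (psl2V det3) -[RHS]psl2N; last exact: det3.
by congr psl2; ring: z4.
Qed.

(** The ring map from the Gaussian integers to ['F_p] that sends [i] to [z ^+ 2], written on
    coordinates. *)
Definition phi (w : int * int) : F := w.1%:~R + z ^+ 2 * w.2%:~R.

Lemma phiD v w : phi (v.1 + w.1, v.2 + w.2) = phi v + phi w.
Proof. by rewrite /phi /= !rmorphD /=; ring. Qed.

Definition zpow u : F := match u with East => 1 | North => z | West => z ^+ 2 | South => z ^+ 3 end.

Definition zpowV u : F :=
  match u with East => 1 | North => - z ^+ 3 | West => - z ^+ 2 | South => - z end.

(** The class of the Moebius map [x |-> i^k x + phi w], where the direction [u] is [i^k]: the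
    rotation of the plane taking vertex 0 and East to [w] and [u], reduced modulo p. *)
Definition aff (w : int * int) u : K := psl2 (zpow u) (zpowV u * phi w) 0 (zpowV u).

Lemma detA x u : zpow u * zpowV u - x * 0 = 1.
Proof. by case: u; rewrite /=; ring: z4. Qed.

Lemma aff_volt0 w u : (aff w u * volt o0)%g = aff (w.1 + (vec u).1, w.2 + (vec u).2) (turn u).
Proof.
rewrite /aff /volt /= (psl2M (detA _ _) det0) phiD.
have -> : phi (vec u) = zpow u ^+ 2.
  by case: u; rewrite /phi /= ?rmorphN ?rmorph1 ?rmorph0; ring: z4.
case: u => /=; try by congr psl2; ring: z4.
rewrite -[RHS]psl2N; last by ring.
by congr psl2; ring: z4.
Qed.

Lemma aff_volt2 w u : (aff w u * volt o2)%g = aff w (unturn u).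
Proof.
rewrite /aff /volt /= (psl2M (detA _ _) det2).
case: u => /=; try by congr psl2; ring: z4.
rewrite -[RHS]psl2N; last by ring: z4.
by congr psl2; ring: z4.
Qed.

Lemma aff_East w : aff w East = Tm (phi w).
Proof. by rewrite /aff /Tm /= mul1r. Qed.

Lemma aff_shift v w u : aff (v.1 + w.1, v.2 + w.2) u = (aff w East * aff v u)%g.
Proof.
rewrite aff_East /aff /Tm (psl2M (detT _) (detA _ _)) phiD.
by congr psl2; ring.
Qed.

Definition unipotent (x : K) := exists a, x = Tm a.

Lemma upper_conj a b d x : a * d - b * 0 = 1 -> (Tm x ^ psl2 a b 0 d)%g = Tm (d ^+ 2 * x).
Proof.
move=> h; have hV : d * a - - b * - 0 = 1 by rewrite -h; ring.
rewrite conjgE /Tm (psl2V h) mulgA (psl2M hV (detT _)) (psl2M (det2M hV (detT _)) h).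
by congr psl2; try (by ring); transitivity (a * d - b * 0) => //; ring.
Qed.

Lemma unipotent_aff x w u : unipotent x -> unipotent (x ^ aff w u)%g.
Proof. by move=> [a ->]; rewrite /aff (upper_conj _ (detA _ _)); eexists. Qed.

Lemma unipotent_volt2V x : unipotent x -> unipotent (x ^ (volt o2)^-1)%g.
Proof.
have h : z * - z ^+ 3 - 0 * 0 = 1 by ring: z4.
by move=> [a ->]; rewrite /volt /= (psl2V det2) oppr0 (upper_conj _ h); eexists.
Qed.

(** [volt o0 * volt o2] is an upper transvection and [volt o3 * volt o2 ^+ 2] a lower one,
    nontrivial because [i = 1] would give 2 = 0. *)
Lemma gen_volt (N : {group K}) : volt o0 \in N -> volt o2 \in N -> volt o3 \in N ->
  N = [set: K] :> {set K}.
Proof.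
move=> N0 N2 N3; apply: (@gen_PSL p N 1 (1 - z ^+ 2)).
- exact: oner_neq0.
- apply: contra_neq h2 => e0.
  transitivity ((1 - z ^+ 2) * (1 + z ^+ 2)); last by rewrite e0 mul0r.
  by ring: z4.
- suff -> : Tm 1 = (volt o0 * volt o2)%g by rewrite groupM.
  by rewrite /volt /= (psl2M det0 det2); congr psl2; ring: z4.
suff -> : Lm (1 - z ^+ 2) = (volt o3 * (volt o2 * volt o2))%g by rewrite !groupM.
rewrite /volt /= (psl2M det2 det2) (psl2M det3 (det2M det2 det2)) -[LHS]psl2N; last by ring.
by congr psl2; ring: z4.
Qed.

(** The constant [k = 1 / (1 - i)] of the inversion [w |-> k / w], with its denominator
    rationalised. *)
Definition dual_scale : F := (1 + z ^+ 2) / 2%:R.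

Lemma dual_scaleV : dual_scale * (1 - z ^+ 2) = 1.
Proof.
rewrite /dual_scale mulrAC; have -> : (1 + z ^+ 2) * (1 - z ^+ 2) = 2%:R by ring: z4.
exact: mulfV.
Qed.

Lemma det_pdual a b c d : a * d - b * c = 1 -> d * a - c * dual_scale * (b * (1 - z ^+ 2)) = 1.
Proof.
move=> h; transitivity (d * a - c * b * (dual_scale * (1 - z ^+ 2))); first by ring.
by rewrite dual_scaleV mulr1 mulrC [c * b]mulrC.
Qed.

Definition entries_of (x : K) (q : F * F * F * F) :=
  let: (a, b, c, d) := q in (a * d - b * c == 1) && (x == psl2 a b c d).

Lemma entries_ex x : exists q, entries_of x q.
Proof.
by have [a [b [c [d [h ->]]]]] := psl2_ex x; exists (a, b, c, d); rewrite /entries_of h !eqxx.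
Qed.

(* Conjugation by [w |-> k / w], which need not lie in the group. *)
Lemma pdual_sig x : {y : K | forall a b c d, a * d - b * c = 1 -> x = psl2 a b c d ->
  y = psl2 d (c * dual_scale) (b * (1 - z ^+ 2)) a}.
Proof.
have := xchooseP (entries_ex x); case: xchoose => [[[a' b'] c'] d'] /andP[/eqP h' /eqP xE].
exists (psl2 d' (c' * dual_scale) (b' * (1 - z ^+ 2)) a') => a b c d h xE'.
have [e e1 [-> -> -> ->]] := psl2_inj h h' (etrans (esym xE') xE).
have : (e - 1) * (e + 1) = e * e - 1 by ring.
rewrite e1 subrr => /eqP; rewrite mulf_eq0 subr_eq0 addr_eq0 => /orP[]/eqP->.
  by rewrite !mul1r.
rewrite !mulN1r !mulNr; apply/esym/psl2N; exact: det_pdual.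
Qed.

Definition pdual (x : K) : K := sval (pdual_sig x).

Lemma pdual_psl2 a b c d : a * d - b * c = 1 ->
  pdual (psl2 a b c d) = psl2 d (c * dual_scale) (b * (1 - z ^+ 2)) a.
Proof. by move=> h; apply: (svalP (pdual_sig _)) h _. Qed.

Lemma pdualM x y : pdual (x * y)%g = (pdual x * pdual y)%g.
Proof.
have [a [b [c [d [h ->]]]]] := psl2_ex x; have [a' [b' [c' [d' [h' ->]]]]] := psl2_ex y.
rewrite (psl2M h h') (pdual_psl2 (det2M h h')) (pdual_psl2 h) (pdual_psl2 h').
rewrite (psl2M (det_pdual h) (det_pdual h')).
congr psl2; try by ring.
- transitivity (d * d' + c * b' * (dual_scale * (1 - z ^+ 2))); first by rewrite dual_scaleV; ring.
  by ring.
transitivity (a * a' + b * c' * (dual_scale * (1 - z ^+ 2))); first by rewrite dual_scaleV; ring.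
by ring.
Qed.

Lemma pdualK : involutive pdual.
Proof.
move=> x; have [a [b [c [d [h ->]]]]] := psl2_ex x.
rewrite (pdual_psl2 h) (pdual_psl2 (det_pdual h)); congr psl2.
  by rewrite -mulrA [_ * dual_scale]mulrC dual_scaleV mulr1.
by rewrite -mulrA dual_scaleV mulr1.
Qed.

Lemma pdual1 : pdual 1%g = 1%g.
Proof.
by apply: (@mulgI _ (pdual 1%g)); rewrite -pdualM !mulg1.
Qed.

(** The factor [(volt o2)^-1] is a renormalisation: the trivial voltage belongs to the move 1, whose
    dual is the move 2. *)
Lemma pdual_volt (i : 'I_4) : pdual (volt i) = (volt (rev_ord i) * (volt o2)^-1)%g.
Proof.
elim/ord4P: i; rewrite /volt /=.
- rewrite (pdual_psl2 det0) (psl2V det2) (psl2M det3 det2V); congr psl2; ring: z4.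
- by rewrite pdual1 mulgV.
- rewrite (pdual_psl2 det2) (psl2V det2) mul1g; congr psl2; ring: z4.
rewrite (pdual_psl2 det3) (psl2V det2) (psl2M det0 det2V); congr psl2; try by ring: z4.
transitivity (- z ^+ 2 * (dual_scale * (1 - z ^+ 2))); first by ring: z4.
by rewrite dual_scaleV; ring: z4.
Qed.

(** The inversion turns translations, which fix infinity, into maps that fix 0; only the identity is
    of both kinds. *)
Lemma unipotent_pdual x : unipotent x -> unipotent (pdual x) -> x = 1%g.
Proof.
move=> [a ->] [b E]; suff b0 : b = 0.
  by rewrite -[Tm a]pdualK E b0 Tm0 pdual1.
have : pdual (Tm a) = Lm (a * (1 - z ^+ 2)).
  by rewrite /Tm (pdual_psl2 (detT _)) mul0r.
by rewrite E => /Tm_Lm.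
Qed.

(** [volt o0 * volt o2] is the translation by 1, and inverting both voltages in it gives the
    right-hand side, the translation by [i]; conjugation by the rotation [volt o2] takes the first
    to the second. *)
Lemma volt_chir1 : ((volt o2)^-1 * volt o0 * volt o2 * volt o2 = (volt o0)^-1 * (volt o2)^-1)%g.
Proof.
rewrite /volt /= (psl2V det2) (psl2V det0) (psl2M det2V det0) (psl2M (det2M det2V det0) det2).
rewrite (psl2M (det2M (det2M det2V det0) det2) det2) (psl2M det0V det2V).
by congr psl2; ring: z4.
Qed.

Lemma volt_chir2 : (volt o2 * (volt o0)^-1 * (volt o2)^-1 * (volt o2)^-1 = volt o0 * volt o2)%g.
Proof.
rewrite /volt /= (psl2V det2) (psl2V det0) (psl2M det2 det0V) (psl2M (det2M det2 det0V) det2V).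
rewrite (psl2M (det2M (det2M det2 det0V) det2V) det2V) (psl2M det0 det2).
by congr psl2; ring: z4.
Qed.

(** The exponent [n] represents [i] modulo p. The translation by [i] is thus the [n]-th power of
    that by 1, while its own [n]-th power is the translation by [i * i = -1]. *)
Lemma volt_chir3 : exists n : nat,
  ((volt o0)^-1 * (volt o2)^-1 = (volt o0 * volt o2) ^+ n /\
   ((volt o0)^-1 * (volt o2)^-1) ^+ n <> volt o0 * volt o2)%g.
Proof.
have E1 : (volt o0 * volt o2)%g = Tm 1.
  by rewrite /volt /= (psl2M det0 det2); congr psl2; ring: z4.
have E2 : ((volt o0)^-1 * (volt o2)^-1)%g = Tm (z ^+ 2).
  by rewrite /volt /= (psl2V det2) (psl2V det0) (psl2M det0V det2V); congr psl2; ring: z4.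
have [n nE] := Fp_mulrn (z ^+ 2) (oner_neq0 F); exists n.
rewrite E1 E2 !TmX -nE; split=> // /Tm_inj E; move/eqP: h2; apply.
transitivity (1 - z ^+ 2 *+ n); last by rewrite E subrr.
by rewrite -[z ^+ 2 *+ n]mulr_natr -nE; ring: z4.
Qed.

End Voltages.

(** * The voltage cover *)

(** The [k] with [(k, 1)] in [S] form a normal subgroup, because [S] projects onto [gT1]. If it is
    everything, [S] is the full product; if it is trivial, [S] embeds in [H] and maps onto [gT1],
    whose order then divides that of [H]. *)
Lemma goursat_full (gT1 gT2 : finGroupType) (H : {group gT2}) (S : {group gT1 * gT2}) :
  (forall g, g \in S -> g.2 \in H) ->
  (forall k, exists f, (k, f) \in S) -> (forall f, f \in H -> exists k, (k, f) \in S) ->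
  (forall (N : {group gT1}) x, (forall y z, y \in N -> (y ^ z)%g \in N) ->
     x \in N -> x != 1%g -> N = [set: gT1] :> {set gT1}) ->
  ~~ (#|[set: gT1]| %| #|H|) -> forall k f, f \in H -> (k, f) \in S.
Proof.
move=> SH S1 S2 simp ncard.
have eM (a a' : gT1) (b b' : gT2) : ((a, b) * (a', b') = (a * a', b * b'))%g by [].
have eV (a : gT1) (b : gT2) : ((a, b)^-1 = (a^-1, b^-1))%g by [].
have Ngs : group_set [set k | (k, 1%g) \in S].
  apply/group_setP; split=> [|x y]; rewrite !inE; first exact: group1.
  by move=> xS yS; have := groupM xS yS; rewrite eM mulg1.
pose N := Group Ngs.
have NJ (y z : gT1) : y \in N -> (y ^ z)%g \in N.
  rewrite !inE => yS; have [f zS] := S1 z; have := groupJ yS zS.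
  by rewrite conjgE eV !eM mul1g mulVg -conjgE.
case: (pickP (fun x => (x \in N) && (x != 1%g))) => [x /andP[xN x1]|triv].
  have NE := simp N x NJ xN x1; move=> k f fH; have [k' kS] := S2 f fH.
  have : (k * k'^-1)%g \in N by rewrite NE inE.
  rewrite inE => kS'; have := groupM kS' kS.
  by rewrite eM mulgKV mul1g.
case/negP: ncard.
have m1 : {in S &, {morph (@fst gT1 gT2) : x y / (x * y)%g}} by [].
have m2 : {in S &, {morph (@snd gT1 gT2) : x y / (x * y)%g}} by [].
have i2 : ('injm (Morphism m2))%g.
  apply/injmP=> -[k f] [k' f'] kS kS' /= ff'.
  have := groupM kS (groupVr kS'); rewrite eV eM ff' mulgV => h.
  have := triv (k * k'^-1)%g; rewrite inE h /= => /negbFE/eqP e.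
  by rewrite -(mulgKV k' k) e mul1g.
have -> : [set: gT1] = (Morphism m1 @* S)%g.
  apply/esym/setP=> k; rewrite inE morphimEdom; have [f kS] := S1 k.
  by apply/imsetP; exists (k, f).
apply: dvdn_trans (dvdn_morphim _ _) _; rewrite -(card_injm i2 (subxx S)).
apply: cardSg; apply/subsetP=> _ /morphimP[g _ gS ->].
exact: SH.
Qed.

Lemma ord4_ge3 (i j : 'I_4) : 3 <= i -> 3 <= j -> i = j.
Proof. by elim/ord4P: i; elim/ord4P: j. Qed.

(** * The cover, for abstract voltages [cv] and a flag-transitive [M] *)

Section Cover.
Variables (K : finGroupType) (cv : 'I_4 -> K) (aff : int * int -> dir -> K).
Variables (dl : K -> K) (uni : K -> Prop).
Hypotheses
  (cv1 : cv o1 = 1%g)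
  (cv_far : forall i j : 'I_4, i.+1 < j -> (cv i * (cv j)^-1 = cv j * (cv i)^-1)%g)
  (aff0 : forall w u, (aff w u * cv o0)%g = aff (w.1 + (vec u).1, w.2 + (vec u).2)%R (turn u))
  (aff2 : forall w u, (aff w u * cv o2)%g = aff w (unturn u))
  (aff_sh : forall v w u, aff (v.1 + w.1, v.2 + w.2)%R u = (aff w East * aff v u)%g)
  (uni_aff : forall w, uni (aff w East))
  (uni_conj : forall x w u, uni x -> uni (x ^ aff w u)%g)
  (uni_c2V : forall x, uni x -> uni (x ^ (cv o2)^-1)%g)
  (dlM : forall x y, dl (x * y)%g = (dl x * dl y)%g)
  (dlK : involutive dl)
  (dl_cv : forall i, dl (cv i) = (cv (rev_ord i) * (cv o2)^-1)%g)
  (uni_dl : forall x, uni x -> uni (dl x) -> x = 1%g).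

Variables (M : maniplex 4) (par : M -> bool) (dq : M -> M).
Local Notation adjM := (@adj 4 M).
Hypotheses
  (par_adj : forall i x, par (adjM i x) = ~~ par x)
  (dq_adj : forall i x, dq (adjM i x) = adjM (rev_ord i) (dq x))
  (dq_par : forall x, par (dq x) = par x)
  (dq_inj : injective dq)
  (mtrans : forall x y, exists2 f, f \in maut M & f x = y).

Variables (m : int) (mu0 : tflag -> M).
Hypotheses (mu0_chart : chart adjM mu0)
  (mu0_fib : forall t t', mu0 t = mu0 t' <-> exists2 w, lattice m 0%R w & t' = shift w t).

Definition sgn (e : bool) (x : K) : K := if e then (x^-1)%g else x.

Definition vadj (i : 'I_4) (v : K * M) : K * M := ((v.1 * sgn (par v.2) (cv i))%g, adjM i v.2).

Lemma vadjK i : involutive (vadj i).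
Proof.
move=> [x y]; rewrite /vadj /= par_adj adjK; congr pair.
by case: (par y); rewrite /= ?mulgK ?mulgKV.
Qed.

Lemma vadj_neq i v : vadj i v <> v.
Proof. by move=> /(congr1 snd)/adj_neq. Qed.

Lemma vadjC (i j : 'I_4) v : i.+1 < j -> vadj i (vadj j v) = vadj j (vadj i v).
Proof.
move=> ij; rewrite /vadj /= !par_adj (adjC _ ij); congr pair.
have far := cv_far ij; case: (par _) => /=; last first.
  by rewrite -!mulgA far.
rewrite -!mulgA; congr mulg.
have := congr1 (fun x => (cv j)^-1 * x^-1 * cv j)%g far.
rewrite !invMg !invgK !mulgA mulVg mul1g mulgKV => ->.
by [].
Qed.

Lemma link_snd (I : {set 'I_4}) u v : link vadj I u v -> link adjM I u.2 v.2.
Proof. by apply: (link_hom (g := id) (f := snd)). Qed.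

Lemma link_lift (I : {set 'I_4}) u y : link adjM I u.2 y -> exists x, link vadj I u (x, y).
Proof.
apply: (@link_ind _ _ adjM I u.2 (fun y => exists x, link vadj I u (x, y))).
  by exists u.1; rewrite -surjective_pairing; apply: link_refl.
move=> i z iI _ [x l]; exists (vadj i (x, z)).1.
by apply: link_trans l _; apply: (@link1 _ _ vadj I i (x, z) iI).
Qed.

Lemma odd_tadj i t : (tadj i t).2 = ~~ t.2.
Proof. by case: t => [[z u] []]; case: i => [|[|i]]. Qed.

(** Some automorphism [f] brings the chart of [M] to the given flag. The starting bit is [par y], so
    that the bit of [t] is always the parity of [f (mu0 t)]; inverse voltages then occur exactly
    where [tadj] undoes the steps of [aff0] and [aff2]. *)
Lemma cover_chart v : exists (l : K) (f : {perm M}) t0,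
  let nu t := ((l * aff t.1.1 t.1.2)%g, f (mu0 t)) in
  [/\ chart vadj nu, nu t0 = v & f \in maut M].
Proof.
case: v => x y; pose t0 : tflag := (0%R, 0%R, East, par y).
have [f fM fE] := mtrans (mu0 t0) y; have /mautP fadj := fM.
have parE t : par (f (mu0 t)) = t.2.
  apply: (@tflag_ind (fun t => par (f (mu0 t)) = t.2) t0) => [|i s i3 E]; first by rewrite fE.
  have i4 : i < 4 by apply: leq_trans i3 _.
  have /= -> := mu0_chart (i := Ordinal i4) s i3.
  by rewrite fadj par_adj E odd_tadj.
exists (x * (aff (0, 0)%R East)^-1)%g, f, t0 => nu; split=> //; last first.
  by rewrite /nu /= mulgKV fE.
move=> i t i3; rewrite /nu /vadj /= parE mu0_chart // fadj; congr pair.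
rewrite -!mulgA; congr (_ * (_ * _))%g.
elim/ord4P: i i3 => // _; case: t => [[w u] []] /=.
- apply/esym/(canLR (mulgK _)); rewrite aff0.
  by case: u; case: w => a b /=; congr (aff (_, _) _); lia.
- by rewrite aff0.
- by rewrite cv1 invg1 mulg1.
- by rewrite cv1 mulg1.
- by apply/esym/(canLR (mulgK _)); rewrite aff2; case: u.
by rewrite aff2.
Qed.

Lemma shift0 w i t : tcell i (shift w t) = tcell i t -> shift w t = t.
Proof.
case: t w => [[[a b] u] e] [x y]; rewrite tcell_shift; case: (tcell _ _) => c d [/= h1 h2].
by congr (_, _, _, _); lia.
Qed.

(** A walk closed in [M] lifts to the plane, where its ends differ by a lattice vector [w], and its
    voltage is conjugate to the translation by [w]. If a move [j < 3] is missing, the cell of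
    dimension [j] is kept, so the translation is trivial. *)
Lemma link_low (I : {set 'I_4}) x y z : (forall i, i \in I -> i < 3) ->
  link vadj I (x, z) (y, z) ->
  uni (x^-1 * y)%g /\ forall j : 'I_4, j < 3 -> j \notin I -> x = y.
Proof.
move=> I3; have [l [f [t0 [nuC nu0 fM]]]] := cover_chart (x, z).
rewrite -{1}nu0 => lk.
pose Q s := forall j : 'I_4, j < 3 -> j \notin I -> tcell j s = tcell j t0.
have QR i s : i \in I -> Q s -> Q (tadj i s).
  move=> iI Qs j j3 jI; rewrite tcell_adj ?(I3 i iI) ?Qs //.
  by apply: contraNneq jI => ij; rewrite (_ : j = i) //; apply: val_inj.
have [s Qs [sE1 sE2]] := chart_lift (Q := Q) nuC I3 (fun _ _ _ => erefl) QR lk.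
case: nu0 => xE zE.
have /mu0_fib[w wL sw] : mu0 t0 = mu0 s by apply: (@perm_inj _ f); rewrite sE2.
have aE : aff s.1.1 s.1.2 = (aff w East * aff t0.1.1 t0.1.2)%g.
  by rewrite sw; case: (t0) => [[v u] e] /=; rewrite aff_sh.
split=> [|j j3 jI].
  rewrite -xE -sE1 aE invMg !mulgA mulgKV -mulgA -conjgE; exact/uni_conj/uni_aff.
have st : s = t0 by rewrite sw; apply: (@shift0 w j); rewrite -sw Qs.
by rewrite -xE -sE1 st.
Qed.

(** The factor [cv o2] on odd flags offsets the factor [(cv o2)^-1] of [dl_cv]. *)
Definition vdual (v : K * M) : K * M :=
  ((dl v.1 * (if par v.2 then cv o2 else 1))%g, dq v.2).

Lemma vdual_adj i v : vdual (vadj i v) = vadj (rev_ord i) (vdual v).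
Proof.
case: v => x y; rewrite /vdual /vadj /= par_adj dq_par dq_adj; congr pair.
rewrite dlM; have dl1 : dl 1 = 1%g by apply: (@mulgI _ (dl 1)); rewrite -dlM !mulg1.
case: (par y) => /=; last by rewrite dl_cv mulg1 mulgA mulgKV.
have -> : dl (cv i)^-1 = (dl (cv i))^-1%g.
  by apply/eqP; rewrite eq_sym eq_invg_mul -dlM mulgV dl1.
by rewrite dl_cv invMg invgK mulg1 mulgA.
Qed.

Lemma vdual_par v : par (vdual v).2 = par v.2.
Proof. exact: dq_par. Qed.

(** The dual of [link_low]: under [vdual] a walk avoiding the move 0 becomes one avoiding the move
    3. The factor [k] only conjugates the voltage, and [uni_c2V] removes it. *)
Lemma link_high (I : {set 'I_4}) x y z : (forall i, i \in I -> 0 < i) ->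
  link vadj I (x, z) (y, z) ->
  uni (dl (x^-1 * y))%g /\ forall j : 'I_4, 0 < j -> j \notin I -> x = y.
Proof.
move=> I0 lk; pose J := [set rev_ord i | i in I].
have lJ : link vadj J (vdual (x, z)) (vdual (y, z)).
  apply: (link_hom (g := @rev_ord 4)) lk => [i iI|i v _]; last exact: vdual_adj.
  exact: imset_f.
have J3 i : i \in J -> i < 3.
  by case/imsetP=> j /I0 j0 ->; rewrite /=; have := ltn_ord j; lia.
have [h1 h2] := link_low J3 lJ; move: h1 h2; rewrite /=.
set k := (if par z then _ else _) => h1 h2.
have dl1 : dl 1 = 1%g by apply: (@mulgI _ (dl 1)); rewrite -dlM !mulg1.
have dlV u : dl u^-1 = (dl u)^-1%g.
  by apply/eqP; rewrite eq_sym eq_invg_mul -dlM mulgV dl1.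
split=> [|j j0 jI].
  have : uni (dl (x^-1 * y) ^ k)%g.
    by rewrite dlM dlV conjgE; move: h1; rewrite invMg !mulgA.
  rewrite /k; case: (par z); last by rewrite conjg1.
  by move/uni_c2V; rewrite -conjgM mulgV conjg1.
have /mulIg/(can_inj dlK) // : (dl x * k = dl y * k)%g.
apply: (h2 (rev_ord j)); first by rewrite /=; have := ltn_ord j; lia.
by rewrite (mem_imset _ _ (@rev_ord_inj _)).
Qed.

(** If neither move 3 nor move 0 is missing, a middle move [a] is. The walk then splits into moves
    below [a] and moves above it, and [linkI] in [M] shows that both parts are closed there. *)
Lemma link_triv (I : {set 'I_4}) (j1 j2 : 'I_4) x y z : j1 < 3 -> 0 < j2 ->
  j1 \notin I -> j2 \notin I -> link vadj I (x, z) (y, z) -> x = y.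
Proof.
move=> j13 j20 j1I j2I lk.
have [o3I|o3I] := boolP (o3 \in I); last first.
  have I3 i : i \in I -> i < 3.
    elim/ord4P: i => // h; by rewrite h in o3I.
  by have [_ h] := link_low I3 lk; apply: (h j1).
have [o0I|o0I] := boolP (o0 \in I); last first.
  have I0 i : i \in I -> 0 < i by elim/ord4P: i => // h; rewrite h in o0I.
  by have [_ h] := link_high I0 lk; apply: (h j2).
have [a aI /andP[a0 a3]] : exists2 a : 'I_4, a \notin I & 0 < a < 3.
  exists j1; rewrite // j13 andbT lt0n; apply: contraNneq j1I => e.
  by rewrite (_ : j1 = o0) //; apply: val_inj.
pose A := [set i in I | i < a]; pose B := [set i in I | a < i].
have IE : I = A :|: B.
  apply/setP=> i; rewrite !inE -andb_orr -neq_ltn; case: (boolP (i \in I)) => //= iI.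
  by apply/esym; apply: contraNneq aI => /val_inj <-.
rewrite IE in lk; have [|[x' z'] l1 l2] := link_split _ lk.
  move=> i j v; rewrite !inE => /andP[_ ia] /andP[_ aj]; apply: vadjC.
  exact: leq_ltn_trans ia aj.
have zz : z = z'.
  have k1 := link_snd l1; have k2 := link_snd l2; rewrite /= in k1 k2.
  rewrite (link_sym (@adjK _ M)) in k2; have := linkI k1 k2.
  rewrite (_ : A :&: B = set0); first by move/link0.
  apply/setP=> i; rewrite !inE; apply/negP=> /andP[/andP[_ h1] /andP[_ h2]].
  by have := ltn_trans h1 h2; rewrite ltnn.
rewrite -zz in l1 l2.
have [i|_ /(_ a a3) h1] := link_low _ l1; first by rewrite inE => /andP[_ /ltn_trans]; apply.
have [i|_ /(_ a a0) h2] := link_high _ l2; first by rewrite inE => /andP[_]; apply: leq_ltn_trans.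
by rewrite h1 ?h2 // !inE ltnn andbF.
Qed.

(** Lifting a walk of [M] with moves in [I :&: J] reduces the claim to two walks closed in [M] with
    equal voltage. By [link_triv] this voltage is trivial unless one set consists of the moves of a
    facet and the other of those of a vertex-figure; there [uni_dl] concludes. *)
Lemma vadj_linkI (I J : {set 'I_4}) u v :
  link vadj I u v -> link vadj J u v -> link vadj (I :&: J) u v.
Proof.
case: u v => [x z] [y w] lI lJ.
have [/setIidPl->//|/subsetPn[a aI aJ]] := boolP (I \subset J).
have [/setIidPr->//|/subsetPn[b bJ bI]] := boolP (J \subset I).
have lM := linkI (link_snd lI) (link_snd lJ).
have [x' l] := link_lift lM; rewrite /= in l; have l' := l; rewrite (link_sym vadjK) in l'.
have lI' := link_trans (link_sub (subsetIl I J) l') lI.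
have lJ' := link_trans (link_sub (subsetIr I J) l') lJ.
suff <- : x' = y by [].
have tr (L : {set 'I_4}) c : c \notin L -> link vadj L (x', w) (y, w) -> x' = y \/
    (forall i, (i \in L) = (i < 3)) \/ (forall i, (i \in L) = (0 < i)).
  move=> cL lL.
  have [/existsP[j1 /andP[j13 j1L]]|/existsPn n1] :=
      boolP [exists j1 : 'I_4, (j1 < 3) && (j1 \notin L)].
    have [/existsP[j2 /andP[j20 j2L]]|/existsPn n2] :=
        boolP [exists j2 : 'I_4, (0 < j2) && (j2 \notin L)].
      by left; apply: (link_triv j13 j20 j1L j2L lL).
    right; right=> i; apply/idP/idP => [iL|i0].
      rewrite lt0n; apply: contraNneq j1L => i0.
      have := n2 j1; rewrite lt0n; case: (eqVneq (j1 : nat) 0) => [j10 _|_]; last by rewrite negbK.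
      by rewrite (_ : j1 = i) //; apply: val_inj; rewrite /= i0.
    by have := n2 i; rewrite i0 negbK.
  right; left=> i; apply/idP/idP => [iL|i3]; last by have := n1 i; rewrite i3 negbK.
  have := n1 c; rewrite cL andbT -leqNgt => c3; rewrite ltnNge; apply: contra cL => i3.
  by rewrite (ord4_ge3 c3 i3).
have [//|hI] := tr I b bI lI'; have [//|hJ] := tr J a aJ lJ'.
have low (L : {set 'I_4}) : (forall i, (i \in L) = (i < 3)) ->
    link vadj L (x', w) (y, w) -> uni (x'^-1 * y)%g.
  by move=> hL lL; have [i|] := link_low _ lL; first by rewrite hL.
have high (L : {set 'I_4}) : (forall i, (i \in L) = (0 < i)) ->
    link vadj L (x', w) (y, w) -> uni (dl (x'^-1 * y))%g.
  by move=> hL lL; have [i|] := link_high _ lL; first by rewrite hL.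
have fin : uni (x'^-1 * y)%g -> uni (dl (x'^-1 * y))%g -> x' = y.
  by move=> h1 h2; apply/eqP; rewrite eq_mulVg1 (uni_dl h1 h2).
case: hI hJ => hI [] hJ.
- by rewrite hI -hJ (negPf aJ) in aI.
- exact: fin (low _ hI lI') (high _ hJ lJ').
- exact: fin (low _ hJ lJ') (high _ hI lI').
by rewrite hI -hJ (negPf aJ) in aI.
Qed.

Definition epar_set := [set f in maut M | [forall x, par (f x) == par x]].

Lemma eparP f : reflect (f \in maut M /\ forall x, par (f x) = par x) (f \in epar_set).
Proof.
apply: (iffP setIdP) => -[fM h]; split=> //.
  by move=> x; apply/eqP/(forallP h).
by apply/forallP=> x; apply/eqP.
Qed.

Lemma epar_group_set : group_set epar_set.
Proof.
apply/group_setP; split=> [|f g /eparP[fM fp] /eparP[gM gp]]; apply/eparP.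
  by split=> [|x]; rewrite ?group1 ?perm1.
by split=> [|x]; rewrite ?groupM // permM gp fp.
Qed.

Canonical epar := Group epar_group_set.

Lemma maut_epar f x : f \in maut M -> par (f x) = par x -> f \in epar.
Proof.
move=> fM fx; apply/eparP; split=> // y; have /mautP fa := fM.
apply: (link_ind (P := fun y => par (f y) = par y)) (link_all x y) => // i z _ _ E.
by rewrite fa !par_adj E.
Qed.

Lemma epar_trans x y : par x = par y -> exists2 f, f \in epar & f x = y.
Proof.
have [f fM fE] := mtrans x y => xy; exists f => //.
by apply: (maut_epar (x := x)) => //; rewrite fE.
Qed.

(** Left multiplication commutes with the right multiplications of [vadj]; the inverse adapts it to
    the order of products of permutations. *)
Definition gact (g : K * {perm M}) (v : K * M) : K * M := ((g.1^-1 * v.1)%g, g.2 v.2).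

Lemma gact_vadj g i v : g.2 \in epar -> gact g (vadj i v) = vadj i (gact g v).
Proof.
case/eparP=> /mautP ga gp; rewrite /gact /vadj /= ga gp; congr pair.
by rewrite mulgA.
Qed.

Lemma gactM g h v : gact (g * h)%g v = gact h (gact g v).
Proof. by rewrite /gact /= invMg mulgA permM. Qed.

Lemma gact_inj g : injective (gact g).
Proof. by move=> [x y] [x' y'] [/mulgI-> /perm_inj->]. Qed.

Definition gperm g : {perm K * M} := perm (@gact_inj g).

Lemma gpermE g v : gperm g v = gact g v. Proof. exact: permE. Qed.

Hypotheses
  (cv_gen : forall N : {group K}, cv o0 \in N -> cv o2 \in N -> cv o3 \in N ->
    N = [set: K] :> {set K})
  (K_simple : forall (N : {group K}) x, (forall y z, y \in N -> (y ^ z)%g \in N) ->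
     x \in N -> x != 1%g -> N = [set: K] :> {set K})
  (K_center : forall x : K, (forall y, commute x y) -> x = 1%g)
  (K_card : ~~ (#|[set: K]| %| #|epar|)).

Definition even_base : M := if par (base_flag M) then adjM o1 (base_flag M) else base_flag M.

Lemma par_base : par even_base = false.
Proof. by rewrite /even_base; case: ifP => // h; rewrite par_adj h. Qed.

Definition vbase : K * M := (1%g, even_base).

(** The pairs moving the base flag within its component form a group, to which [goursat_full]
    applies. It projects onto [epar] because [M] is connected, and onto [K] because a move [i]
    followed by the voltage-free move 1 ends on an even flag with voltage [cv i]. *)
Lemma vadj_link_all u v : link vadj setT u v.
Proof.
suff H w : link vadj setT vbase w.
  by apply: link_trans (H v); rewrite (link_sym vadjK).
pose S0 := [set g : K * {perm M} | (g.2 \in epar) && link vadj setT vbase (gact g vbase)].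
have SP g : reflect (g.2 \in epar /\ link vadj setT vbase (gact g vbase)) (g \in S0).
  by rewrite [g \in S0]in_set; apply: andP.
have Sgs : group_set S0.
  apply/group_setP; split=> [|g h /SP[gH lg] /SP[hH lh]]; apply/SP.
    by split; rewrite ?group1 // /gact /= invg1 mul1g perm1; apply: link_refl.
  split; first exact: groupM.
  rewrite gactM; apply: link_trans lh _.
  by apply: (link_hom (g := id)) lg => // i z _; apply: gact_vadj.
pose S := Group Sgs.
have even_in x y : link vadj setT vbase (x, y) -> par y = false ->
    exists2 f, (x^-1%g, f) \in S & f even_base = y.
  move=> l py; have [f fH fE] := @epar_trans even_base y (etrans par_base (esym py)).
  by exists f => //; apply/SP; split; rewrite // /gact /= invgK mulg1 fE.
have SH g : g \in S -> g.2 \in epar by case/SP.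
have S2 f : f \in epar -> exists k, (k, f) \in S.
  move=> fH; have [x l] := @link_lift setT vbase (f even_base) (link_all _ _).
  by exists (x^-1%g); apply/SP; split; rewrite // /gact /= invgK mulg1.
have S1 k : exists f, (k, f) \in S.
  have m1 : {in S &, {morph (@fst K {perm M}) : x y / (x * y)%g}} by [].
  have memP x f : (x, f) \in S -> x \in (Morphism m1 @* S)%g.
    by move=> xS; rewrite morphimEdom; apply/imsetP; exists (x, f).
  have gen i : cv i \in (Morphism m1 @* S)%g.
    have [||f fS _] := @even_in (cv i) (adjM o1 (adjM i even_base)); last first.
    - by rewrite -groupV; apply: memP fS.
    - by rewrite !par_adj par_base.
    have -> : (cv i, adjM o1 (adjM i even_base)) = vadj o1 (vadj i vbase).
      by rewrite /vadj /= par_adj par_base /= mul1g cv1 invg1 mulg1.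
    by apply: (link_trans (y := vadj i vbase)); apply: link1; rewrite inE.
  have : k \in (Morphism m1 @* S)%g by rewrite (cv_gen (gen o0) (gen o2) (gen o3)) inE.
  by rewrite morphimEdom => /imsetP[[x f] xS ->]; exists f.
have SA := goursat_full SH S1 S2 K_simple K_card.
have ev x y : par y = false -> link vadj setT vbase (x, y).
  move=> py; have [f fH fE] := @epar_trans even_base y (etrans par_base (esym py)).
  by have /SP[_] := SA x^-1%g f fH; rewrite /gact /= invgK mulg1 fE.
case: w => x y; case: (boolP (par y)) => [py|/negPf]; last exact: ev.
rewrite -(vadjK o1 (x, y)).
apply: (link_trans (y := vadj o1 (x, y))); last by apply: link1; rewrite inE.
by apply: ev; rewrite par_adj py.
Qed.

Definition cover : maniplex 4 :=
  @Maniplex 4 _ vadj vbase vadjK vadj_neq vadjC vadj_link_all vadj_linkI.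

Lemma gpermM g h : (gperm g * gperm h)%g = gperm (g * h)%g.
Proof. by apply/permP=> v; rewrite permM !gpermE gactM. Qed.

Lemma gperm_maut g : g.2 \in epar -> gperm g \in maut cover.
Proof. by move=> gH; apply/mautP=> i v; rewrite !gpermE gact_vadj. Qed.

Lemma gperm_trans u v : par u.2 = par v.2 -> exists2 g, g.2 \in epar & gperm g u = v.
Proof.
move=> uv; have [f fH fE] := epar_trans uv; exists ((u.1 * v.1^-1)%g, f) => //.
by rewrite gpermE /gact /= fE invMg invgK mulgKV -surjective_pairing.
Qed.

Lemma maut_even f u : f \in maut cover -> par (f u).2 = par u.2 ->
  exists2 g, g.2 \in epar & f = gperm g.
Proof.
move=> fM /esym/gperm_trans[g gH gE]; exists g => //.
by apply: (maut_eq (x := u : cover)) => //; apply: gperm_maut.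
Qed.

(** Parity flips at each move, so an automorphism changes either every parity or none. *)
Lemma maut_par_eq f u v : f \in maut cover -> par u.2 = par v.2 -> par (f u).2 = par (f v).2.
Proof.
move=> /mautP fa; suff H w : par (f w).2 (+) par w.2 = par (f u).2 (+) par u.2.
  by move=> uv; have := H v; rewrite uv => /addIb.
pose Q w := par (f w).2 (+) par w.2 = par (f u).2 (+) par u.2.
apply: (link_ind (P := Q)) (vadj_link_all u w) => //.
rewrite /Q => i z _ _ <-; have -> : f (vadj i z) = vadj i (f z) := fa i z.
by rewrite /vadj /= !par_adj addNb addbN negbK.
Qed.

Lemma conj_even f h : f \in maut cover -> h.2 \in epar ->
  exists2 g, g.2 \in epar & (gperm h ^ f)%g = gperm g.
Proof.
move=> fM hH; apply: (@maut_even _ (f vbase)).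
  by rewrite groupJ // gperm_maut.
rewrite permJ; apply: maut_par_eq => //; rewrite gpermE /=.
by have /eparP[_ ->] := hH.
Qed.

Hypotheses
  (chir1 : ((cv o2)^-1 * cv o0 * cv o2 * cv o2 = (cv o0)^-1 * (cv o2)^-1)%g)
  (chir2 : (cv o2 * (cv o0)^-1 * (cv o2)^-1 * (cv o2)^-1 = cv o0 * cv o2)%g)
  (chir3 : exists n : nat, ((cv o0)^-1 * (cv o2)^-1 = (cv o0 * cv o2) ^+ n /\
     ((cv o0)^-1 * (cv o2)^-1) ^+ n <> cv o0 * cv o2)%g).

(* An odd automorphism would induce on [K] a map inverting every voltage; the
   translations by [1] and [i] would be exchanged, although the latter is a
   power of the former with exponent a square root of -1. *)
Lemma no_odd_voltage (beta : K -> K) : beta 1%g = 1%g ->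
  (forall x i, beta (x * cv i)%g = (beta x * (cv i)^-1)%g) -> False.
Proof.
move=> b1 bc.
have bV x i : beta (x * (cv i)^-1)%g = (beta x * cv i)%g.
  by rewrite -{2}(mulgKV (cv i) x) bc mulgKV.
have [n [h1 h2]] := chir3.
have bX k : beta ((cv o0 * cv o2) ^+ k)%g = (((cv o0)^-1 * (cv o2)^-1) ^+ k)%g.
  by elim: k => [|k IH] //; rewrite !expgSr mulgA !bc IH mulgA.
apply: h2; rewrite -bX -h1 -chir1 !bc -[(cv o2)^-1%g]mul1g bV b1 !mul1g.
exact: chir2.
Qed.

(** An odd automorphism, corrected by an even one, becomes [f'], sending the base flag to its
    1-adjacent flag. Because [K] has trivial centre, the new voltage coordinate depends on the old
    one alone, and the induced map contradicts [no_odd_voltage]. *)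
Lemma maut_cover_par f u : f \in maut cover -> par (f u).2 = par u.2.
Proof.
move=> f0M; suff: par (f vbase).2 = par vbase.2.
  by move/(maut_even f0M)=> [g /eparP[_ gp] ->]; rewrite gpermE /= gp.
apply/eqP; apply: contraT => odd_f; exfalso.
have [g gH gE] : exists2 g, g.2 \in epar & gperm g (f vbase) = vadj o1 vbase.
  by apply: gperm_trans; rewrite /vadj /= par_adj; move: odd_f => /=; case: (par _); case: (par _).
pose f' := (f * gperm g)%g; have fM : f' \in maut cover by rewrite groupM // gperm_maut.
have f'E : f' vbase = vadj o1 vbase by rewrite permM gE.
have /mautP fa := fM.
have faE i v : f' (vadj i v) = vadj i (f' v) := fa i v.
(* Flag-transitivity of [M] gives an automorphism with the same effect as [f'] on second
   coordinates. *)
have [tau tM tE] := mtrans even_base (adjM o1 even_base); have /mautP ta := tM.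
have f2 v : (f' v).2 = tau v.2.
  apply: (link_ind (P := fun v => (f' v).2 = tau v.2)) (vadj_link_all vbase v).
    by rewrite f'E /= tE.
  by move=> i w _ _ E; rewrite faE /= ta E.
(* Conjugates of elements [(l, 1)] act trivially on [M], hence have the same form. *)
have conjK F (t : {perm M}) l : F \in maut cover -> (forall v, (F v).2 = t v.2) ->
    exists l', (gperm (l, 1%g) ^ F)%g = gperm (l', 1%g).
  move=> FM Ft; have [[l' h] hH E] := conj_even FM (group1 epar : (l, 1%g).2 \in epar).
  exists l'; rewrite E; congr (gperm (_, _)); apply/permP=> y; rewrite perm1.
  pose w := (F^-1)%g (1%g, y).
  have := congr1 (fun s : {perm K * M} => (s (F w)).2) E.
  by rewrite permJ !gpermE Ft /= perm1 -Ft /w permKV.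
have fV2 v : (f'^-1%g v).2 = (tau^-1%g) v.2.
  by apply: (@perm_inj _ tau); rewrite -f2 !permKV.
(* The conjugate [(k, h')] of [(1, h)] commutes with the conjugates of the elements [(l', 1)], which
   exhaust all [(l, 1)]; so [k] is central. *)
have key h v : h \in epar -> (f' (v.1, h v.2)).1 = (f' v).1.
  move=> hH; have [[k h'] h'H E] := conj_even fM (hH : (1%g, h).2 \in epar).
  suff k1 : k = 1%g.
    have := congr1 (fun s : {perm K * M} => (s (f' v)).1) E.
    by rewrite permJ !gpermE /gact /= k1 invg1 !mul1g.
  apply: K_center => l; have [l' lE] := conjK _ _ l (groupVr fM) fV2.
  have {}lE : (gperm (l', 1) ^ f' = gperm (l, 1))%g by rewrite -lE -conjgM mulVg conjg1.
  have : ((gperm (l', 1) * gperm (1, h)) ^ f' = (gperm (1, h) * gperm (l', 1)) ^ f')%g.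
    by congr (_ ^ _)%g; rewrite !gpermM; congr gperm; congr pair; rewrite /= ?mulg1 ?mul1g.
  rewrite !conjMg lE E !gpermM => /(congr1 (fun s : {perm K * M} => (s vbase).1)).
  by rewrite !gpermE /gact /= !mulg1 => /invg_inj.
have flip x : par (f' (x, even_base)).2 = true.
  by rewrite f2 /= tE par_adj par_base.
(* Odd flags are reached from even ones through the move 1, which carries no voltage. *)
have b2 x y : (f' (x, y)).1 = (f' (x, even_base)).1.
  case: (boolP (par y)) => [py|/negPf py]; last first.
    have [h hH <-] := @epar_trans even_base y (etrans par_base (esym py)).
    exact: (key h (x, even_base)).
  have py1 : par (adjM o1 even_base) = par y by rewrite par_adj par_base py.
  have [h hH <-] := epar_trans py1.
  rewrite (key h (x, adjM o1 even_base) hH).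
  have := faE o1 (x, even_base); rewrite {1}/vadj /= par_base /= cv1 mulg1 => ->.
  by rewrite /vadj /= flip /= cv1 invg1 mulg1.
apply: (@no_odd_voltage (fun x => (f' (x, even_base)).1)) => [|x i].
  by rewrite f'E /vadj /= par_base /= cv1 mulg1.
have := faE i (x, even_base); rewrite {1}/vadj /= par_base /= => /(congr1 fst).
by rewrite b2 /vadj /= flip.
Qed.

Definition vpar (v : cover) := par v.2.

Lemma vpar_adj i (v : cover) : vpar (adj i v) = ~~ vpar v.
Proof. exact: par_adj. Qed.

Lemma vpar_orbit (u v : cover) : (exists2 f, f \in maut cover & f u = v) <-> vpar u = vpar v.
Proof.
split=> [[f fM <-]|/gperm_trans[g gH gE]]; first by rewrite /vpar maut_cover_par.
by exists (gperm g) => //; apply: gperm_maut.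
Qed.

Lemma vdual_inj : injective vdual.
Proof.
move=> [x y] [x' y'] [/= + /dq_inj yy]; rewrite yy => /mulIg/(can_inj dlK) ->.
by [].
Qed.

Lemma isog_cover : Gamma (face cover) \isog setX [set: K] epar.
Proof.
apply: isog_trans (Gamma_isog_maut _) _; rewrite isog_sym.
have mg : {in setX [set: K] epar &, {morph gperm : g h / (g * h)%g}}.
  by move=> g h _ _; rewrite gpermM.
apply/isogP; exists (Morphism mg).
  apply/injmP=> -[k f] [k' f'] _ _ /= E; congr pair.
    have := congr1 (fun s : {perm K * M} => (s vbase).1) E.
    by rewrite !gpermE /gact /= !mulg1 => /invg_inj.
  apply/permP=> y; have := congr1 (fun s : {perm K * M} => (s (1%g, y)).2) E.
  by rewrite !gpermE.
rewrite morphimEdom; apply/setP=> f; apply/imsetP/idP => [[[k h] /setXP[_ hH] ->]|fM].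
  exact: gperm_maut.
have [[k h] hH ->] := maut_even fM (maut_cover_par vbase fM).
by exists (k, h) => //; apply/setXP; split; rewrite ?in_setT.
Qed.

Variables b' c' b2 c2 : int.
Hypotheses
  (lat1 : forall w, lattice b' c' w <-> lattice m 0%R w /\ aff w East = 1%g)
  (lat2 : forall x y, lattice b2 c2 (x, y) <-> lattice b' c' (y, x)).

Lemma cover_facet (v : cover) :
  isomorphic_to (section \bot%O (mkface (inord 4) v)) (toroid b' c').
Proof.
have [l [f [t0 [nuC nu0 fM]]]] := cover_chart v.
set nu := (X in chart _ X) in nuC.
have fib t t' : (nu t : cover) = nu t' <-> exists2 w, lattice b' c' w & t' = shift w t.
  split=> [[E1 /perm_inj/mu0_fib[w wL tE]]|[w /lat1[wL w1] ->]].
    exists w => //; apply/lat1; split=> //; move: E1; rewrite tE.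
    case: (t) => [[z u] e] /=; rewrite aff_sh => /mulgI E.
    by apply: (mulIg (aff z u)); rewrite mul1g -E.
  rewrite /nu; congr pair; first by case: (t) => [[z u] e] /=; rewrite aff_sh w1 mul1g.
  by congr (f _); apply/mu0_fib; exists w.
have := chart_toroid (M := cover) nuC fib.
by rewrite -(facetE (M := cover) nuC t0) /nu nu0.
Qed.

Lemma cover_polytope : exists (d : Order.disp_t) (P : finTBPOrderType d),
  [/\ polytope P 4, chiral P, properly_self_dual P,
      Gamma P \isog setX [set: K] epar
    & has_type P 4 (toroid b' c') (toroid b2 c2)].
Proof.
exists _, (face cover).
pose dual := perm vdual_inj : {perm cover}.
have dualE i (v : cover) : dual (adj i v) = adj (rev_ord i) (dual v).
  by rewrite !permE; apply: vdual_adj.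
split.
- exact: face_polytope.
- exact: face_chiral vpar_adj vpar_orbit isT.
- apply: (face_properly_self_dual vpar_orbit dualE) => v.
  by rewrite permE; apply: vdual_par.
- exact: isog_cover.
split=> X; rewrite rank_face => lX; have [v XE] := faceP X.
  have -> : X = mkface (inord 4) v.
    by rewrite XE; congr mkface; apply: val_inj; rewrite /= inordK //; lia.
  exact: cover_facet.
have [s sd sE] := face_dual dualE.
apply: (vertex_figure_dual lat2 sd); rewrite XE sE.
have -> : rev_ord (level X) = inord 4.
  by apply: val_inj; rewrite /= inordK //; lia.
exact: cover_facet.
Qed.

End Cover.

Lemma isog_setX (gT1 gT2 rT1 rT2 : finGroupType) (G1 : {group gT1}) (G2 : {group gT2})
    (H1 : {group rT1}) (H2 : {group rT2}) :
  G1 \isog H1 -> G2 \isog H2 -> setX G1 G2 \isog setX H1 H2.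
Proof.
case/isogP=> f1 i1 E1 /isogP[f2 i2 E2].
pose f (g : gT1 * gT2) := (f1 g.1, f2 g.2).
have fM : {in setX G1 G2 &, {morph f : g h / (g * h)%g}}.
  by move=> [a b] [a' b'] /setXP[aG bG] /setXP[aG' bG']; rewrite /f /= !morphM.
apply/isogP; exists (Morphism fM).
  apply/injmP=> -[a b] [a' b'] /setXP[aG bG] /setXP[aG' bG'] [/(injmP i1) -> // /(injmP i2) -> //].
rewrite morphimEdom; apply/setP=> -[a b]; apply/imsetP/setXP.
  case=> -[x y] /setXP[xG yG] [-> ->].
  by rewrite -E1 -E2 !morphimEdom; split; apply: imset_f.
rewrite -{1}E1 -{1}E2 !morphimEdom => -[/imsetP[x xG ->] /imsetP[y yG ->]].
by exists (x, y) => //; apply/setXP.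
Qed.

(** The unit group is cyclic of order divisible by 8. As [i] has fourth power 1, writing it as
    [g ^+ j] gives [8 %| j * 4], so [j] is even. *)
Lemma Fp_sqrt (p : nat) (i : 'F_p) : prime p -> p = 1 %[mod 8] -> (i ^+ 2 = -1)%R ->
  exists z : 'F_p, (z ^+ 2 = i)%R.
Proof.
move=> p_pr p8 i2.
have iU : (i \is a GRing.unit)%R.
  by rewrite -(unitrX_pos _ (isT : 0 < 2)) i2 unitrN1.
pose u : {unit 'F_p} := FinRing.unit _ iU.
have /cyclicP[g gE] := field_unit_group_cyclic [set: {unit 'F_p}]%G.
have /cycleP[j uE] : u \in <[g]>%g by rewrite -gE inE.
have og : #[g]%g = p.-1.
  by rewrite orderE -gE card_finField_unit card_Fp.
have u4 : (u ^+ 4 = 1)%g.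
  by apply: val_inj; rewrite FinRing.val_unitX -[4]/(2 * 2) exprM /= i2 sqrrN expr1n.
have : 8 %| j * 4.
  apply: (@dvdn_trans p.-1).
    rewrite -subn1 -(eqn_mod_dvd _ (prime_gt0 p_pr)); exact/eqP.
  by rewrite -og order_dvdn expgM -uE; apply/eqP.
rewrite (_ : 8 = 2 * 4) // dvdn_pmul2r // => /dvdnP[k jE].
exists (val (g ^+ k)%g).
by rewrite -FinRing.val_unitX -expgM -jE -uE.
Qed.

(** * Translation lattices as ideals of Gaussian integers *)

Section Lattices.
Local Open Scope ring_scope.
Variables (p : nat) (b c m : int).
Hypotheses (p_pr : prime p) (b_gt0 : 0 < b) (c_gt0 : 0 < c) (p_eq : p%:Z = b ^+ 2 + c ^+ 2).

Lemma p_ndvd_c : ~~ (p%:Z %| c)%Z.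
Proof.
apply/negP=> /dvdzP[k kE]; have p0 := prime_gt0 p_pr.
have : c < p%:Z by rewrite p_eq; nia.
have : 0 < k by nia.
nia.
Qed.

Lemma lattice_dvd w : (p%:Z %| m)%Z ->
  lattice m 0 w -> (p%:Z %| c * w.1 - b * w.2)%Z.
Proof.
move=> pm [s [t [-> ->]]]; rewrite !mulr0 subr0 add0r.
by rewrite rpredB // !mulrA dvdz_mull.
Qed.

(** With [w = m (x + y i)], the prime p divides both parts of [(x + y i) (b - c i)]. Since
    [p = (b + c i) (b - c i)], the quotient [s + t i] satisfies [x + y i = (s + t i) (b + c i)]. *)
Lemma lattice_mul w : ~~ (p%:Z %| m)%Z ->
  lattice (m * b) (m * c) w <-> lattice m 0 w /\ (p%:Z %| c * w.1 - b * w.2)%Z.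
Proof.
move=> pm; case: w => w1 w2; split=> [[s [t [/= -> ->]]]|[[x [y [/= -> ->]]]]].
  split; first by exists (s * b - t * c), (s * c + t * b); split; rewrite /=; ring.
  apply/dvdzP; exists (- (m * t)); rewrite p_eq; ring.
have cop (a : int) : ~~ (p%:Z %| a)%Z -> coprimez p%:Z a.
  by rewrite coprimezE prime_coprime // dvdzE.
rewrite !mulr0 subr0 add0r => h.
have : (p%:Z %| (b * y - c * x) * m)%Z.
  by rewrite (_ : _ * m = - (c * (x * m) - b * (y * m))) ?rpredN //; ring.
rewrite Gauss_dvdzl ?cop // => /dvdzP[t tE].
(* The real part follows from the imaginary one by [c * (b * x + c * y) = p * y - b * (b * y - c *
   x)]. *)
have : (p%:Z %| (b * x + c * y) * c)%Z.
  apply/dvdzP; exists (y - b * t); rewrite p_eq.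
  have -> : (y - b * t) * (b ^+ 2 + c ^+ 2) =
      y * (b ^+ 2 + c ^+ 2) - b * (t * (b ^+ 2 + c ^+ 2)) by ring.
  by rewrite -p_eq -tE p_eq; ring.
rewrite Gauss_dvdzl ?cop ?p_ndvd_c // => /dvdzP[s sE].
have p0 : p%:Z != 0 by have := prime_gt0 p_pr; lia.
have xE : x = s * b - t * c.
  apply: (mulfI p0); transitivity (b * (b * x + c * y) - c * (b * y - c * x)).
    by rewrite p_eq; ring.
  by rewrite sE tE; ring.
have yE : y = s * c + t * b.
  apply: (mulfI p0); transitivity (c * (b * x + c * y) + b * (b * y - c * x)).
    by rewrite p_eq; ring.
  by rewrite sE tE; ring.
by exists s, t; rewrite xE yE; split; rewrite /=; ring.
Qed.

Lemma lattice_swap (b' c' x y : int) : lattice c' b' (x, y) <-> lattice b' c' (y, x).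
Proof.
by split=> -[s [t [/= -> ->]]]; exists s, (- t); split; rewrite /=; ring.
Qed.

Lemma lattice_swap0 x y : lattice m 0 (x, y) <-> lattice m 0 (y, x).
Proof.
by split=> -[s [t [/= -> ->]]]; exists t, s; split; rewrite /=; ring.
Qed.

End Lattices.

(** * The group of the given polytope acting on its flags *)

Section FlagAction.
Variables (d : Order.disp_t) (Q : finTBPOrderType d).
Hypothesis hQ : polytope Q 4.
Variable A0 : pflag Q.
Local Notation M := (flag_maniplex hQ A0).

Lemma flag_perm_sig (s : {perm Q}) :
  {f : {perm pflag Q} | s \in Gamma Q -> forall A, f A = flag_act s A}.
Proof.
case: (boolP (s \in Gamma Q)) => [sG|_]; last by exists 1%g.
by exists (perm (flag_act_inj sG)) => _ A; rewrite permE.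
Qed.

Definition act_perm s : {perm pflag Q} := sval (flag_perm_sig s).

Lemma act_permE s A : s \in Gamma Q -> act_perm s A = flag_act s A.
Proof. by move=> sG; apply: (svalP (flag_perm_sig s)). Qed.

Lemma act_perm_maut s : s \in Gamma Q -> act_perm s \in maut M.
Proof.
by move=> sG; apply/mautP=> i A; rewrite !act_permE //; apply: flag_act_padj.
Qed.

Hypotheses (hreg : regular Q) (hrot : #|Gamma Q : rotation_group 4 (val A0)|%g = 2).

Lemma act_trans (A B : M) : exists2 f, f \in maut M & f A = B.
Proof.
have [s sG sE] := flag_trans hreg A B; exists (act_perm s); first exact: act_perm_maut.
by rewrite act_permE.
Qed.

Lemma isog_rotation :
  rotation_group 4 (val A0) \isog epar (M := M) (odd_flag 4 A0).
Proof.
have rG := subsetP (rot_sub hQ hreg hrot).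
have mM : {in rotation_group 4 (val A0) &, {morph act_perm : s t / (s * t)%g}}.
  move=> s t /rG sG /rG tG; apply/permP=> A.
  by rewrite permM !act_permE ?groupM // flag_actM.
apply/isogP; exists (Morphism mM).
  apply/injmP=> s t /rG sG /rG tG /= E; apply: (flag_act_eq hQ (A := A0)) => //.
  by rewrite -!act_permE // E.
rewrite morphimEdom; apply/setP=> f; apply/imsetP/eparP => [[s sr ->]|[fM fp]].
  split=> [|A]; first exact/act_perm_maut/rG.
  by rewrite /= (act_permE A (rG _ sr)); apply: (odd_rot hQ hreg hrot).
have [s sr sE] := rot_trans hQ hreg hrot (esym (fp A0)).
exists s => //=; apply: (maut_eq (x := A0 : M)) => //; first exact/act_perm_maut/rG.
by rewrite (act_permE A0 (rG _ sr)).
Qed.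

(** The duality is followed by an automorphism bringing the image of [A0] back to [A0]. Since it
    fixes one flag and permutes the moves, the result keeps every parity. *)
Lemma dual_flags : self_dual Q -> exists dq : M -> M,
  [/\ forall i x, dq (adj i x) = adj (rev_ord i) (dq x),
      forall x, odd_flag 4 A0 (dq x) = odd_flag 4 A0 x & injective dq].
Proof.
case=> s sd; have [g gG gE] := flag_trans hreg (flag_act s A0) A0.
pose dq A := flag_act g (flag_act s A).
have dq_adj i A : dq (padj hQ i A) = padj hQ (rev_ord i) (dq A).
  by rewrite /dq (dual_padj _ sd) flag_act_padj.
exists dq; split=> [i x|x|]; first exact: dq_adj.
  apply: (link_ind (P := fun x => odd_flag 4 A0 (dq x) = odd_flag 4 A0 x)) (padj_link_all hQ A0 x).
    by rewrite /dq gE.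
  by move=> i A _ _ E; rewrite dq_adj !(odd_padj hQ hreg hrot) E.
by apply: inj_comp; [apply: flag_act_inj | apply: dual_act_inj].
Qed.

End FlagAction.

Theorem theorem8p1 (p : nat) (b c m : int)
    (d : Order.disp_t) (Q : finTBPOrderType d) (Phi : {set Q})
    (p_prime : prime p) (p_mod8 : p = 1 %[mod 8])
    (b_gt0 : (0 < b)%R) (c_gt0 : (0 < c)%R)
    (p_eq : (p%:Z = b ^+ 2 + c ^+ 2)%R)
    (m_odd : odd `|m|%N)
    (Q_polytope : polytope Q 4)
    (Q_self_dual : self_dual Q)
    (Q_directly_regular : directly_regular Q 4)
    (Q_type : has_type Q 4 (toroid m 0%R) (toroid m 0%R))
    (Phi_flag : flag Phi)
    (Q_order : ~~ (p * (p ^ 2 - 1) %| #|Gamma Q|)) :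
  exists (d' : Order.disp_t) (P : finTBPOrderType d'),
    [/\ polytope P 4, chiral P, properly_self_dual P,
        Gamma P \isog setX (PSL2 p) (rotation_group 4 Phi)
      & ((p%:Z %| m)%Z -> has_type P 4 (toroid m 0%R) (toroid m 0%R)) /\
        (~~ (p%:Z %| m)%Z ->
           has_type P 4 (toroid (m * b)%R (m * c)%R)
                        (toroid (m * c)%R (m * b)%R))].
Proof.
have [hreg hrot0] := Q_directly_regular.
pose A0 : pflag Q := Sub Phi Phi_flag.
have hrot : #|Gamma Q : rotation_group 4 (val A0)|%g = 2 by apply: hrot0.
pose M := flag_maniplex Q_polytope A0.
have [dq [dq_adj dq_par dq_inj]] := dual_flags Q_polytope hreg hrot (A0 := A0) Q_self_dual.
have rF : (rank (pface Q_polytope A0 (inord 4)) = 4%:Z - 1)%R.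
  by rewrite (levE Q_polytope) lev_pface inordK.
have [f f_mono f_img] := Q_type.1 _ rF.
have [mu muC mu_fib] := toroid_chart Q_polytope A0 m_odd rF f_mono f_img.
have p8 : p %% 8 = 1 by rewrite p_mod8.
have pFp := pchar_Fp p_prime.
(* A prime vanishing in ['F_p] equals p, hence is 1 modulo 8; this excludes 2, 3 and 5. *)
have nat_neq0 q : prime q -> q %% 8 != 1 -> (q%:R : 'F_p)%R != 0%R.
  move=> q_pr q8; rewrite -(dvdn_pcharf pFp) dvdn_prime2 //.
  by apply: contraNneq q8 => <-; rewrite p8.
have h2 := nat_neq0 2 isT isT.
have h15 : (15%:R : 'F_p)%R != 0%R.
  by rewrite (_ : 15 = 3 * 5) // natrM mulf_neq0 ?nat_neq0.
have c0 : (c%:~R : 'F_p)%R != 0%R.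
  by rewrite -(dvdz_pcharf pFp); apply: (p_ndvd_c p_prime b_gt0 c_gt0 p_eq).
have E : ((b%:~R ^+ 2 = - c%:~R ^+ 2 :> 'F_p))%R.
  apply/eqP; rewrite -addr_eq0; apply/eqP.
  by rewrite -!rmorphXn -rmorphD /= -p_eq -pmulrn; apply: pchar_Fp_0.
(* This root of -1 sends [b + c i] to 0; it decides that the facets get the lattice of
   [(mb, mc)]. *)
have i2 : ((- (b%:~R / c%:~R)) ^+ 2 = -1 :> 'F_p)%R.
  by rewrite sqrrN expr_div_n E mulNr divff // expf_neq0.
have [z z2] := Fp_sqrt p_prime p_mod8 i2.
have z4 : (z ^+ 4 = -1)%R by rewrite -[4]/(2 * 2)%N exprM z2.
have affP w : aff z w East = 1%g <-> (p%:Z %| c * w.1 - b * w.2)%Z%R.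
  rewrite (dvdz_pcharf pFp).
  have <- : (c%:~R * phi z w = (c * w.1 - b * w.2)%:~R)%R.
    by rewrite /phi z2 rmorphB !rmorphM /=; field.
  rewrite mulf_eq0 (negPf c0) /= aff_East.
  by split=> [Tw|/eqP->]; [apply/eqP/(@Tm_inj p); rewrite Tw Tm0 | rewrite Tm0].
pose par := odd_flag 4 A0; pose K := subg_of (PSL2 p).
have iso_rot : rotation_group 4 (val A0) \isog epar (M := M) par.
  exact: (@isog_rotation _ _ Q_polytope A0 hreg hrot).
(* The index 2 of the rotation group cancels the factor 2 of [card_PSL]. *)
have K_card : ~~ (#|[set: K]| %| #|epar (M := M) par|).
  apply: contra Q_order => dK; apply: dvdn_trans (card_PSL p_prime) _.
  rewrite -(Lagrange (rot_sub Q_polytope hreg (Phi := A0) hrot)) hrot mulnC dvdn_pmul2r //.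
  by rewrite (card_isog iso_rot).
(* Only the type depends on whether p divides [m], so the construction is run once for any lattice
   of translations with trivial voltage. *)
have main (b' c' b2 c2 : int) :
    (forall w, lattice b' c' w <-> lattice m 0%R w /\ aff z w East = 1%g) ->
    (forall x y, lattice b2 c2 (x, y) <-> lattice b' c' (y, x)) ->
    exists (d' : Order.disp_t) (P : finTBPOrderType d'),
    [/\ polytope P 4, chiral P, properly_self_dual P,
        Gamma P \isog setX (PSL2 p) (rotation_group 4 Phi)
      & has_type P 4 (toroid b' c') (toroid b2 c2)].
  move=> lat1 lat2.
  have uniE w : unipotent (aff z w East) by rewrite aff_East; eexists.
  have par_adj (i : 'I_4) (x : M) : par (adj i x) = ~~ par x.
    exact: (odd_padj Q_polytope hreg hrot).
  have mtrans (x y : M) : exists2 f, f \in maut M & f x = y by apply: act_trans.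
  have simp := fun N x => @simple_PSL p N x h2 h15.
  have cent := fun x => @center_PSL p x h2 h15.
  have [d' [P [h1 h3 h4 h5 h6]]] := cover_polytope (cv := volt z) (M := M) (par := par) (erefl _)
    (volt_far z4) (aff_volt0 z4) (aff_volt2 z4) (aff_shift z4) uniE
    (unipotent_aff z4) (unipotent_volt2V z4) (pdualM z4 h2) (pdualK z4 h2)
    (pdual_volt z4 h2) (unipotent_pdual (z4 := z4) (h2 := h2))
    par_adj dq_adj dq_par dq_inj mtrans
    muC mu_fib (gen_volt z4 h2) simp cent K_card (volt_chir1 z4) (volt_chir2 z4)
    (volt_chir3 z4 h2) lat1 lat2.
  exists d', P; split=> //; apply: isog_trans h5 _; apply: isog_setX.
    by rewrite isog_sym; apply: isog_subg.
  by rewrite isog_sym.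
(* When p divides [m], every translation trivial in the facet of [Q] already has trivial voltage, so
   the facets do not grow. *)
have [pm|pm] := boolP (p%:Z %| m)%Z%R.
  have [w|d' [P [h1 h3 h4 h5 h6]]] := main m 0%R m 0%R _ (lattice_swap0 m).
    by split=> [wL|[]//]; split=> //; apply/affP; apply: lattice_dvd wL.
  by exists d', P; split.
have [w|d' [P [h1 h3 h4 h5 h6]]] :=
    main (m * b)%R (m * c)%R (m * c)%R (m * b)%R _ (lattice_swap _ _).
  rewrite (lattice_mul p_prime b_gt0 c_gt0 p_eq w pm).
  by split=> -[wL /affP w1].
by exists d', P; split.
Qed.
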